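(* Let $\Gamma$ be a non-uniform lattice in $\operatorname{PSL}(2,\mathbb{R})$. If $$\lim_{n\to \infty}\frac{\#\{\mathrm{Tr}(\Gamma)\cap [-n,n]\}}{n\log\log\log n}=0,$$ then $\Gamma$ is arithmetic.
   Context: For $\Gamma\le\operatorname{PSL}(2,\mathbb{R})$ with projection $p:\operatorname{SL}(2,\mathbb{R})\to\operatorname{PSL}(2,\mathbb{R})$, the trace set is $\mathrm{Tr}(\Gamma)=\{\mathrm{tr}\,T : T\in p^{-1}(\Gamma)\}$. A lattice is non-uniform if $\operatorname{PSL}(2,\mathbb{R})/\Gamma$ has finite Haar measure but is not compact. A Fuchsian group is arithmetic if it is commensurable with a group $P\rho(\mathcal{O}^1)$, where $k$ is a totally real number field, $A$ a quaternion algebra over $k$ ramified at all real places except the identity one, $\rho:A\otimes_{\mathbb{Q}}\mathbb{R}\cong M(2,\mathbb{R})\oplus\mathbf{H}\oplus\cdots\oplus\mathbf{H}$, $P$ the projection to the first factor, $\mathcal{O}$ an order in $A$ and $\mathcal{O}^1$ its elements of reduced norm $1$. For functions partially defined for large $n$ (like $\log\log\log n$), the value is taken to be $1$ outside the domain. *)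

(* Defs.v *)
From HB Require Import structures.
From mathcomp Require Import all_boot all_order all_algebra.
From mathcomp Require Import all_classical all_reals all_analysis.
From mathcomp.real_closed Require Import complex.

Set Implicit Arguments.
Unset Strict Implicit.
Unset Printing Implicit Defensive.

Import Order.TTheory GRing.Theory Num.Theory.
Import numFieldNormedType.Exports.
Local Open Scope classical_set_scope.
Local Open Scope ring_scope.

Section Fuchsian.
Variable R : realType.

(* A subgroup Gamma <= PSL(2,R) is represented by its full preimage
   Gt = p^{-1}(Gamma) in SL(2,R): a subgroup of SL(2,R) containing -1.
   This is a bijective correspondence. *)
Definition PSL_subgroup_preimage (G : set 'M[R]_2) : Prop :=
  [/\ (forall g, G g -> \det g = 1),
      G 1, G (-1),
      (forall g h, G g -> G h -> G (g *m h)) &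
      (forall g, G g -> G (invmx g))].

Definition trace_set (G : set 'M[R]_2) : set R :=
  [set t | exists g, G g /\ \tr g = t].

Definition discrete_subset (G : set 'M[R]_2) : Prop :=
  forall g, G g -> \forall h \near g, G h -> h = g.

(* upper half plane, points written (x, y) for x + i y *)
Definition Hplane : set (R * R) := [set p | 0 < p.2].

Definition mobius (g : 'M[R]_2) (p : R * R) : R * R :=
  let a := g ord0 ord0 in let b := g ord0 ord_max in
  let c := g ord_max ord0 in let d := g ord_max ord_max in
  let x := p.1 in let y := p.2 in
  let den := (c * x + d) ^+ 2 + (c * y) ^+ 2 in
  (((a * x + b) * (c * x + d) + a * c * y ^+ 2) / den, (\det g * y) / den).

Definition hyp_area (F : set (R * R)) : \bar R :=
  (\int[(@lebesgue_measure R \x @lebesgue_measure R)%E]_(p in F)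
     ((p.2 ^+ 2)^-1)%:E)%E.

Definition fundamental_domain (G : set 'M[R]_2) (F : set (R * R)) : Prop :=
  [/\ measurable F, F `<=` Hplane,
      (forall z, Hplane z -> exists g, G g /\ F (mobius g z)) &
      (forall z g, F z -> G g -> F (mobius g z) -> mobius g z = z)].

(* Gamma is a lattice: discrete, with PSL(2,R)/Gamma of finite Haar measure,
   i.e. Gamma\H of finite hyperbolic area *)
Definition lattice (G : set 'M[R]_2) : Prop :=
  discrete_subset G /\
  exists F, fundamental_domain G F /\ (hyp_area F < +oo)%E.

(* PSL(2,R)/Gamma compact  <->  Gamma\H compact *)
Definition cocompact (G : set 'M[R]_2) : Prop :=
  exists K : set (R * R), [/\ compact K, K `<=` Hplane &
    forall z, Hplane z -> exists g, G g /\ K (mobius g z)].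

Definition nonuniform_lattice (G : set 'M[R]_2) : Prop :=
  lattice G /\ ~ cocompact G.

(* a subfield k of R (the identity real place) which is a number field *)
Definition subfield (k : set R) : Prop :=
  [/\ k 1,
      (forall x y, k x -> k y -> k (x - y)),
      (forall x y, k x -> k y -> k (x * y)) &
      (forall x, k x -> x != 0 -> k x^-1)].

Definition number_field (k : set R) : Prop :=
  subfield k /\
  exists s : seq R, (forall e, e \in s -> k e) /\
    forall x, k x -> exists q : 'I_(size s) -> rat,
      x = \sum_(i < size s) ratr (q i) * s`_i.

(* a ring embedding of k into T (a map R -> T, only its restriction to k matters) *)
Definition field_embedding (k : set R) (T : pzRingType) (s : R -> T) : Prop :=
  [/\ s 1 = 1,
      (forall x y, k x -> k y -> s (x + y) = s x + s y) &
      (forall x y, k x -> k y -> s (x * y) = s x * s y)].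

Definition totally_real (k : set R) : Prop :=
  forall s : R -> R[i], field_embedding k s ->
    forall x, k x -> complex.Im (s x) = 0.

(* The quaternion algebra A = (a, b)_k, with basis 1, i, j, ij,
   i^2 = a, j^2 = b, ij = -ji, is ramified at every real place
   sigma of k other than the identity one, and split at the identity one
   ((a,b)_R is ramified iff a < 0 and b < 0). *)
Definition ramified_except_identity (k : set R) (a b : R) : Prop :=
  ~ (a < 0 /\ b < 0) /\
  forall s : R -> R, field_embedding k s -> (exists2 x, k x & s x != x) ->
    s a < 0 /\ s b < 0.

(* Image P rho (A) in M(2,R) of A = (a,b)_k, where P rho maps i |-> I, j |-> J
   (P rho restricted to A is a k-algebra map to M(2,R), k acting by scalars). *)
Definition quat_image (k : set R) (I J : 'M[R]_2) : set 'M[R]_2 :=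
  [set m | exists x0 x1 x2 x3, [/\ k x0, k x1, k x2, k x3 &
      m = x0%:M + x1 *: I + x2 *: J + x3 *: (I *m J)]].

Definition order_image (k : set R) (I J : 'M[R]_2) (O : set 'M[R]_2) : Prop :=
  [/\ O `<=` quat_image k I J, O 1,
      (forall x y, O x -> O y -> O (x - y)),
      ((forall x y, O x -> O y -> O (x *m y)) /\
       (exists s : seq 'M[R]_2, (forall e, e \in s -> O e) /\
         forall x, O x -> exists n : 'I_(size s) -> int,
           x = \sum_(i < size s) (s`_i *~ n i))) &
      (forall x, quat_image k I J x -> exists2 m : nat, (0 < m)%N & O (x *+ m))].

(* the elements of reduced norm 1 (reduced norm = det after P rho) *)
Definition norm_one (O : set 'M[R]_2) : set 'M[R]_2 :=
  [set m | O m /\ \det m = 1].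

Definition finite_index (G K : set 'M[R]_2) : Prop :=
  exists s : seq 'M[R]_2, (forall h, h \in s -> G h) /\
    forall g, G g -> exists2 h, h \in s & K (invmx h *m g).

Definition commensurable (G H : set 'M[R]_2) : Prop :=
  finite_index G (G `&` H) /\ finite_index H (G `&` H).

Definition arithmetic_group (G : set 'M[R]_2) : Prop :=
  exists (k : set R) (a b : R) (I J : 'M[R]_2) (O : set 'M[R]_2),
    [/\ number_field k, totally_real k,
        [/\ k a, k b, a != 0 & b != 0],
        ramified_except_identity k a b &
      [/\ [/\ I *m I = a%:M, J *m J = b%:M & I *m J = - (J *m I)],
        order_image k I J O &
        commensurable G (norm_one O)]].

(* log log log n, taken to be 1 outside its domain (n <= e) *)
Definition lll (n : nat) : R :=
  if expR (1 : R) < n%:R then ln (ln (ln (n%:R : R))) else 1.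

End Fuchsian.

(* Main.v *)
Require Import Defs.
From HB Require Import structures.
From mathcomp Require Import all_boot all_order all_fingroup all_algebra.
From mathcomp Require Import all_classical all_reals all_analysis.
From mathcomp.real_closed Require Import complex.
From mathcomp Require Import measurable_realfun ring lra zify.

Import Order.TTheory GRing.Theory Num.Theory.
Import numFieldNormedType.Exports.
Local Open Scope classical_set_scope.
Local Open Scope ring_scope.

(* Integrating over a fundamental domain of finite area bounds the number of
   well-separated translates of a box ([packing]).  If the quotient is not
   compact, this and the discreteness of the trace set produce a parabolic
   element, so after conjugation the group contains T = [1 1; 0 1].  The traces of
   g T^n h T^m are values of c c' (n + x) (m + y) + const; were x irrational, these
   values would be pairwise distinct and there would be about X log X of them up
   to X.  Hence all products of two entries of an element are rational (after
   another conjugation).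
   If h has rational entries and tr h = e / f with f > 1, then
   tr (h^k T^m h T^n) takes the values alpha N + const, with alpha of size f^-k,
   for all products N of two integers congruent to P modulo q, where
   q alpha = O(f^-k).  The multiplication table of a residue class
   has density at least 1 / (32 q) at some scale Z whose triple logarithm is
   O(log q), so the number of traces exceeds f^k / O(k) times the assumed bound:
   traces of rational elements are integers.  For the density, the weighted
   proportion of N whose divisors miss some class of units modulo q is
   multiplied by at most 3/5 each time the exponent 1 + d of the weight N^-(1 + d) is
   replaced by 1 + d^2 / (80 q), because adding to a subset A of the
   unit group a random translate of A halves 1/|A| - 1/|(Z/q)^*| on average.
   Integral traces bound the denominators of all entries, so that finitely many
   congruence conditions cut out the integral matrices; the converse finiteness
   comes from the packing inequality again. *)

Set Implicit Arguments.
Unset Strict Implicit.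
Unset Printing Implicit Defensive.

(** * Two-by-two matrices through their entries *)

Section TwoByTwo.
Context {F : fieldType}.
Implicit Types a b c d : F.

(** Both exponents of T are free, so only the product N of the two integers is bounded, not its
    factors. Hence N is admissible as soon as it lies in the class of P^2 modulo q and has a divisor
    in the class of P; that whole class has density 1 / q, and at a suitable scale a fixed
    proportion of it is admissible. This scale decides how strong a hypothesis on the traces is
    needed. A set missing one class of units is only known to have defect at least q^-2, and the
    class of P^2 carries a share 1 / q of the integers, so the weighted defect has to fall below a
    constant times q^-3. At a factor 3/5 per step this takes O(log q) steps. Each step squares d up
    to a factor, so that 1 / d ends as q to the power 2^O(log q), and the weight N^-(1 + d) is
    spread over N up to (8 q)^(1 / d). Hence the three exponentials. Finally log q is linear in k,
    whereas q times the spacing of the traces decays geometrically in k. *)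

Definition mx2 a b c d : 'M[F]_2 :=
  \matrix_(i, j) (if i == ord0 then if j == ord0 then a else b
                  else if j == ord0 then c else d).

Lemma mx2_00 a b c d : mx2 a b c d ord0 ord0 = a. Proof. by rewrite mxE. Qed.
Lemma mx2_01 a b c d : mx2 a b c d ord0 ord_max = b. Proof. by rewrite mxE. Qed.
Lemma mx2_10 a b c d : mx2 a b c d ord_max ord0 = c. Proof. by rewrite mxE. Qed.
Lemma mx2_11 a b c d : mx2 a b c d ord_max ord_max = d. Proof. by rewrite mxE. Qed.
Definition mx2E := (mx2_00, mx2_01, mx2_10, mx2_11).

Lemma ord2P (i : 'I_2) : (i = ord0) + (i = ord_max).
Proof.
case: (i =P ord0) => [|i0]; [by left | right]; apply: val_inj => /=.
by case: i i0 => [[|[|n]]] //= H i0; case: i0; apply: val_inj.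
Qed.

Lemma mx2_eta (g : 'M[F]_2) :
  g = mx2 (g ord0 ord0) (g ord0 ord_max) (g ord_max ord0) (g ord_max ord_max).
Proof.
by apply/matrixP => i j; case: (ord2P i) => ->; case: (ord2P j) => ->; rewrite mx2E.
Qed.

Lemma mx2_ex (g : 'M[F]_2) : exists a b c d, g = mx2 a b c d.
Proof. by do 4!eexists; exact: mx2_eta. Qed.

Lemma mx2_inj a b c d a' b' c' d' : mx2 a b c d = mx2 a' b' c' d' ->
  [/\ a = a', b = b', c = c' & d = d'].
Proof.
move=> E; split.
- by have := congr1 (fun m : 'M[F]_2 => m ord0 ord0) E; rewrite !mx2E.
- by have := congr1 (fun m : 'M[F]_2 => m ord0 ord_max) E; rewrite !mx2E.
- by have := congr1 (fun m : 'M[F]_2 => m ord_max ord0) E; rewrite !mx2E.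
- by have := congr1 (fun m : 'M[F]_2 => m ord_max ord_max) E; rewrite !mx2E.
Qed.

Lemma lift00 : lift ord0 ord0 = ord_max :> 'I_2. Proof. exact: val_inj. Qed.

Lemma mulmx2 a b c d a' b' c' d' : mx2 a b c d *m mx2 a' b' c' d' =
  mx2 (a * a' + b * c') (a * b' + b * d') (c * a' + d * c') (c * b' + d * d').
Proof.
apply/matrixP => i j; rewrite mxE !big_ord_recl big_ord0 lift00 addr0.
by case: (ord2P i) => ->; case: (ord2P j) => ->; rewrite !mx2E.
Qed.

Lemma addmx2 a b c d a' b' c' d' : mx2 a b c d + mx2 a' b' c' d' =
  mx2 (a + a') (b + b') (c + c') (d + d').
Proof. by apply/matrixP => i j; rewrite mxE; case: (ord2P i) => ->; case: (ord2P j) => ->; rewrite !mx2E. Qed.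

Lemma oppmx2 a b c d : - mx2 a b c d = mx2 (- a) (- b) (- c) (- d).
Proof. by apply/matrixP => i j; rewrite mxE; case: (ord2P i) => ->; case: (ord2P j) => ->; rewrite !mx2E. Qed.

Lemma scalemx2 k a b c d : k *: mx2 a b c d = mx2 (k * a) (k * b) (k * c) (k * d).
Proof. by apply/matrixP => i j; rewrite mxE; case: (ord2P i) => ->; case: (ord2P j) => ->; rewrite !mx2E. Qed.

Lemma scalar_mx2 k : k%:M = mx2 k 0 0 k.
Proof. by apply/matrixP => i j; rewrite mxE; case: (ord2P i) => ->; case: (ord2P j) => ->; rewrite !mx2E. Qed.

Lemma det_mx22 a b c d : \det (mx2 a b c d) = a * d - b * c.
Proof.
rewrite (expand_det_row _ ord0) !big_ord_recl big_ord0 lift00 addr0 /cofactor !mx2E.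
rewrite !det_mx11 !mxE /= !addn0 addn1 expr0 expr1 mul1r mulN1r mulrN.
by [].
Qed.

Lemma detE (g : 'M[F]_2) : \det g = g ord0 ord0 * g ord_max ord_max - g ord0 ord_max * g ord_max ord0.
Proof. by rewrite {1}(mx2_eta g) det_mx22. Qed.

Lemma tr_mx22 a b c d : \tr (mx2 a b c d) = a + d.
Proof. by rewrite /mxtrace !big_ord_recl big_ord0 lift00 addr0 !mx2E. Qed.

Lemma invmx2 a b c d : a * d - b * c = 1 -> invmx (mx2 a b c d) = mx2 d (- b) (- c) a.
Proof.
move=> D; have E : mx2 d (- b) (- c) a *m mx2 a b c d = 1%:M.
  by rewrite mulmx2 scalar_mx2 -D; congr mx2; ring.
have u : mx2 a b c d \in unitmx by rewrite unitmxE det_mx22 D unitr1.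
by rewrite -[RHS]mulmx1 -(mulmxV u) mulmxA E mul1mx.
Qed.
End TwoByTwo.

(** * Invariance of the hyperbolic area *)

Section LogarithmicMeasure.
Local Open Scope ereal_scope.
Context {R : realType}.
Notation mu := (@lebesgue_measure R).
Implicit Types f : R -> \bar R.

Lemma preimage_itv_affine (a t : R) (x : R * R) : (0 < a)%R ->
  ((fun z : R => (a * z + t)%R) @^-1` `]x.1, x.2] = `](x.1 - t) / a, (x.2 - t) / a]%classic)%R.
Proof.
move=> a0; apply/seteqP; split => z /=; rewrite !in_itv /=
  ltr_pdivrMr // ler_pdivlMr // ltrBlDr lerBrDr (mulrC z); by [].
Qed.

Lemma lebesgue_measure_affine (a t : R) (A : set R) : (0 < a)%R -> measurable A ->
  pushforward mu ((fun x : R => (a * x + t)%R) : _ -> measurableTypeR R) A = a^-1%:E * mu A.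
Proof.
move=> a0 mA.
have mphi : measurable_fun [set: measurableTypeR R] ((fun x : R => (a * x + t)%R) : _ -> measurableTypeR R).
  by apply: measurable_funD => //; apply: measurable_funM.
pose k : {nonneg R} := NngNum (ltW a0).
pose m := mscale k (measure_function_pushforward__canonical__measure_function_Measure mu mphi).
have -> : mu A = m A.
  apply: lebesgue_measure_unique => // _ [x _ <-].
  rewrite [RHS](_ : _ = k%:num%:E * mu ((fun z : R => (a * z + t)%R) @^-1` `]x.1, x.2])) // preimage_itv_affine //.
  rewrite !lebesgue_measure_itv /= !lte_fin.
  rewrite ltr_pM2r ?invr_gt0 // ltrD2r; case: ifPn => _; last by rewrite mule0.
  rewrite -!EFinD -EFinM; congr (_%:E); field; lra.
rewrite /m /mscale /= muleA -EFinM mulVf ?mul1e //; lra.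
Qed.

Lemma integral_affine f (a t : R) : (0 < a)%R -> measurable_fun setT f -> (forall x, 0 <= f x) ->
  \int[mu]_x f (a * x + t)%R = a^-1%:E * \int[mu]_x f x.
Proof.
move=> a0 mf f0.
have mphi : measurable_fun [set: measurableTypeR R] ((fun x : R => (a * x + t)%R) : _ -> measurableTypeR R).
  by apply: measurable_funD => //; apply: measurable_funM.
have ai : (0 <= a^-1)%R by rewrite invr_ge0 ltW.
pose k : {nonneg R} := NngNum ai.
rewrite -[X in X * _]/(k%:num%:E) -(ge0_integral_mscale mu measurableT k mf) //.
rewrite -[LHS](@ge0_integral_pushforward _ _ _ _ _ _ mphi mu setT f measurableT mf); last by move=> *; exact: f0.
apply: eq_measure_integral => /= A mA _.
by rewrite /mscale /=; apply: lebesgue_measure_affine.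
Qed.

Lemma integral_reflect f : measurable_fun setT f -> (forall x, 0 <= f x) ->
  \int[mu]_x f (- x)%R = \int[mu]_x f x.
Proof.
move=> mf f0.
have mphi : measurable_fun [set: measurableTypeR R] ((fun x : R => (- x)%R) : _ -> measurableTypeR R).
  exact: oppr_measurable.
rewrite -[LHS](@ge0_integral_pushforward _ _ _ _ _ _ mphi mu setT f measurableT mf); last by move=> *; exact: f0.
apply: eq_measure_integral => /= A mA _; exact: lebesgue_measureN.
Qed.

Lemma measurable_inv : measurable_fun [set: R] (fun x : R => x^-1)%R.
Proof.
rewrite (_ : [set: R] = [set x | x != 0%R] `|` [set 0%R]); last first.
  by apply/seteqP; split => x //= _; case: (eqVneq x 0%R); [right|left].
have o : open [set x : R | x != 0%R] by exact: open_neq.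
apply/measurable_funU => //.
- exact: open_measurable.
- split; last exact: measurable_fun_set1.
  apply: open_continuous_measurable_fun => //.
  by move=> x /[!inE] /= x0; apply: continuousV => //; exact: cvg_id.
Qed.

Lemma measurable_pos d (T : measurableType d) (g : T -> R) :
  measurable_fun setT g -> measurable_fun setT (fun x => 0 < g x)%R.
Proof. by move=> mg; apply: measurable_fun_ltr. Qed.

(** Integrand against the Haar measure dy / y of the positive reals, extended by zero to the whole
    line. *)
Definition dlog (u : R -> \bar R) (y : R) := if (0 < y)%R then (y^-1)%:E * u y else 0.

Lemma dlog_ge0 u y : (forall y, 0 <= u y) -> 0 <= dlog u y.
Proof.
move=> u0; rewrite /dlog; case: ifPn => // y0; apply: mule_ge0 => //.
by rewrite lee_fin invr_ge0 ltW.
Qed.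

Lemma measurable_dlog2 d (T : measurableType d) (g : T -> R) (u : T -> \bar R) :
  measurable_fun setT g -> measurable_fun setT u ->
  measurable_fun setT (fun x => if (0 < g x)%R then ((g x)^-1)%:E * u x else 0).
Proof.
move=> mg mu'; apply: measurable_fun_ifT => //; first exact: measurable_pos.
apply: emeasurable_funM => //; apply/measurable_EFinP.
by apply: (measurableT_comp measurable_inv).
Qed.

Lemma measurable_dlog u : measurable_fun setT u -> measurable_fun setT (dlog u).
Proof. by move=> mu'; apply: measurable_dlog2. Qed.

Lemma dlog_scale u (k : R) : (0 < k)%R -> measurable_fun setT u -> (forall y, 0 <= u y) ->
  \int[mu]_y dlog (fun y => u (k * y)%R) y = \int[mu]_y dlog u y.
Proof.
move=> k0 mu' u0.
transitivity (\int[mu]_y (k%:E * dlog u (k * y + 0)%R)).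
  apply: eq_integral => y _; rewrite /dlog addr0 pmulr_rgt0 //; case: ifPn => y0; last by rewrite mule0.
  by rewrite muleA -EFinM invfM mulrA mulfV ?mul1r ?gt_eqF.
rewrite ge0_integralZl //; last by rewrite lee_fin ltW.
- rewrite integral_affine //; last by move=> x; apply: dlog_ge0.
    by rewrite muleA -EFinM mulfV ?mul1e ?gt_eqF.
  exact: measurable_dlog.
- have mf : measurable_fun [set: R] (fun x : R => k * x + 0)%R.
    by apply: measurable_funD => //; apply: measurable_funM.
  have H := measurableT_comp (measurable_dlog mu') mf; exact: H.
- by move=> y _; apply: dlog_ge0.
Qed.

Lemma integral_scale (k : \bar R) u : measurable_fun setT u -> (forall y, 0 <= u y) -> 0 <= k ->
  \int[mu]_y (k * u y) = k * \int[mu]_y u y.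
Proof. by move=> mu' u0 k0; rewrite ge0_integralZl. Qed.

Lemma invr_mule_ge0 (t : R) (v : \bar R) : (0 < t)%R -> 0 <= v -> 0 <= t^-1%:E * v.
Proof. by move=> t0 v0; apply: mule_ge0 => //; rewrite lee_fin invr_ge0 ltW. Qed.

Lemma mule4 (a b p q : \bar R) : a * (b * (p * q)) = b * p * (a * q).
Proof. by rewrite muleCA -!muleA; congr (_ * _); rewrite muleCA. Qed.

Lemma div_inv (t y : R) : (t / y = (t^-1 * y)^-1)%R.
Proof. by rewrite invfM invrK. Qed.

Lemma mule_cancel (k a b : \bar R) : 0 < k < +oo -> k * a = k * b -> a = b.
Proof.
case/andP => k0 ky E; have kf : k \is a fin_num by rewrite ge0_fin_numE ?(ltW k0).
by apply/eqP; rewrite eq_le -(lee_pmul2l kf k0 a b) -(lee_pmul2l kf k0 b a) E lexx.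
Qed.

Lemma half_one_pos (k : \bar R) : (2^-1)%:E <= k <= 1 -> 0 < k < +oo.
Proof.
case/andP => k1 k2; rewrite (lt_le_trans _ k1) ?lte_fin ?invr_gt0 //=.
exact: le_lt_trans k2 (ltry _).
Qed.

Let phi (s : R) : \bar R := (\1_(`[1%R, 2%R]%classic : set R) s)%:E.

Let mphi : measurable_fun [set: R] phi.
Proof. by apply/measurable_EFinP; exact: measurable_indic. Qed.

Let phi_ge0 s : 0 <= phi s. Proof. by rewrite lee_fin. Qed.

Let c := \int[mu]_y dlog phi y.

(** The value is ln 2; positivity and finiteness allow [c] to be cancelled in [dlog_inv]. *)
Let c_bound : (2^-1)%:E <= c <= 1.
Proof.
have E (r : R) : (0 <= r)%R -> \int[mu]_(x in `[1%R, 2%R]) (r%:E) = r%:E.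
  move=> r0; rewrite integral_cst //= lebesgue_measure_itv /= lte_fin ltr1n -EFinD.
  by rewrite -EFinM; congr (_%:E); ring.
have -> : c = \int[mu]_(x in `[1%R, 2%R]) (x^-1)%:E.
  rewrite /c [RHS]integral_mkcond; apply: eq_integral => y _.
  rewrite /dlog /phi patchE indicE; case: ifPn => y0.
    by case: ifPn => yi; rewrite ?mule1 ?mule0.
  case: ifPn => //; rewrite inE /= in_itv /= => /andP[y1 _].
  by move: y0; rewrite (lt_le_trans _ y1).
have mi : measurable_fun (`[1%R, 2%R]%classic : set R) (fun x : R => (x^-1)%:E).
  by apply/measurable_EFinP; apply: (measurable_funS measurableT _ measurable_inv).
have h (x : R) : `[1%R, 2%R]%classic x -> (2^-1 <= x^-1 <= 1)%R.
  rewrite /= in_itv /= => /andP[x1 x2].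
  rewrite lef_pV2 ?posrE ?invf_le1 //; lra.
apply/andP; split.
  rewrite -[X in X <= _]E ?invr_ge0 //; apply: ge0_le_integral => //.
  - by move=> x /h; rewrite lee_fin => /andP[].
rewrite -[X in _ <= X]E //; apply: ge0_le_integral => //.
- by move=> x /h /andP[h1 _]; rewrite lee_fin; apply: le_trans h1; rewrite invr_ge0.
- by move=> x /h; rewrite lee_fin => /andP[].
Qed.

Let KK (u : R -> \bar R) (p : R * R) : \bar R :=
  if (0 < p.1)%R then (p.1^-1)%:E * (if (0 < p.2)%R then (p.2^-1)%:E * (phi (p.1 * p.2)%R * u p.2) else 0) else 0.
Let LL (u : R -> \bar R) (p : R * R) : \bar R :=
  if (0 < p.1)%R then (p.1^-1)%:E * (if (0 < p.2)%R then (p.2^-1)%:E * (phi p.2 * u (p.2 / p.1)%R) else 0) else 0.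

(* Both sides are compared through the double integral of [phi (y t)] against [u], whose two
   iterated integrals are [c] times the two sides. *)
Lemma dlog_inv u : measurable_fun setT u -> (forall y, 0 <= u y) ->
  \int[mu]_y dlog (fun y => u (y^-1)%R) y = \int[mu]_y dlog u y.
Proof.
move=> mu' u0.
have m1 : measurable_fun [set: R * R] (fst : R * R -> R) by exact: measurable_fst.
have m2 : measurable_fun [set: R * R] (snd : R * R -> R) by exact: measurable_snd.
have mK : measurable_fun setT (KK u).
  apply: measurable_dlog2 => //; apply: measurable_dlog2 => //; apply: emeasurable_funM.
    exact: (measurableT_comp mphi (measurable_funM m1 m2)).
  exact: (measurableT_comp mu' m2).
have mL : measurable_fun setT (LL u).
  apply: measurable_dlog2 => //; apply: measurable_dlog2 => //; apply: emeasurable_funM.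
    exact: (measurableT_comp mphi m2).
  apply: (measurableT_comp mu' (measurable_funM m2 _)).
  exact: (measurableT_comp measurable_inv m1).
have K0 p : 0 <= KK u p.
  rewrite /KK; case: ifPn => // p1; apply: mule_ge0; first by rewrite lee_fin invr_ge0 ltW.
  by case: ifPn => // p2; do 2?[apply: mule_ge0 => //]; rewrite lee_fin invr_ge0 ltW.
have L0 p : 0 <= LL u p.
  rewrite /LL; case: ifPn => // p1; apply: mule_ge0; first by rewrite lee_fin invr_ge0 ltW.
  by case: ifPn => // p2; do 2?[apply: mule_ge0 => //]; rewrite lee_fin invr_ge0 ltW.
have mui : measurable_fun setT (fun y : R => u (y^-1)%R).
  exact: (measurableT_comp mu' measurable_inv).
have KL : \int[mu]_y \int[mu]_t KK u (y, t) = \int[mu]_y \int[mu]_t LL u (y, t).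
  apply: eq_integral => y _; rewrite /KK /LL /=; case: (boolP (0 < y)%R) => y0 //.
  have ms : measurable_fun [set: R] (fun t : R => t / y)%R by apply: measurable_funM.
  have my : measurable_fun [set: R] (fun t : R => y * t)%R by apply: measurable_funM.
  rewrite !ge0_integralZl ?lee_fin ?invr_ge0 ?(ltW y0) //; last 4 first.
  - apply: measurable_dlog2 => //; apply: emeasurable_funM => //.
    exact: (measurableT_comp mu' ms).
  - by move=> t _; case: ifPn => // t0; do 2?[apply: mule_ge0 => //]; rewrite lee_fin invr_ge0 ltW.
  - apply: measurable_dlog2 => //; apply: emeasurable_funM => //.
    exact: (measurableT_comp mphi my).
  - by move=> t _; case: ifPn => // t0; do 2?[apply: mule_ge0 => //]; rewrite lee_fin invr_ge0 ltW.
  congr (_ * _).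
  rewrite -[RHS](@dlog_scale (fun t => phi t * u (t / y)%R) y y0) //.
  - apply: eq_integral => t _; rewrite /dlog.
    by case: ifPn => // t0; rewrite mulrAC mulfV ?mul1r ?gt_eqF.
  - apply: emeasurable_funM => //; exact: (measurableT_comp mu' ms).
  - by move=> t; apply: mule_ge0.
have IK : \int[mu]_y \int[mu]_t KK u (y, t) = c * \int[mu]_y dlog u y.
  have FK := fubini_tonelli (m1 := mu) (m2 := mu) (KK u) mK K0.
  etransitivity; first exact: FK.
  have c0 : 0 <= c by have /andP[h _] := c_bound; apply: le_trans h; rewrite lee_fin.
  rewrite -(integral_scale (measurable_dlog mu') (fun y => dlog_ge0 y u0) c0).
  apply: eq_integral => t _; rewrite /KK /dlog /=.
  case: (boolP (0 < t)%R) => t0; last first.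
    rewrite mule0; under eq_integral do rewrite mule0 if_same.
    by rewrite integral0.
  have k0 : 0 <= t^-1%:E * u t := invr_mule_ge0 t0 (u0 t).
  rewrite muleC /c -(dlog_scale t0 mphi phi_ge0).
  have mt : measurable_fun [set: R] (fun y : R => t * y)%R by apply: measurable_funM.
  have mpt : measurable_fun [set: R] (fun y : R => phi (t * y)%R) by exact: (measurableT_comp mphi mt).
  rewrite -(integral_scale (measurable_dlog mpt) (fun y => dlog_ge0 y (fun z => phi_ge0 (t * z)%R)) k0).
  apply: eq_integral => y _; rewrite /dlog; case: ifPn => y0; last by rewrite mule0.
  by rewrite (mulrC y t) [RHS]muleCA; congr (_ * _); rewrite [in LHS](muleC (phi _)) muleA.
have IL : \int[mu]_y \int[mu]_t LL u (y, t) = c * \int[mu]_y dlog (fun y => u (y^-1)%R) y.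
  have FL := fubini_tonelli (m1 := mu) (m2 := mu) (LL u) mL L0.
  etransitivity; first exact: FL.
  have c0 : 0 <= \int[mu]_y dlog (fun y => u (y^-1)%R) y by apply: integral_ge0 => y _; apply: dlog_ge0.
  rewrite muleC -(integral_scale (measurable_dlog mphi) (fun y => dlog_ge0 y phi_ge0) c0).
  apply: eq_integral => t _; rewrite /LL /=.
  rewrite [X in _ = _ * X]/dlog; case: (boolP (0 < t)%R) => t0; last first.
    rewrite mule0; under eq_integral do rewrite mule0 if_same.
    by rewrite integral0.
  have ti : (0 < t^-1)%R by rewrite invr_gt0.
  have k0 : 0 <= t^-1%:E * phi t := invr_mule_ge0 t0 (phi_ge0 t).
  have mt : measurable_fun [set: R] (fun y : R => t^-1 * y)%R by apply: measurable_funM.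
  have mut := measurableT_comp mui mt.
  have E1 := dlog_scale ti mui (fun y => u0 _).
  have E2 := integral_scale (measurable_dlog mut) (fun y => dlog_ge0 y (fun z => u0 _)) k0.
  rewrite muleC -E1; etransitivity; last exact: E2.
  apply: eq_integral => y _; rewrite /dlog; case: ifPn => y0; last by rewrite mule0.
  rewrite (div_inv t y); exact: mule4.
exact: (mule_cancel (half_one_pos c_bound) (etrans (esym IL) (etrans (esym KL) IK))).
Qed.
End LogarithmicMeasure.

(** * Integration over the upper half-plane *)

Section HyperbolicArea.
Local Open Scope ereal_scope.
Context {R : realType}.
Notation mu := (@lebesgue_measure R).
Implicit Types f : R * R -> \bar R.

Definition upper_density f (p : R * R) : \bar R :=
  if (0 < p.2)%R then ((p.2 ^+ 2)^-1)%:E * f p else 0.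

Definition area_int f := \int[(mu \x mu)%E]_p upper_density f p.

Lemma upper_density_ge0 f p : (forall p, 0 <= f p) -> 0 <= upper_density f p.
Proof.
move=> f0; rewrite /upper_density; case: ifPn => // _; apply: mule_ge0 => //.
by rewrite lee_fin invr_ge0 sqr_ge0.
Qed.

Lemma measurable_upper_density f :
  measurable_fun setT f -> measurable_fun setT (upper_density f).
Proof.
move=> mf; apply: measurable_fun_ifT => //.
- exact: (measurable_pos measurable_snd).
- apply: emeasurable_funM => //; apply/measurable_EFinP.
  have m2 : measurable_fun [set: R * R] (fun p : R * R => p.2 ^+ 2)%R.
    exact: (measurable_funX 2 measurable_snd).
  exact: (measurableT_comp measurable_inv m2).
Qed.

Lemma area_int_ext f g : (forall p, (0 < p.2)%R -> f p = g p) -> area_int f = area_int g.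
Proof.
move=> fg; apply: eq_integral => p _; rewrite /upper_density.
by case: ifPn => // /fg ->.
Qed.

Lemma measurable_row f (y : R) : measurable_fun setT f -> measurable_fun [set: R] (fun x => f (x, y)).
Proof. by move=> mf; exact: (measurableT_comp mf (measurable_pair2 y)). Qed.

Lemma area_int_rows f : measurable_fun setT f -> (forall p, 0 <= f p) ->
  area_int f = \int[mu]_y (if (0 < y)%R then ((y ^+ 2)^-1)%:E * \int[mu]_x f (x, y) else 0).
Proof.
move=> mf f0.
have H := fubini_tonelli2 (m1 := mu) (m2 := mu) (upper_density f) (measurable_upper_density mf) (fun p => upper_density_ge0 p f0).
rewrite /area_int; etransitivity; first exact: H.
apply: eq_integral => y _; rewrite /fubini_G /upper_density /=.
case: (boolP (0 < y)%R) => y0; last by rewrite integral0.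
apply: integral_scale => //; first exact: measurable_row.
by rewrite lee_fin invr_ge0 sqr_ge0.
Qed.

(** The substitution x = y b turns dx dy / y^2 into db dy / y. Dilations and z -> -1/z permute the
    rays x = b y, so they can be treated one ray at a time. *)
Lemma area_int_rays f : measurable_fun setT f -> (forall p, 0 <= f p) ->
  area_int f = \int[mu]_b \int[mu]_y dlog (fun y => f (y * b, y)%R) y.
Proof.
move=> mf f0; rewrite area_int_rows //.
pose h (p : R * R) := f (p.2 * p.1, p.2)%R.
have mh : measurable_fun setT h.
  exact: (measurableT_comp mf (measurable_fun_pair (measurable_funM measurable_snd measurable_fst) measurable_snd)).
pose g (p : R * R) := if (0 < p.2)%R then (p.2^-1)%:E * h p else 0.
have mg : measurable_fun setT g by apply: measurable_dlog2 => //; exact: measurable_snd.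
have g0 p : 0 <= g p.
  by rewrite /g; case: ifPn => // p0; exact: (invr_mule_ge0 p0 (f0 _)).
have H := fubini_tonelli (m1 := mu) (m2 := mu) g mg g0.
etransitivity; last exact: (esym H).
apply: eq_integral => y _; rewrite /g /=.
case: (boolP (0 < y)%R) => y0; last by rewrite integral0.
have E1 := integral_scale (measurable_row y mh) (fun p => f0 _) (_ : 0 <= y^-1%:E).
rewrite /h /= in E1 *; rewrite E1; last by rewrite lee_fin invr_ge0 ltW.
have E2 := integral_affine 0 y0 (measurable_row y mf) (fun p => f0 _).
have -> : \int[mu]_x f (y * x, y)%R = \int[mu]_x f (y * x + 0, y)%R.
  by apply: eq_integral => x _; rewrite addr0.
rewrite E2 muleA -EFinM; congr (_%:E * _); by rewrite expr2 invfM.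
Qed.

(** Translations, dilations and z -> -1/z, into which [mobiusE] decomposes every element. *)
Definition tau (t : R) (p : R * R) : R * R := (p.1 + t, p.2)%R.
Definition sigma (s : R) (p : R * R) : R * R := (s * p.1, s * p.2)%R.
Definition inversion (p : R * R) : R * R :=
  (- p.1 / (p.1 ^+ 2 + p.2 ^+ 2), p.2 / (p.1 ^+ 2 + p.2 ^+ 2))%R.

Lemma measurable_tau t : measurable_fun setT (tau t).
Proof.
apply/measurable_fun_pairP; split => /=; last exact: measurable_snd.
by apply: measurable_funD => //; exact: measurable_fst.
Qed.

Lemma measurable_sigma s : measurable_fun setT (sigma s).
Proof.
have mc : measurable_fun [set: R * R] (cst s : R * R -> R) by [].
exact: (measurable_fun_pair (measurable_funM mc measurable_fst) (measurable_funM mc measurable_snd)).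
Qed.

Lemma measurable_inversion : measurable_fun setT inversion.
Proof.
have m : measurable_fun [set: R * R] (fun p : R * R => (p.1 ^+ 2 + p.2 ^+ 2)^-1)%R.
  apply: (measurableT_comp measurable_inv); apply: measurable_funD.
    exact: (measurable_funX 2 measurable_fst).
  exact: (measurable_funX 2 measurable_snd).
exact: (measurable_fun_pair (measurable_funM (measurable_funN measurable_fst) m) (measurable_funM measurable_snd m)).
Qed.

Lemma area_int_tau f t : measurable_fun setT f -> (forall p, 0 <= f p) ->
  area_int (f \o tau t) = area_int f.
Proof.
move=> mf f0; have mft := measurableT_comp mf (measurable_tau t).
apply: etrans (area_int_rows mft (fun p => f0 _)) _; apply: etrans (esym (area_int_rows mf f0)).
apply: eq_integral => y _; case: ifPn => // y0; congr (_ * _); rewrite /tau /=.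
have E2 := integral_affine t (@ltr01 R) (measurable_row y mf) (fun p => f0 _).
rewrite -[RHS]mul1e -(invr1 R) -E2.
by apply: eq_integral => x _; rewrite mul1r.
Qed.

Lemma measurable_ray f b : measurable_fun setT f -> measurable_fun [set: R] (fun y => f (y * b, y)%R).
Proof.
move=> mf; have mp : measurable_fun [set: R] (fun y : R => (y * b, y)%R).
  have mc : measurable_fun [set: R] (cst b : R -> R) by [].
  have mi : measurable_fun [set: R] (id : R -> R) by [].
  exact: (measurable_fun_pair (measurable_funM mi mc) mi).
exact: (measurableT_comp mf mp).
Qed.

Lemma area_int_sigma f (s : R) : (0 < s)%R -> measurable_fun setT f -> (forall p, 0 <= f p) ->
  area_int (f \o sigma s) = area_int f.
Proof.
move=> s0 mf f0; have mfs := measurableT_comp mf (measurable_sigma s).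
apply: etrans (area_int_rays mfs (fun p => f0 _)) _; apply: etrans (esym (area_int_rays mf f0)).
apply: eq_integral => b _.
have E := dlog_scale s0 (measurable_ray b mf) (fun y => f0 _).
etransitivity; last exact: E.
by apply: eq_integral => y _; rewrite /dlog /sigma /= mulrA.
Qed.

Lemma inversion_ray (b y : R) : (0 < y)%R ->
  inversion (y * b, y)%R = (((1 + b ^+ 2) * y)^-1 * - b, ((1 + b ^+ 2) * y)^-1)%R.
Proof.
move=> y0; have y1 : y != 0%R by rewrite gt_eqF.
have k0 : (0 < 1 + b ^+ 2)%R by apply: ltr_pwDl => //; exact: sqr_ge0.
have k1 : (1 + b ^+ 2 != 0)%R by rewrite gt_eqF.
rewrite /inversion /= (_ : (y * b) ^+ 2 + y ^+ 2 = y * ((1 + b ^+ 2) * y))%R; last by ring.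
congr (_, _).
  by rewrite -mulrN -mulf_div divff // mul1r mulrC.
by rewrite -[X in (X / _)%R]mulr1 -mulf_div divff // mul1r div1r.
Qed.

(** By [inversion_ray], the ray b goes to the ray -b through y -> 1 / ((1 + b^2) y), which preserves
    dy / y; the exchange of rays is a reflection in b. *)
Lemma area_int_inversion f : measurable_fun setT f -> (forall p, 0 <= f p) ->
  area_int (f \o inversion) = area_int f.
Proof.
move=> mf f0; have mfs := measurableT_comp mf measurable_inversion.
apply: etrans (area_int_rays mfs (fun p => f0 _)) _; apply: etrans (esym (area_int_rays mf f0)).
pose V b := \int[mu]_y dlog (fun y => f (y * b, y)%R) y.
have mV : measurable_fun [set: R] V.
  pose h (p : R * R) := f (p.2 * p.1, p.2)%R.
  have mh : measurable_fun setT h.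
    exact: (measurableT_comp mf (measurable_fun_pair (measurable_funM measurable_snd measurable_fst) measurable_snd)).
  pose g (p : R * R) := if (0 < p.2)%R then (p.2^-1)%:E * h p else 0.
  have mg : measurable_fun setT g by apply: measurable_dlog2 => //; exact: measurable_snd.
  have g0 p : 0 <= g p.
    by rewrite /g; case: ifPn => // p0; exact: (invr_mule_ge0 p0 (f0 _)).
  exact: (measurable_fun_fubini_tonelli_F (m2 := mu) g mg g0).
have V0 b : 0 <= V b by apply: integral_ge0 => y _; apply: dlog_ge0.
have E := integral_reflect mV V0.
etransitivity; last exact: E.
apply: eq_integral => b _.
have k0 : (0 < 1 + b ^+ 2)%R by apply: ltr_pwDl => //; exact: sqr_ge0.
have E1 := dlog_inv (measurable_ray (- b)%R mf) (fun y => f0 _).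
have mi : measurable_fun [set: R] (fun y : R => f (y^-1 * - b, y^-1)%R).
  exact: (measurableT_comp (measurable_ray (- b)%R mf) measurable_inv).
have E2 := dlog_scale k0 mi (fun y => f0 _).
rewrite /V -E1 -E2.
apply: eq_integral => y _; rewrite /dlog /=; case: ifPn => // y0.
by rewrite -(inversion_ray b y0).
Qed.

(** Bruhat decomposition: for c != 0, (a z + b) / (c z + d) = a / c - 1 / (c^2 (z + d / c)). *)
Lemma mobiusE (g : 'M[R]_2) (p : R * R) : (\det g = 1)%R -> (0 < p.2)%R ->
  mobius g p = if (g ord_max ord0 == 0)%R
    then tau (g ord0 ord0 * g ord0 ord_max)%R (sigma (g ord0 ord0 ^+ 2) p)%R
    else tau (g ord0 ord0 / g ord_max ord0)%R (sigma (g ord_max ord0 ^- 2)%R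
       (inversion (tau (g ord_max ord_max / g ord_max ord0)%R p))).
Proof.
move=> D0; have := D0; rewrite detE /mobius D0 /tau /sigma /inversion /=; clear D0.
set a := g ord0 ord0; set b := g ord0 ord_max; set c := g ord_max ord0; set d := g ord_max ord_max.
case: p => x y /= D y0.
case: (eqVneq c 0%R) => c0.
  rewrite c0 mulr0 subr0 in D; have d0 : (d != 0)%R by apply/eqP => d0; move: D; rewrite d0 mulr0 => /esym/eqP; rewrite oner_eq0.
  have -> : (a = d^-1)%R by rewrite -[LHS]mulr1 -(mulfV d0) mulrA D mul1r.
  rewrite c0; congr (_, _); field => //.
have n0 : ((c * x + d) ^+ 2 + (c * y) ^+ 2 != 0)%R.
  rewrite gt_eqF // ltr_wpDl ?sqr_ge0 // exprn_even_gt0 //= mulf_neq0 // gt_eqF //.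
have n1 : ((x + d / c) ^+ 2 + y ^+ 2 != 0)%R.
  by rewrite gt_eqF // ltr_wpDl ?sqr_ge0 // exprn_gt0.
have -> : (b = (a * d - 1) / c)%R by rewrite -D; field.
congr (_, _); field; rewrite ?c0 /= ?n0 /= ?andbT.
all: by rewrite (mulrC x) (mulrC y).
Qed.

Lemma measurable_mobius (g : 'M[R]_2) : measurable_fun setT (mobius g).
Proof.
rewrite /mobius.
set a := g ord0 ord0; set b := g ord0 ord_max; set c := g ord_max ord0; set d := g ord_max ord_max.
have mc (k : R) : measurable_fun [set: R * R] (cst k : R * R -> R) by [].
have mx : measurable_fun [set: R * R] (fst : R * R -> R) by exact: measurable_fst.
have my : measurable_fun [set: R * R] (snd : R * R -> R) by exact: measurable_snd.
have mcd := measurable_funD (measurable_funM (mc c) mx) (mc d).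
have mab := measurable_funD (measurable_funM (mc a) mx) (mc b).
have mcy := measurable_funM (mc c) my.
have mden := measurable_funD (measurable_funX 2 mcd) (measurable_funX 2 mcy).
have mi := measurableT_comp measurable_inv mden.
have mn1 := measurable_funD (measurable_funM mab mcd) (measurable_funM (mc (a * c)%R) (measurable_funX 2 my)).
have mn2 := measurable_funM (mc (\det g)) my.
exact: (measurable_fun_pair (measurable_funM mn1 mi) (measurable_funM mn2 mi)).
Qed.

Lemma area_int_mobius f (g : 'M[R]_2) : (\det g = 1)%R -> measurable_fun setT f -> (forall p, 0 <= f p) ->
  area_int (f \o mobius g) = area_int f.
Proof.
move=> D mf f0.
case: (eqVneq (g ord_max ord0) 0%R) => c0.
  have a0 : (0 < g ord0 ord0 ^+ 2)%R.
    rewrite exprn_even_gt0 //=; apply/eqP => a0; move: D; rewrite detE.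
    by rewrite a0 c0 mul0r mulr0 subr0 => /esym/eqP; rewrite oner_eq0.
  have mt := measurableT_comp mf (measurable_tau (g ord0 ord0 * g ord0 ord_max)%R).
  rewrite -(area_int_tau (g ord0 ord0 * g ord0 ord_max)%R mf f0) -(area_int_sigma a0 mt (fun p => f0 _)).
  by apply: area_int_ext => p p0; rewrite /= mobiusE // c0 eqxx.
have s0 : (0 < g ord_max ord0 ^- 2)%R by rewrite invr_gt0 exprn_even_gt0.
have m1 := measurableT_comp mf (measurable_tau (g ord0 ord0 / g ord_max ord0)%R).
have m2 := measurableT_comp m1 (measurable_sigma (g ord_max ord0 ^- 2)%R).
have m3 := measurableT_comp m2 measurable_inversion.
rewrite -(area_int_tau (g ord0 ord0 / g ord_max ord0)%R mf f0) -(area_int_sigma s0 m1 (fun p => f0 _)).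
rewrite -(area_int_inversion m2 (fun p => f0 _)) -(area_int_tau (g ord_max ord_max / g ord_max ord0)%R m3 (fun p => f0 _)).
by apply: area_int_ext => p p0; rewrite /= mobiusE // (negPf c0).
Qed.

Lemma hyp_areaE (F : set (R * R)) : measurable F -> F `<=` @Hplane R ->
  hyp_area F = area_int (fun p => (\1_F p)%:E).
Proof.
move=> mF FH; rewrite /hyp_area /area_int integral_mkcond.
apply: eq_integral => p _; rewrite patchE /upper_density indicE.
case: ifPn => pF; last by rewrite mule0 if_same.
by move: pF; rewrite inE => /FH /= ->; rewrite mule1.
Qed.
End HyperbolicArea.

(** * Discrete sets of matrices and the action on the half-plane *)

Section DiscreteGroups.
Context {R : realType}.
Implicit Types (G : set 'M[R]_2) (B F : set (R * R)).

Lemma rat_approx (x e : R) : 0 < e -> exists q : rat, `|x - ratr q| < e.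
Proof.
move=> e0; have lt : x - e < x + e by lra.
have [q /= Hq] := rat_in_itvoo lt; exists q.
by move: Hq; rewrite in_itv /= => /andP[h1 h2]; rewrite ltr_distlC; lra.
Qed.

(** An element is coded by a rational matrix and a radius r = 1 / (n + 1) such that it lies within r
    of that matrix and is alone in [G] within 2 r. Two elements with the same code are within 2 r of
    each other, hence equal. *)
Lemma discrete_code G : discrete_subset G ->
  exists f : 'M[R]_2 -> nat, forall g h, G g -> G h -> f g = f h -> g = h.
Proof.
move=> dG.
have H (g : 'M[R]_2) : exists c : (rat * rat) * (rat * rat) * nat, G g ->
    [/\ `|g ord0 ord0 - ratr c.1.1.1| < c.2.+1%:R^-1, `|g ord0 ord_max - ratr c.1.1.2| < c.2.+1%:R^-1,
        `|g ord_max ord0 - ratr c.1.2.1| < c.2.+1%:R^-1 & `|g ord_max ord_max - ratr c.1.2.2| < c.2.+1%:R^-1] /\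
    (forall h, G h -> (forall i j, `|g i j - h i j| < 2 * c.2.+1%:R^-1) -> h = g).
  case: (pselect (G g)) => [Gg|nG]; last by exists ((0, 0), (0, 0), 0%N).
  have /nbhs_ballP[/= e e0 He] := dG g Gg.
  have [n Hn] : exists n : nat, 2 * n.+1%:R^-1 < e.
    have e2 : 0 < e / 2 by lra.
    have [n Hn] := ltr_add_invr e2; exists n; move: Hn; rewrite add0r; set t := _^-1; lra.
  have n0 : 0 < n.+1%:R^-1 :> R by rewrite invr_gt0.
  have [q1 h1] := rat_approx (g ord0 ord0) n0.
  have [q2 h2] := rat_approx (g ord0 ord_max) n0.
  have [q3 h3] := rat_approx (g ord_max ord0) n0.
  have [q4 h4] := rat_approx (g ord_max ord_max) n0.
  exists ((q1, q2), (q3, q4), n) => _; split => // h Gh Hh.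
  by apply: He => //; split => // i j; apply: lt_trans Hn; exact: Hh.
pose c g := projT1 (cid (H g)).
have Hc g : G g -> _ := projT2 (cid (H g)).
exists (fun g => pickle (c g)) => g h Gg Gh /(pcan_inj pickleK) E.
have [[a1 a2 a3 a4] Ug] := Hc g Gg; have [[b1 b2 b3 b4] _] := Hc h Gh.
rewrite -/(c g) in a1 a2 a3 a4 Ug; rewrite -/(c h) -E in b1 b2 b3 b4.
apply/esym/Ug => // i j.
have D (x y z e : R) : `|x - z| < e -> `|y - z| < e -> `|x - y| < 2 * e.
  by rewrite !ltr_distlC => /andP[? ?] /andP[? ?]; lra.
by case: (ord2P i) => ->; case: (ord2P j) => ->; [exact: (D _ _ _ _ a1)|exact: (D _ _ _ _ a2)|exact: (D _ _ _ _ a3)|exact: (D _ _ _ _ a4)].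
Qed.

(** [v] marks the codes in use; elsewhere [e] is arbitrary. *)
Lemma discrete_enum G : discrete_subset G ->
  exists (e : nat -> 'M[R]_2) (v : pred nat),
    [/\ forall j, v j -> G (e j), forall g, G g -> exists2 j, v j & e j = g &
        forall i j, v i -> v j -> e i = e j -> i = j].
Proof.
move=> /discrete_code[f inj].
have H j : exists g, (exists2 g, G g & f g = j) -> G g /\ f g = j.
  case: (pselect (exists2 g, G g & f g = j)) => [[g Gg fg]|n]; first by exists g.
  by exists 1.
pose e j := projT1 (cid (H j)).
have He j : (exists2 g, G g & f g = j) -> G (e j) /\ f (e j) = j := projT2 (cid (H j)).
exists e, (fun j => `[< exists2 g, G g & f g = j >]); split.
- by move=> j /asboolP/He[].
- move=> g Gg; exists (f g); first by apply/asboolP; exists g.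
  have [|h1 h2] := He (f g); first by exists g.
  exact: inj.
- move=> i j /asboolP/He[_ h1] /asboolP/He[_ h2] E.
  by rewrite -h1 -h2 E.
Qed.

Lemma mobius_upper (g : 'M[R]_2) p : \det g = 1 -> Hplane p -> Hplane (mobius g p).
Proof.
case: p => x y; rewrite /Hplane /mobius /= => D y0; rewrite D mul1r.
have := D; rewrite detE.
set a := g ord0 ord0; set b := g ord0 ord_max; set c := g ord_max ord0; set d := g ord_max ord_max.
move=> D'; apply: divr_gt0 => //.
case: (eqVneq c 0) => c0; last by rewrite ltr_wpDl ?sqr_ge0 // exprn_even_gt0 //= mulf_neq0 // gt_eqF.
rewrite c0 !mul0r add0r expr0n /= addr0 exprn_even_gt0 //=; apply/eqP => d0.
by move: D'; rewrite c0 d0 !mulr0 subr0 => /esym/eqP; rewrite oner_eq0.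
Qed.

Lemma mobius_den (g : 'M[R]_2) p : \det g = 1 -> Hplane p ->
  0 < (g ord_max ord0 * p.1 + g ord_max ord_max) ^+ 2 + (g ord_max ord0 * p.2) ^+ 2.
Proof.
case: p => x y; rewrite /Hplane /= detE => D y0.
case: (eqVneq (g ord_max ord0) 0) => c0; last by rewrite ltr_wpDl ?sqr_ge0 // exprn_even_gt0 //= mulf_neq0 // gt_eqF.
rewrite c0 !mul0r add0r expr0n /= addr0 exprn_even_gt0 //=; apply/eqP => d0.
by move: D; rewrite c0 d0 !mulr0 subr0 => /esym/eqP; rewrite oner_eq0.
Qed.

Lemma mobius_mx2 a b c d x y : \det (mx2 a b c d) = 1 ->
  mobius (mx2 a b c d) (x, y) =
  (((a * x + b) * (c * x + d) + a * c * y ^+ 2) / ((c * x + d) ^+ 2 + (c * y) ^+ 2),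
   y / ((c * x + d) ^+ 2 + (c * y) ^+ 2)) :> R * R.
Proof. by move=> D; rewrite /mobius D !mx2E mul1r. Qed.

Lemma mobius_mul (g h : 'M[R]_2) p : \det g = 1 -> \det h = 1 -> Hplane p ->
  mobius (g *m h) p = mobius g (mobius h p).
Proof.
move=> Dg Dh Hp; have n1 := mobius_den Dh Hp.
have n2 := mobius_den Dg (mobius_upper Dh Hp).
have Dgh : \det (g *m h) = 1 by rewrite det_mulmx Dg Dh mulr1.
have n3 := mobius_den Dgh Hp.
have [a [b [c [d E]]]] := mx2_ex g; have [a' [b' [c' [d' E']]]] := mx2_ex h; subst g h.
case: p Hp n1 n2 n3 => x y Hp; rewrite mulmx2 in Dgh *.
rewrite !mobius_mx2 // !mx2E /=.
set n1 := (c' * x + d') ^+ 2 + _ => h1.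
set X := ((a' * x + b') * (c' * x + d') + a' * c' * y ^+ 2).
rewrite det_mx22 in Dh.
(* Inserting the determinant of [h] makes the identities homogeneous in its entries, so that [field]
   proves them. *)
have Ey : y = (a' * d' - b' * c') * y by rewrite Dh mul1r.
have -> : (c * (X / n1) + d) ^+ 2 + (c * (y / n1)) ^+ 2 =
  (((c * a' + d * c') * x + (c * b' + d * d')) ^+ 2 + ((c * a' + d * c') * y) ^+ 2) / n1.
  by rewrite [in LHS]Ey /X /n1; field; rewrite gt_eqF.
move=> h2 h3; congr (_, _); last by rewrite -mulf_div divff ?invr_eq0 ?gt_eqF // mulr1.
have -> : (y / n1) ^+ 2 = ((a' * d' - b' * c') * y / n1) ^+ 2 by rewrite Dh mul1r.
by rewrite /X /n1; field; rewrite !gt_eqF.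
Qed.
End DiscreteGroups.

(** * The packing inequality *)

Section Packing.
Context {R : realType}.
Notation mu := (@lebesgue_measure R).
Implicit Types (G : set 'M[R]_2) (B F : set (R * R)).

Definition hit B (g : 'M[R]_2) (p : R * R) : \bar R := (\1_B (mobius g p))%:E.

Lemma hit_ge0 B g p : (0 <= hit B g p)%E. Proof. by rewrite lee_fin. Qed.

Lemma hit1 B g p : B (mobius g p) -> hit B g p = 1%E.
Proof. by move=> h; rewrite /hit indicE mem_set. Qed.

Lemma hit0 B g p : ~ B (mobius g p) -> hit B g p = 0%E.
Proof. by move=> h; rewrite /hit indicE memNset. Qed.

Lemma measurable_hit B g : measurable B -> measurable_fun setT (hit B g).
Proof.
move=> mB; have m1 : measurable_fun [set: R * R] (\1_B : R * R -> R) by exact: measurable_indic.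
have m2 := measurableT_comp m1 (measurable_mobius g).
exact/measurable_EFinP.
Qed.

Lemma area_int_hit B g : \det g = 1 -> measurable B ->
  area_int (hit B g) = area_int (fun p => (\1_B p)%:E).
Proof.
move=> D mB; apply: (@area_int_mobius R (fun p => (\1_B p)%:E) g D) => //.
by apply/measurable_EFinP; exact: measurable_indic.
Qed.

Lemma area_int_le f g : measurable_fun setT f -> measurable_fun setT g -> (forall p, 0 <= f p)%E ->
  (forall p, Hplane p -> f p <= g p)%E -> (area_int f <= @area_int R g)%E.
Proof.
move=> mf mg f0 fg; apply: ge0_le_integral => //.
- by move=> p _; apply: upper_density_ge0.
- exact: measurable_upper_density.
- exact: measurable_upper_density.
- move=> p _; rewrite /upper_density; case: ifPn => // p0; apply: lee_wpmul2l; last exact: fg.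
  by rewrite lee_fin invr_ge0 sqr_ge0.
Qed.

Lemma area_int_scale k f : (0 <= k)%R -> measurable_fun setT f -> (forall p, 0 <= f p)%E ->
  (@area_int R (fun p => k%:E * f p) = k%:E * area_int f)%E.
Proof.
move=> k0 mf f0; rewrite /area_int -ge0_integralZl //.
- by apply: eq_integral => p _; rewrite /upper_density; case: ifPn => _; rewrite ?mule0 // muleCA.
- exact: measurable_upper_density.
- by move=> p _; apply: upper_density_ge0.
Qed.

Lemma area_int_sum (I : Type) (r : seq I) (f : I -> R * R -> \bar R) :
  (forall i, measurable_fun setT (f i)) -> (forall i p, 0 <= f i p)%E ->
  (@area_int R (fun p => \sum_(i <- r) f i p) = \sum_(i <- r) area_int (f i))%E.
Proof.
move=> mf f0; rewrite /area_int -ge0_integral_sum //.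
- apply: eq_integral => p _; rewrite /upper_density; case: ifPn => _; last by rewrite big1.
  by rewrite ge0_sume_distrr.
- by move=> i; exact: measurable_upper_density.
- by move=> i p _; apply: upper_density_ge0.
Qed.

Lemma area_int_nneseries (f : nat -> R * R -> \bar R) :
  (forall i, measurable_fun setT (f i)) -> (forall i p, 0 <= f i p)%E ->
  (@area_int R (fun p => \sum_(0 <= i <oo) f i p) = \sum_(0 <= i <oo) area_int (f i))%E.
Proof.
move=> mf f0; rewrite /area_int -integral_nneseries //.
- apply: eq_integral => p _; rewrite /upper_density; case: ifPn => _; last by rewrite eseries0.
  by rewrite nneseriesZl.
- by move=> i; exact: measurable_upper_density.
- by move=> i p _; apply: upper_density_ge0.
Qed.

Lemma measurable_nneseries (h : nat -> R * R -> \bar R) :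
  (forall k, measurable_fun setT (h k)) -> (forall k x, 0 <= h k x)%E ->
  measurable_fun setT (fun x => \sum_(0 <= i <oo) h i x)%E.
Proof.
move=> mh h0; exact: (@ge0_emeasurable_sum _ _ _ setT h xpredT (fun k x _ _ => h0 k x) (fun k _ => mh k)).
Qed.

(** Unfolding: since the translates of [F] cover the plane, the area of k_i^-1 B is at most the sum
    over g in [G] of the integrals over [F] of the indicator of B at k_i g p. Summed over i, the
    integrand at p counts the pairs (g, i) with k_i g p in B, so it is at most [M]. *)
Lemma packing G F B (n M : nat) (k : 'I_n -> 'M[R]_2) :
  PSL_subgroup_preimage G -> discrete_subset G -> fundamental_domain G F ->
  measurable B -> B `<=` @Hplane R -> (forall i, \det (k i) = 1) ->
  (forall z, Hplane z -> forall s : seq ('M[R]_2 * 'I_n), uniq s ->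
     (forall p, p \in s -> G p.1 /\ B (mobius (k p.2 *m p.1) z)) -> (size s <= M)%N) ->
  (n%:R%:E * hyp_area B <= M%:R%:E * hyp_area F)%E.
Proof.
move=> [detG G1 _ GM GV] dG [mF FH cover _] mB BH detk mult.
have [e [v [vG Gv einj]]] := discrete_enum dG.
rewrite !hyp_areaE //.
have m1 (A : set (R * R)) : measurable A -> measurable_fun setT (fun p : R * R => (\1_A p)%:E).
  by move=> mA; apply/measurable_EFinP; exact: measurable_indic.
(* [f i j] is the contribution of the element [e j] seen on [F]; [f' i j] is the same contribution
   moved to the translate of [F] by [e j]. *)
pose f i j p := if v j then (hit B (k i *m e j) p * (\1_F p)%:E)%E else 0%E.
pose f' i j p := if v j then (hit B (k i) p * hit F (invmx (e j)) p)%E else 0%E.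
have mf i j : measurable_fun setT (f i j).
  rewrite /f; case: (v j) => //; apply: emeasurable_funM; [exact: measurable_hit|exact: m1].
have mf' i j : measurable_fun setT (f' i j).
  by rewrite /f'; case: (v j) => //; apply: emeasurable_funM; exact: measurable_hit.
have f0 i j p : (0 <= f i j p)%E.
  by rewrite /f; case: (v j) => //; apply: mule_ge0; rewrite lee_fin.
have f'0 i j p : (0 <= f' i j p)%E.
  by rewrite /f'; case: (v j) => //; apply: mule_ge0; rewrite lee_fin.
have deti (g : 'M[R]_2) : \det g = 1 -> \det (invmx g) = 1.
  by move=> D; rewrite det_inv D invr1.
have uni (g : 'M[R]_2) : \det g = 1 -> g \in unitmx by rewrite unitmxE => ->; rewrite unitr1.
have ff' i j : area_int (f i j) = area_int (f' i j).
  rewrite /f /f'; case vj : (v j) => //.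
  have Dj := detG _ (vG _ vj).
  pose F' p := (hit B (k i *m e j) p * (\1_F p)%:E)%E.
  have mF' : measurable_fun setT F'.
    by apply: emeasurable_funM; [exact: measurable_hit|exact: m1].
  have F'0 p : (0 <= F' p)%E by apply: mule_ge0; rewrite lee_fin.
  rewrite -(area_int_mobius (deti _ Dj) mF' F'0); apply: area_int_ext => p p0.
  rewrite /F' /hit /=; congr (_ * _)%E.
  have Hm := mobius_upper (deti _ Dj) (p0 : Hplane p).
  rewrite -mobius_mul // ?det_mulmx ?detk ?Dj ?mulr1 // ?deti //.
  by rewrite -mulmxA mulmxV ?mulmx1 // uni.
pose S i p := (\sum_(0 <= j <oo) f i j p)%E.
have S0 i p : (0 <= S i p)%E by apply: nneseries_ge0.
have mS i : measurable_fun setT (S i).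
  exact: measurable_nneseries.
apply: (@le_trans _ _ (area_int (fun p => \sum_(i < n) S i p)%E)).
  rewrite (_ : n%:R%:E * _ = \sum_(i < n) area_int (hit B (k i)))%E; last first.
    rewrite (eq_bigr (fun=> area_int (fun p => (\1_B p)%:E))); last by move=> i _; rewrite area_int_hit.
    by rewrite sumr_const card_ord mule_natl.
  rewrite area_int_sum //; apply: lee_sum => i _.
  rewrite /S area_int_nneseries //.
  rewrite (eq_eseriesr (g := fun j => area_int (f' i j))); last by move=> j _; exact: ff'.
  rewrite -area_int_nneseries //.
  apply: area_int_le => //; first exact: measurable_hit.
  - exact: measurable_nneseries.
  - by move=> p; exact: hit_ge0.
  - move=> p Hp; have [g [Gg Fg]] := cover p Hp.
    have [j vj ej] := Gv _ (GV _ Gg).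
    apply: (@le_trans _ _ (f' i j p)).
      by rewrite /f' vj ej invmxK (hit1 Fg) mule1.
    apply: (@le_trans _ _ (\sum_(0 <= j < j.+1) f' i j p)%E); last exact: nneseries_lim_ge.
    by rewrite big_nat_recr //= leeDr // sume_ge0.
rewrite -area_int_scale //; last exact: m1.
apply: area_int_le => //.
- by apply: emeasurable_sum.
- by apply: emeasurable_funM => //; exact: m1.
- by move=> p; apply: sume_ge0.
- move=> p Hp; rewrite indicE; case: (pselect (F p)) => Fp; last first.
    rewrite memNset //= mule0 big1 // => i _; apply: eseries0 => j _ _.
    by rewrite /f; case: (v j) => //; rewrite indicE memNset //= mule0.
  rewrite mem_set //= mule1.
  have E : (\sum_(i < n) S i p = \sum_(0 <= j <oo) \sum_(i < n) f i j p)%E.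
    by rewrite nneseries_sum.
  rewrite E; apply: lime_le; first by apply: is_cvg_nneseries => j _ _; apply: sume_ge0.
  apply: nearW => N.
  pose s := [seq (e q.1, q.2) | q <- [seq (j, i) | j <- iota 0 N, i <- enum 'I_n] & v q.1 && `[< B (mobius (k q.2 *m e q.1) p) >] ].
  have us : uniq s.
    rewrite map_inj_in_uniq; first by rewrite filter_uniq // allpairs_uniq ?iota_uniq ?enum_uniq // => -[? ?] [? ?].
    move=> [j i] [j' i']; rewrite !mem_filter /= => /andP[/andP[vj _] _] /andP[/andP[vj' _] _] [E1 ->].
    by rewrite (einj _ _ vj vj' E1).
  have := mult p Hp s us.
  have Hs : forall q : 'M[R]_2 * 'I_n, q \in s -> G q.1 /\ B (mobius (k q.2 *m q.1) p).
    move=> q /mapP[[j i]]; rewrite mem_filter /= => /andP[/andP[vj /asboolP Bj] _] -> /=.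
    by split => //; exact: vG.
  move=> /(_ Hs) sM.
  apply: (@le_trans _ _ (size s)%:R%:E); last by rewrite lee_fin ler_nat.
  have sE : size s = (\sum_(j <- iota 0 N) \sum_(i <- enum 'I_n) (v j && `[< B (mobius (k i *m e j) p) >]))%N.
    rewrite /s size_map size_filter -sum1_count big_mkcond big_allpairs.
    by apply: eq_bigr => j _; apply: eq_bigr => i _ /=; case: (_ && _).
  rewrite sE natr_sum -sumEFin.
  rewrite /index_iota subn0; apply: lee_sum => j _.
  rewrite natr_sum -sumEFin big_enum /=; apply: lee_sum => i _.
  rewrite /f; case: (v j) => //=; rewrite indicE mem_set //= mule1.
  by case: asboolP => h /=; [rewrite hit1 | rewrite hit0].
Qed.
End Packing.

(** * Packing for a fixed box, and conjugation *)

Section PackedGroups.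
Context {R : realType}.
Implicit Types (G : set 'M[R]_2) (g : 'M[R]_2).

(** A neighbourhood of the base point (0, 1), that is, of the imaginary unit. *)
Definition box : set (R * R) := `[- 2^-1, 2^-1]%classic `*` `[2^-1, 2]%classic.

Lemma boxP p : box p <-> `|p.1| <= 2^-1 /\ 2^-1 <= p.2 <= 2.
Proof. by rewrite /box /= !in_itv /= ler_norml. Qed.

Lemma box_upper : box `<=` @Hplane R.
Proof. by move=> p /boxP[_ /andP[h _]]; apply: lt_le_trans h; rewrite invr_gt0. Qed.

Lemma measurable_box : measurable box.
Proof. by apply: measurableX; exact: measurable_itv. Qed.

Lemma area_box : ((4^-1)%:E <= hyp_area box)%E.
Proof.
have mf : measurable_fun box (fun p : R * R => (p.2 ^+ 2)^-1%:E).
  apply/measurable_EFinP; have m2 : measurable_fun [set: R * R] (fun p : R * R => p.2 ^+ 2)%R.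
    exact: (measurable_funX 2 measurable_snd).
  exact: (measurable_funS measurableT _ (measurableT_comp measurable_inv m2)).
have mB := measurable_box.
apply: (@le_trans _ _ (\int[(@lebesgue_measure R \x @lebesgue_measure R)%E]_(p in box) (4^-1)%:E)%E); last first.
  apply: ge0_le_integral => //.
  move=> p /boxP[_ /andP[h1 h2]]; rewrite lee_fin lef_pV2 ?posrE //; first by nra.
  by rewrite exprn_gt0 //; lra.
rewrite integral_cst //=.
have L1 : lebesgue_measure (`[(- 2^-1)%R, (2^-1)%R]%classic : set R) = 1%:E.
  by rewrite lebesgue_measure_itv /= lte_fin ifT; [rewrite -EFinD; congr (_%:E)|]; lra.
have L2 : lebesgue_measure (`[(2^-1)%R, 2%R]%classic : set R) = (3 / 2)%:E.
  by rewrite lebesgue_measure_itv /= lte_fin ifT; [rewrite -EFinD; congr (_%:E)|]; lra.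
have m1 : measurable (`[(- 2^-1)%R, (2^-1)%R]%classic : set R) by exact: measurable_itv.
have m2 : measurable (`[(2^-1)%R, 2%R]%classic : set R) by exact: measurable_itv.
have P := product_measure1E (@lebesgue_measure R) (@lebesgue_measure R) m1 m2.
have {}P := etrans P (congr2 mule L1 L2).
apply: (@le_trans _ _ ((4^-1)%:E * (1%:E * (3 / 2)%:E))%E); first by rewrite -!EFinM lee_fin; lra.
by rewrite le_eqVlt; apply/orP; left; apply/eqP; congr (_ * _)%E; exact: esym P.
Qed.

(* What finite covolume gives for the multiplicity [M] with which the sets [k_i^-1 box] meet an orbit;
   it passes to conjugates without reference to a fundamental domain. *)
Definition packs G := exists A : nat, forall n M (k : 'I_n -> 'M[R]_2),
  (forall i, \det (k i) = 1) ->
  (forall z, Hplane z -> forall s : seq ('M[R]_2 * 'I_n), uniq s ->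
     (forall p, p \in s -> G p.1 /\ box (mobius (k p.2 *m p.1) z)) -> (size s <= M)%N) ->
  (n <= M * A)%N.

Lemma lattice_packs G : PSL_subgroup_preimage G -> lattice G -> packs G.
Proof.
move=> sG [dG [F [fF aF]]].
pose A := (Num.truncn (4 * fine (hyp_area F))).+1.
exists A => n M k detk mult.
have := packing sG dG fF measurable_box box_upper detk mult.
have F0 : (0 <= hyp_area F)%E.
  by apply: integral_ge0 => p _; rewrite lee_fin invr_ge0 sqr_ge0.
have Ff : hyp_area F \is a fin_num by rewrite ge0_fin_numE.
rewrite -(fineK Ff) => H.
have H1 : (n%:R%:E * (4^-1)%:E <= M%:R%:E * (fine (hyp_area F))%:E)%E.
  by apply: le_trans H; apply: lee_wpmul2l; [rewrite lee_fin | exact: area_box].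
move: H1; rewrite -!EFinM lee_fin => H1.
rewrite -(ler_nat R) natrM.
have H2 : 4 * fine (hyp_area F) <= A%:R by rewrite ltW // truncnS_gt.
have H3 : M%:R * (4 * fine (hyp_area F)) <= M%:R * A%:R by apply: ler_wpM2l.
lra.
Qed.

Definition conj_set (s : 'M[R]_2) G : set 'M[R]_2 := [set g | G (s *m g *m invmx s)].

Lemma unit_det1 g : \det g = 1 -> g \in unitmx.
Proof. by rewrite unitmxE => ->; rewrite unitr1. Qed.

Lemma invmx_right g h : g \in unitmx -> g *m h = 1%:M -> invmx g = h.
Proof. by move=> u E; rewrite -[LHS]mulmx1 -E mulKmx. Qed.

Lemma det_inv1 g : \det g = 1 -> \det (invmx g) = 1.
Proof. by move=> D; rewrite det_inv D invr1. Qed.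

Lemma conj_packs s G : \det s = 1 -> (forall g, G g -> \det g = 1) -> packs G -> packs (conj_set s G).
Proof.
move=> Ds detG [A HA]; exists A => n M k detk mult.
have us := unit_det1 Ds.
apply: (HA n M (fun i => k i *m invmx s)).
  by move=> i; rewrite det_mulmx detk det_inv1 // mulr1.
move=> z Hz t ut Ht.
pose f (p : 'M[R]_2 * 'I_n) := (invmx s *m p.1 *m s, p.2).
have finj : injective f.
  move=> [g i] [h j] [E ->]; congr (_, _).
  have := congr1 (fun m => s *m m *m invmx s) E.
  by rewrite !mulmxA !mulmxV // !mul1mx -!mulmxA !mulmxV // !mulmx1.
rewrite -(size_map f); apply: (mult (mobius (invmx s) z)).
- by apply: mobius_upper => //; exact: det_inv1.
- by rewrite map_inj_uniq.
- move=> _ /mapP[[g i] gt ->] /=; have [/= Gg Hg] := Ht _ gt; split.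
    by rewrite /conj_set /= !mulmxA mulmxV // mul1mx -!mulmxA mulmxV // mulmx1.
  rewrite -mobius_mul //; last exact: det_inv1.
    by rewrite !mulmxA -(mulmxA _ s) mulmxV // mulmx1.
  by rewrite !det_mulmx detk det_inv1 // Ds detG // !mulr1.
Qed.

Lemma conj_group s G : \det s = 1 -> PSL_subgroup_preimage G -> PSL_subgroup_preimage (conj_set s G).
Proof.
move=> Ds [dG G1 GN GM GV]; have us := unit_det1 Ds; split; rewrite /conj_set.
- move=> g /dG; rewrite !det_mulmx Ds det_inv1 // mul1r mulr1 //.
- by rewrite /= mulmx1 mulmxV.
- by rewrite /= mulmxN mulNmx mulmx1 mulmxV.
- move=> g h /= Gg Gh; have := GM _ _ Gg Gh.
  by rewrite !mulmxA -(mulmxA _ (invmx s)) mulVmx // mulmx1.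
- move=> g /= Gg; have Dg : \det g = 1 by have := dG _ Gg; rewrite !det_mulmx Ds det_inv1 // mul1r mulr1.
  have := GV _ Gg; congr G.
  apply: invmx_right; first exact/unit_det1/dG.
  by rewrite !mulmxA -(mulmxA _ (invmx s)) mulVmx // mulmx1 -(mulmxA s) mulmxV ?unit_det1 // mulmx1 mulmxV.
Qed.

Lemma conj_trace s G t : \det s = 1 -> trace_set (conj_set s G) t <-> trace_set G t.
Proof.
move=> Ds; have us := unit_det1 Ds; split.
- move=> [g [Gg <-]]; exists (s *m g *m invmx s); split => //.
  by rewrite mxtrace_mulC mulmxA mulVmx // mul1mx.
- move=> [g [Gg <-]]; exists (invmx s *m g *m s); split.
    by rewrite /conj_set /= !mulmxA mulmxV // mul1mx -!mulmxA mulmxV // mulmx1.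
  by rewrite mxtrace_mulC mulmxA mulmxV // mul1mx.
Qed.

(** Write w for x + i y. The ratio of the heights of w and g w is |c w + d|^2, at most 4, and |a w +
    b|^2 = |g w|^2 |c w + d|^2 is at most 17. As y >= 1/2 and |x| <= 1/2, the bound |a w + b| <= 5
    gives |a| <= 10 and |b| <= 10; c and d are smaller. *)
Lemma box_entries g w : \det g = 1 -> box w -> box (mobius g w) -> forall i j, `|g i j| <= 10.
Proof.
have [a [b [c [d ->]]]] := mx2_ex g; case: w => x y D.
rewrite mobius_mx2 // => /boxP[/= hx /andP[hy1 hy2]] /boxP[/= hx' /andP[hy1' hy2']].
have Hp : Hplane (x, y) by rewrite /Hplane /=; lra.
have := mobius_den D Hp; rewrite !mx2E /=.
set N := (c * x + d) ^+ 2 + (c * y) ^+ 2 in hx' hy1' hy2' *; move=> N0.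
have N4 : N <= 4.
  by move: hy1'; rewrite ler_pdivlMr // => h; lra.
pose u := a * x + b; pose v := a * y.
have E : ((a * x + b) * (c * x + d) + a * c * y ^+ 2) ^+ 2 + y ^+ 2 = (u ^+ 2 + v ^+ 2) * N.
  transitivity (((a * x + b) * (c * x + d) + a * c * y ^+ 2) ^+ 2 + ((a * d - b * c) * y) ^+ 2).
    by rewrite -det_mx22 D mul1r.
  by rewrite /u /v /N; ring.
have E2 : (((a * x + b) * (c * x + d) + a * c * y ^+ 2) / N) ^+ 2 + (y / N) ^+ 2 = (u ^+ 2 + v ^+ 2) / N.
  by rewrite !expr_div_n -mulrDl E expr2 invfM mulrA mulfK ?gt_eqF.
have uv : u ^+ 2 + v ^+ 2 <= 17.
  have : (u ^+ 2 + v ^+ 2) / N <= 17 / 4.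
    rewrite -E2; move: hx' hy1' hy2'; set X := _ / N; set Y := y / N => hx' hy1' hy2'.
    have : X ^+ 2 <= (2^-1) ^+ 2 by rewrite -(ger0_norm (sqr_ge0 X)) normrX lerXn2r ?nnegrE ?invr_ge0.
    have : Y ^+ 2 <= 2 ^+ 2 by rewrite lerXn2r ?nnegrE //; apply: le_trans hy1'; rewrite invr_ge0.
    by rewrite !expr2; lra.
  by rewrite ler_pdivrMr // => h; lra.
have B (r k : R) : 0 <= k -> r ^+ 2 <= k ^+ 2 -> `|r| <= k.
  by move=> k0; rewrite -(ger0_norm (sqr_ge0 r)) normrX ler_pXn2r ?nnegrE.
have hv : `|v| <= 5 by apply: B => //; have := sqr_ge0 u; lra.
have hu : `|u| <= 5 by apply: B => //; have := sqr_ge0 v; lra.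
have hcy : `|c * y| <= 2 by apply: B => //; have := sqr_ge0 (c * x + d); rewrite /N in N4; lra.
have hcd : `|c * x + d| <= 2 by apply: B => //; have := sqr_ge0 (c * y); rewrite /N in N4; lra.
have Dv (p q : R) : `|p * y| <= q -> `|p| <= 2 * q.
  rewrite normrM (gtr0_norm (_ : 0 < y)) // => h.
  have : `|p| * 2^-1 <= `|p| * y by apply: ler_wpM2l.
  lra.
have ha : `|a| <= 10 by have := Dv _ _ hv; lra.
have hc : `|c| <= 4 by have := Dv _ _ hcy; lra.
have Db (p q r k1 k2 : R) : `|p * x + q| <= k1 -> `|p| <= k2 -> `|q| <= k1 + k2 / 2.
  move=> h1 h2; have : `|p * x| <= k2 * 2^-1 by rewrite normrM ler_pM.
  rewrite !ler_norml in h1 * => /andP[h3 h4]; case/andP: h1 => h5 h6; apply/andP; split; lra.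
have hb : `|b| <= 10 by have := Db _ _ 0 _ _ hu ha; lra.
have hd : `|d| <= 4 by have := Db _ _ 0 _ _ hcd hc; lra.
have le4 (r : R) : `|r| <= 4 -> `|r| <= 10 by move=> h; apply: le_trans h _; rewrite ler_nat.
by move=> i j; case: (ord2P i) => ->; case: (ord2P j) => ->; rewrite mx2E //; exact: le4.
Qed.
End PackedGroups.

(** * Existence of a unipotent element *)

Section ParabolicElement.
Context {R : realType}.
Implicit Types (G : set 'M[R]_2) (g : 'M[R]_2) (z w : R * R).

Lemma normalizer z : Hplane z -> exists k : 'M[R]_2, \det k = 1 /\
  forall w, Hplane w -> mobius k w = ((w.1 - z.1) / z.2, w.2 / z.2).
Proof.
case: z => x y; rewrite /Hplane /= => y0.
pose r := Num.sqrt y; have r0 : 0 < r by rewrite sqrtr_gt0.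
have ry : r ^+ 2 = y by rewrite sqr_sqrtr // ltW.
have D : \det (mx2 r^-1 (- x / r) 0 r) = 1 by rewrite det_mx22 mulr0 subr0 mulVf // gt_eqF.
exists (mx2 r^-1 (- x / r) 0 r); split => // -[u v] /= v0.
rewrite mobius_mx2 // !mul0r !add0r expr0n /= addr0 mulr0 mul0r addr0 ry.
by congr (_, _); rewrite -ry; field; rewrite gt_eqF.
Qed.

(** The height of the image is 1 / (c^2 + d^2). Here c^2 + d^2 <= 200, and (a^2 + b^2) (c^2 + d^2) =
    1 + (a c + b d)^2 gives c^2 + d^2 >= 1 / 200. *)
Lemma base_image m : \det m = 1 -> (forall i j, `|m i j| <= 10) ->
  `|(mobius m ((0, 1) : R * R)).1| <= (200 * 200) /\ 200^-1 <= (mobius m ((0, 1) : R * R)).2 <= 200.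
Proof.
have [a [b [c [d ->]]]] := mx2_ex m => D H.
have ha := H ord0 ord0; have hb := H ord0 ord_max; have hc := H ord_max ord0; have hd := H ord_max ord_max.
rewrite !mx2E in ha hb hc hd; rewrite mobius_mx2 // !mulr0 !add0r !mulr1 expr1n mulr1 /=.
have S (r : R) : `|r| <= 10 -> r ^+ 2 <= 100.
  by move=> h; rewrite -(ger0_norm (sqr_ge0 r)) normrX (_ : 100 = 10 ^+ 2) ?lerXn2r ?nnegrE //; ring.
have a2 := S _ ha; have b2 := S _ hb; have c2 := S _ hc; have d2 := S _ hd.
set N := d ^+ 2 + c ^+ 2.
have N1 : 1 <= 200 * N.
  have E : (a ^+ 2 + b ^+ 2) * N = (a * d - b * c) ^+ 2 + (a * c + b * d) ^+ 2 by rewrite /N; ring.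
  have : 1 <= (a ^+ 2 + b ^+ 2) * N by rewrite E -det_mx22 D expr1n lerDl sqr_ge0.
  have N0 : 0 <= N by rewrite addr_ge0 ?sqr_ge0.
  have : (a ^+ 2 + b ^+ 2) * N <= 200 * N by apply: ler_wpM2r => //; lra.
  lra.
have N0 : 0 < N by lra.
have N2 : N <= 200 by rewrite /N; lra.
split; last first.
  by rewrite div1r lef_pV2 ?posrE // N2 /= -div1r ler_pdivrMr.
rewrite normrM normfV (gtr0_norm N0) ler_pdivrMr //.
have h1 : `|b * d| <= 100 by rewrite normrM (_ : 100 = 10 * 10) ?ler_pM //; ring.
have h2 : `|a * c| <= 100 by rewrite normrM (_ : 100 = 10 * 10) ?ler_pM //; ring.
apply: le_trans (ler_normD _ _) _; lra.
Qed.

(** The region of [base_image], carried from the base point to [z] by the inverse of the map of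
    [normalizer]. *)
Definition halo z : set (R * R) :=
  `[z.1 - (200 * 200) * z.2, z.1 + (200 * 200) * z.2]%classic `*` `[z.2 / 200, z.2 * 200]%classic.

Lemma haloP z w : Hplane z ->
  `|(w.1 - z.1) / z.2| <= (200 * 200) /\ 200^-1 <= w.2 / z.2 <= 200 -> halo z w.
Proof.
rewrite /Hplane /= => z0 [h /andP[h1 h2]]; rewrite /halo /= !in_itv /=.
move: h h1 h2; rewrite normrM normfV (gtr0_norm z0) ler_pdivrMr // ler_distl.
by rewrite ler_pdivlMr // ler_pdivrMr // => /andP[-> ->] h1 h2; rewrite !(mulrC z.2) h1 h2.
Qed.

Lemma halo_upper z : Hplane z -> halo z `<=` @Hplane R.
Proof.
rewrite /Hplane /= => z0 w []; rewrite /= !in_itv /= => _ /andP[h _].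
by apply: lt_le_trans h; rewrite divr_gt0.
Qed.

Lemma halo_compact z : compact (halo z).
Proof. by apply: compact_setX; exact: segment_compact. Qed.

(** Finitely many halos form a compact set, which cannot meet every orbit when the quotient is not
    compact; a point whose orbit avoids them extends the list. *)
Lemma separated_points G : ~ cocompact G -> forall n, exists l : nat -> R * R,
  (forall i, (i < n)%N -> Hplane (l i)) /\
  (forall i j, (i < j < n)%N -> forall g, G g -> ~ halo (l i) (mobius g (l j))).
Proof.
move=> ncc; elim=> [|n [l [Hl sep]]].
  by exists (fun=> (0, 0)); split => // i j; rewrite ltn0 andbF.
have [z [Hz sz]] : exists z, Hplane z /\ forall i, (i < n)%N -> forall g, G g -> ~ halo (l i) (mobius g z).
  apply: contrapT => nz; apply: ncc.
  exists (\bigcup_(i in `I_n) halo (l i)); split.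
  - by rewrite bigcup_mkord; apply: bigsetU_compact => i _; exact: halo_compact.
  - by move=> p [i /= /Hl Hi]; exact: halo_upper.
  - move=> z Hz; apply: contrapT => nz'; apply: nz; exists z; split => // i ni g Gg hz.
    by apply: nz'; exists g; split => //; exists i.
exists (fun i => if i == n then z else l i); split.
  by move=> i; rewrite ltnS leq_eqVlt; case: eqVneq => //= _; exact: Hl.
move=> i j /andP[ij]; rewrite ltnS leq_eqVlt.
case: eqVneq => [jn _ | _ /= jn] g Gg.
  by rewrite ltn_eqF -?jn //; apply: sz => //; rewrite -jn.
by rewrite ltn_eqF; [apply: sep => //; rewrite ij | exact: ltn_trans jn].
Qed.

Lemma seq_gap (s : seq R) (x : R) : exists2 e : R, 0 < e & forall t, t \in s -> `|t - x| < e -> t = x.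
Proof.
elim: s => [|t s [e e0 He]]; first by exists 1.
case: (eqVneq t x) => tx.
  by exists e => // u /[1!inE] /orP[/eqP -> //|]; exact: He.
exists (Num.min e `|t - x|); first by rewrite lt_min e0 normr_gt0 subr_eq0.
move=> u /[1!inE] /orP[/eqP -> | us]; rewrite lt_min => /andP[h1 h2]; last exact: He.
by rewrite ltxx in h2.
Qed.

(** Pigeonholes of mesh [e] for the entries in [-10, 10]; [inord] is faithful there once 20 / e < N
    + 1. *)
Definition cell (N : nat) (e : R) (g : 'M[R]_2) : {ffun 'I_2 * 'I_2 -> 'I_N.+1} :=
  [ffun ij => inord (Num.truncn ((g ij.1 ij.2 + 10) / e))].

Lemma cell_close N (e : R) (g h : 'M[R]_2) : 0 < e -> 20 / e < N.+1%:R ->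
  (forall i j, `|g i j| <= 10) -> (forall i j, `|h i j| <= 10) ->
  cell N e g = cell N e h -> forall i j, `|g i j - h i j| < e.
Proof.
move=> e0 eN Hg Hh E i j.
have := congr1 (fun f : {ffun 'I_2 * 'I_2 -> 'I_N.+1} => f (i, j)) E.
rewrite !ffunE /=.
have key (x : R) : `|x| <= 10 -> 0 <= (x + 10) / e /\ (Num.truncn ((x + 10) / e) < N.+1)%N.
  rewrite ler_norml => /andP[h1 h2].
  have p0 : 0 <= (x + 10) / e by apply: divr_ge0; [lra | exact: ltW].
  split => //; rewrite -(ltr_nat R); apply: le_lt_trans eN.
  have /andP[t1 _] := truncn_itv p0; apply: le_trans t1 _.
  rewrite ler_pM2r ?invr_gt0 //; lra.
have [p1 k1] := key _ (Hg i j); have [p2 k2] := key _ (Hh i j).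
move/(congr1 val); rewrite /= !inordK // => Et.
have /andP[a1 a2] := truncn_itv p1; have /andP[b1 b2] := truncn_itv p2.
rewrite Et in a1 a2.
have : `|(g i j + 10) / e - (h i j + 10) / e| < 1.
  move: a1 a2 b1 b2; rewrite -[X in _ < X%:R]addn1 natrD; set T := _%:R.
  by rewrite -[X in _ < T + X]/1 ltr_norml => *; apply/andP; split; lra.
rewrite -mulrBl (_ : g i j + 10 - (h i j + 10) = g i j - h i j); last by ring.
by rewrite normrM normfV (gtr0_norm e0) ltr_pdivrMr // mul1r.
Qed.

(** As tr (g^-1 g) = 2, the difference is linear in h - g: four terms, each with a coefficient of
    size at most 10. *)
Lemma close_trace (g h : 'M[R]_2) (e : R) : \det g = 1 -> (forall i j, `|g i j| <= 10) ->
  (forall i j, `|g i j - h i j| < e) -> `|\tr (invmx g *m h) - 2| < 40 * e.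
Proof.
have [a [b [c [d ->]]]] := mx2_ex g; have [a' [b' [c' [d' ->]]]] := mx2_ex h => D H1 H2.
rewrite det_mx22 in D; rewrite invmx2 // mulmx2 tr_mx22.
have := H1 ord0 ord0; have := H1 ord0 ord_max; have := H1 ord_max ord0; have := H1 ord_max ord_max.
have := H2 ord0 ord0; have := H2 ord0 ord_max; have := H2 ord_max ord0; have := H2 ord_max ord_max.
rewrite !mx2E => k1 k2 k3 k4 h1 h2 h3 h4.
have -> : d * a' + - b * c' + (- c * b' + a * d') - 2 =
   - (d * (a - a')) + b * (c - c') + (c * (b - b') - a * (d - d')).
  by rewrite -[X in _ - X]/(1 + 1) -D; ring.
have P (x y : R) : `|x| <= 10 -> `|y| < e -> `|x * y| <= 10 * e /\ `|x * y| <= 10 * `|y|.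
  by move=> hx hy; rewrite normrM; split; apply: ler_pM => //; exact: ltW.
have [p1 q1] := P _ _ h1 k4; have [p2 q2] := P _ _ h3 k2; have [p3 q3] := P _ _ h2 k3; have [p4 q4] := P _ _ h4 k1.
apply: le_lt_trans (ler_normD _ _) _.
have n1 := ler_normD (- (d * (a - a'))) (b * (c - c')).
have n2 := ler_normB (c * (b - b')) (a * (d - d')).
rewrite normrN in n1; lra.
Qed.

(** Relative to a fixed g0 of the list, k g g0^-1 k^-1 maps a point of the box into the box, so its
    entries are at most 10. If g and h fall into the same pigeonhole, then tr (g^-1 h) is within 40
    e of 2, and g = h. *)
Lemma mult_bound G (z : R * R) (e : R) (N : nat) (k : 'M[R]_2) (s : seq 'M[R]_2) :
  PSL_subgroup_preimage G -> (forall g, G g -> `|\tr g - 2| < 40 * e -> g = 1) ->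
  0 < e -> 20 / e < N.+1%:R -> \det k = 1 -> Hplane z -> uniq s ->
  (forall g, g \in s -> G g /\ box (mobius (k *m g) z)) ->
  (size s <= #|{ffun 'I_2 * 'I_2 -> 'I_N.+1}|)%N.
Proof.
move=> [dG G1 GN GM GV] gap e0 eN Dk Hz us Hs.
case: s us Hs => [//|g0 s0]; set s := g0 :: s0 => us Hs.
have [G0 B0] : G g0 /\ box (mobius (k *m g0) z) by apply: Hs; rewrite mem_head.
have uk := unit_det1 Dk; have ug0 := unit_det1 (dG _ G0).
pose m g := k *m g *m invmx g0 *m invmx k.
have dm g : G g -> \det (m g) = 1.
  by move=> Gg; rewrite /m !det_mulmx Dk (dG _ Gg) (det_inv1 (dG _ G0)) (det_inv1 Dk) !mulr1.
have bm g : g \in s -> forall i j, `|m g i j| <= 10.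
  move=> gs; have [Gg Bg] := Hs _ gs.
  apply: (@box_entries _ _ (mobius (k *m g0) z)) => //; first exact: dm.
  rewrite -mobius_mul //; first by rewrite /m -!mulmxA mulKmx // mulVmx // mulmx1.
  - exact: dm.
  - by rewrite det_mulmx Dk dG // mulr1.
have inj : {in s &, injective (cell N e \o m)}.
  move=> g h gs hs /= /(cell_close e0 eN (bm _ gs) (bm _ hs)) C.
  have [Gg _] := Hs _ gs; have [Gh _] := Hs _ hs.
  have := close_trace (dm _ Gg) (bm _ gs) C.
  have ug := unit_det1 (dG _ Gg).
  have -> : \tr (invmx (m g) *m m h) = \tr (invmx g *m h).
    have -> : invmx (m g) = k *m g0 *m invmx g *m invmx k.
      apply: invmx_right; first exact/unit_det1/dm.
      by rewrite /m !mulmxA -(mulmxA _ (invmx k) k) mulVmx // mulmx1 -(mulmxA _ (invmx g0) g0) mulVmx // mulmx1 -(mulmxA _ g) mulmxV // mulmx1 mulmxV.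
    rewrite /m !mulmxA -(mulmxA _ (invmx k) k) mulVmx // mulmx1.
    rewrite mxtrace_mulC !mulmxA mulVmx // mul1mx mxtrace_mulC !mulmxA mulVmx // mul1mx.
    by [].
  move/(gap _ (GM _ _ (GV _ Gg) Gh)) => E.
  by rewrite -[h](mulKVmx ug) E mulmx1.
have -> : size s = size [seq (cell N e \o m) g | g <- s] by rewrite size_map.
rewrite -(card_uniqP _) ?max_card //.
by rewrite map_inj_in_uniq.
Qed.

(* Otherwise nontrivial elements, conjugated to any base point, stay uniformly away from 1, and
   base points chosen far apart in the quotient contradict the packing inequality. *)
Lemma unipotent_exists G (s3 : seq R) : PSL_subgroup_preimage G -> packs G -> ~ cocompact G ->
  (forall t, trace_set G t -> `|t| <= 3 -> t \in s3) ->
  exists g, [/\ G g, \tr g = 2 & g <> 1].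
Proof.
move=> sG pG ncc tr3; apply: contrapT => nex.
have par g : G g -> \tr g = 2 -> g = 1.
  by move=> Gg tg; apply: contrapT => g1; apply: nex; exists g.
have [e0 e00 He] := seq_gap s3 2.
(* The 40 is that of [close_trace]; the minimum with 1 keeps the traces in [-3, 3], where [s3] lists
   them all. *)
pose e := Num.min 1 e0 / 40.
have e0' : 0 < Num.min 1 e0 by rewrite lt_min ltr01.
have ep : 0 < e by rewrite divr_gt0.
have gap g : G g -> `|\tr g - 2| < 40 * e -> g = 1.
  move=> Gg; rewrite /e mulrC mulfVK ?gt_eqF // lt_min => /andP[h1 h2].
  apply: par => //; apply: He => //; apply: tr3; first by exists g.
  by move: h1; rewrite !ltr_norml ler_norml => /andP[h3 h4]; apply/andP; split; lra.
pose N := Num.truncn (20 / e).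
have eN : 20 / e < N.+1%:R by apply: truncnS_gt.
have [A HA] := pG.
pose M := #|{ffun 'I_2 * 'I_2 -> 'I_N.+1}|.
pose n := (M * A).+1.
have [l [Hl sep]] := separated_points ncc n.
have Hk (i : 'I_n) : exists k : 'M[R]_2, \det k = 1 /\
  forall w, Hplane w -> mobius k w = ((w.1 - (l i).1) / (l i).2, w.2 / (l i).2).
  by apply: normalizer; exact: Hl.
pose k i := projT1 (cid (Hk i)).
have kP i : \det (k i) = 1 /\
  forall w, Hplane w -> mobius (k i) w = ((w.1 - (l i).1) / (l i).2, w.2 / (l i).2) := projT2 (cid (Hk i)).
have Dk i : \det (k i) = 1 by have [] := kP i.
suff : (n <= M * A)%N by rewrite ltnn.
apply: (HA n M k) => // z Hz s us Hs.
have [dG G1 GN GM GV] := sG.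
(* Two pairs with base points i < j would give k_i p q^-1 k_j^-1 mapping a point of the box into the
   box; by [base_image] it would bring the translate of l_j by p q^-1 into the halo of l_i. *)
have same p q : p \in s -> q \in s -> ~ (p.2 < q.2)%N.
  move=> ps qs pq; have [Gp Bp] := Hs _ ps; have [Gq Bq] := Hs _ qs.
  have Dp := dG _ Gp; have Dq := dG _ Gq; have uq := unit_det1 Dq; have ukq := unit_det1 (Dk q.2).
  pose w := mobius (p.1 *m invmx q.1) (l q.2).
  have Hlq := Hl _ (ltn_ord q.2).
  have Dpq : \det (p.1 *m invmx q.1) = 1 by rewrite det_mulmx Dp det_inv1 // mulr1.
  have Hw : Hplane w by exact: mobius_upper.
  apply: (sep p.2 q.2 _ (p.1 *m invmx q.1)); rewrite ?pq ?ltn_ord //.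
    by apply: GM => //; exact: GV.
  apply: haloP; first exact: Hl.
  have [_ kE] := kP p.2; have [_ kE'] := kP q.2.
  have E1 : mobius (k q.2) (l q.2) = (0, 1).
    by rewrite kE' // subrr mul0r divff // gt_eqF.
  pose m := k p.2 *m (p.1 *m invmx q.1) *m invmx (k q.2).
  have Dm : \det m = 1 by rewrite !det_mulmx Dk Dp !det_inv1 // !mulr1.
  have mE : mobius m (0, 1) = ((w.1 - (l p.2).1) / (l p.2).2, w.2 / (l p.2).2).
    rewrite -E1 -mobius_mul // -?kE // /m -mulmxA mulVmx // mulmx1 mobius_mul //.
  have := base_image Dm; rewrite mE /=; apply.
  apply: (@box_entries _ _ (mobius (k q.2 *m q.1) z)) => //.
  rewrite -mobius_mul //; last by rewrite det_mulmx Dk Dq mulr1.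
  by rewrite /m -!mulmxA mulKmx // mulVmx // mulmx1.
case: s us Hs same => [//|p s0]; set s := p :: s0 => us Hs same.
have ps : p \in s by rewrite mem_head.
have eq2 q : q \in s -> q.2 = p.2.
  by move=> qs; apply: val_inj; case: (ltngtP q.2 p.2) => // h; [case: (same _ _ qs ps h) | case: (same _ _ ps qs h)].
have -> : size s = size (map fst s) by rewrite size_map.
apply: (mult_bound sG gap ep eN (Dk p.2) Hz).
  rewrite map_inj_in_uniq // => -[q1 q2] [r1 r2] qs rs /= E.
  by rewrite E (eq2 _ qs : q2 = _) (eq2 _ rs : r2 = _).
move=> g /mapP[q qs ->]; have [Gq Bq] := Hs _ qs; split => //.
by rewrite -(eq2 _ qs).
Qed.
End ParabolicElement.

(** * Discrete groups containing a translation *)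

Section Unipotents.
Context {R : realType}.
Implicit Types (G : set 'M[R]_2) (g : 'M[R]_2) (z w : R * R).

Definition unip (x : R) : 'M[R]_2 := mx2 1 x 0 1.

Definition isolated_one G := exists2 r : R, 0 < r & forall g, G g ->
  (forall i j, `|g i j - (1 : 'M[R]_2) i j| < r) -> g = 1.

Lemma unip0 : unip 0 = 1. Proof. by rewrite /unip -scalar_mx2. Qed.
Lemma unipD x y : unip x *m unip y = unip (y + x).
Proof. by rewrite /unip mulmx2; congr mx2; ring. Qed.
Lemma unipV x : invmx (unip x) = unip (- x).
Proof. by rewrite /unip invmx2; [congr mx2|]; ring. Qed.

Lemma conj_isolated s G : \det s = 1 -> discrete_subset G -> G 1 -> isolated_one (conj_set s G).
Proof.
move=> Ds dG G1; have /nbhs_ballP[/= e e0 He] := dG _ G1.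
have us := unit_det1 Ds.
pose S := 1 + \sum_i \sum_j `|s i j| + \sum_i \sum_j `|invmx s i j|.
have p1 i (A : 'M[R]_2) : 0 <= \sum_j `|A i j| by apply: sumr_ge0.
have p2 (A : 'M[R]_2) : 0 <= \sum_i \sum_j `|A i j| by apply: sumr_ge0.
have S1 : 1 <= S by have := p2 s; have := p2 (invmx s); rewrite /S; lra.
have bnd (A : 'M[R]_2) i j : `|A i j| <= \sum_i \sum_j `|A i j|.
  rewrite (bigD1 i) //= (bigD1 j) //= -addrA lerDl addr_ge0 // sumr_ge0 // => *; exact: sumr_ge0.
have s1 i j : `|s i j| <= S by have := bnd s i j; have := p2 (invmx s); rewrite /S; lra.
have s2 i j : `|invmx s i j| <= S by have := bnd (invmx s) i j; have := p2 s; rewrite /S; lra.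
have S0 : 0 < S by lra.
(* Each entry of s (g - 1) s^-1 is a sum of four terms of size at most e / 8. *)
exists (e / (8 * S ^+ 2)); first by rewrite divr_gt0 // mulr_gt0 // exprn_gt0.
move=> g Gg Hg.
have E : s *m g *m invmx s = 1.
  apply: He => //; split => // i j.
  have -> : 1 = s *m 1 *m invmx s :> 'M[R]_2 by rewrite mulmx1 mulmxV.
  rewrite /ball /= -[_ - _]opprB normrN.
  have -> : (s *m g *m invmx s) i j - (s *m 1 *m invmx s) i j = (s *m (g - 1) *m invmx s) i j.
    have subE (A B : 'M[R]_2) : (A - B) i j = A i j - B i j by rewrite !mxE.
    by rewrite mulmxBr mulmxBl subE.
  rewrite mxE !big_ord_recl big_ord0 lift00 addr0 !mxE !big_ord_recl !big_ord0 !lift00 !addr0.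
  have P (a b c : R) : `|a| <= S -> `|b| < e / (8 * S ^+ 2) -> `|c| <= S -> `|a * b * c| <= e / 8.
    move=> ha hb hc; rewrite !normrM.
    have -> : e / 8 = S * (e / (8 * S ^+ 2)) * S by field; rewrite gt_eqF.
    by do 2?[apply: ler_pM => //; rewrite ?mulr_ge0 //]; exact: ltW.
  have h i' j' : `|(g - 1) i' j'| < e / (8 * S ^+ 2) by have := Hg i' j'; rewrite !mxE.
  rewrite !mulrDl.
  have q1 := P _ _ _ (s1 i ord0) (h ord0 ord0) (s2 ord0 j).
  have q2 := P _ _ _ (s1 i ord_max) (h ord_max ord0) (s2 ord0 j).
  have q3 := P _ _ _ (s1 i ord0) (h ord0 ord_max) (s2 ord_max j).
  have q4 := P _ _ _ (s1 i ord_max) (h ord_max ord_max) (s2 ord_max j).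
  move: q1 q2 q3 q4; set t1 := s i ord0 * _ * _; set t2 := s i ord_max * _ * _; set t3 := s i ord0 * _ * _; set t4 := s i ord_max * _ * _ => q1 q2 q3 q4.
  have := ler_normD (t1 + t2) (t3 + t4); have := ler_normD t1 t2; have := ler_normD t3 t4; lra.
have := congr1 (fun m => invmx s *m m *m s) E.
by rewrite /= !mulmxA mulVmx // mul1mx mulmx1 mulVmx // -mulmxA mulVmx // mulmx1.
Qed.

Lemma expr_small (x r : R) : `|x| < 1 -> 0 < r -> exists k, `|x ^+ k| < r.
Proof.
move=> x1 r0; have /cvgrPdist_lt/(_ r r0) := cvg_expr x1.
by case=> k _ /(_ k (leqnn k)); rewrite sub0r normrN; exists k.
Qed.

Lemma isolated_unip G (r x : R) : (forall g, G g -> (forall i j, `|g i j - (1 : 'M[R]_2) i j| < r) -> g = 1) ->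
  0 < r -> G (unip x) -> `|x| < r -> x = 0.
Proof.
move=> Hr r0 Gx xr; have := Hr _ Gx; rewrite -unip0 => H.
suff /mx2_inj[_ -> _ _] : unip x = unip 0 by [].
apply: H => i j; case: (ord2P i) => ->; case: (ord2P j) => ->; rewrite !mx2E ?subrr ?normr0 // subr0 //.
Qed.

(** Conjugation by the element multiplies the parameter of a translation by a^2. If a^2 were not 1,
    iterating it or its inverse on [unip 1] would produce nontrivial translations tending to 1. *)
Lemma upper_diagonal G a b d : PSL_subgroup_preimage G -> isolated_one G -> G (unip 1) ->
  G (mx2 a b 0 d) -> d = a^-1 /\ a ^+ 2 = 1.
Proof.
move=> [dG G1 GN GM GV] [r r0 Hr] GT Gg.
have := dG _ Gg; rewrite det_mx22 mulr0 subr0 => ad.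
have a0 : a != 0 by apply/eqP => a0; move: ad; rewrite a0 mul0r => /esym/eqP; rewrite oner_eq0.
have dE : d = a^-1 by rewrite -[LHS]mul1r -(mulVf a0) -mulrA ad mulr1.
split => //.
have ct a' b' d' : G (mx2 a' b' 0 d') -> a' * d' = 1 -> ~ `|a' ^+ 2| < 1.
  move=> Ga ad' lt; have a'0 : a' != 0 by apply/eqP => a'0; move: ad'; rewrite a'0 mul0r => /esym/eqP; rewrite oner_eq0.
  have step x : G (unip x) -> G (unip (a' ^+ 2 * x)).
    move=> Gx; have := GM _ _ (GM _ _ Ga Gx) (GV _ Ga).
    rewrite invmx2 ?mulr0 ?subr0 // /unip !mulmx2.
    congr G; congr mx2; first [ring | rewrite -[RHS]ad'; ring].
  have all k : G (unip ((a' ^+ 2) ^+ k)).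
    by elim: k => [|k IH]; rewrite ?expr0 // exprS; exact: step.
  have [k Hk] := expr_small lt r0.
  have := isolated_unip Hr r0 (all k) Hk; move/eqP; rewrite !expf_eq0 (negPf a'0) !andbF //.
have n1 := ct a b d Gg ad.
have Gi := GV _ Gg; rewrite invmx2 ?mulr0 ?subr0 // in Gi.
have n2 := ct d (- b) a; rewrite oppr0 in Gi; have {}n2 := n2 Gi; rewrite mulrC in n2; have {}n2 := n2 ad.
rewrite !ger0_norm ?sqr_ge0 // in n1 n2.
have h1 : 1 <= a ^+ 2 by rewrite leNgt; apply/negP.
have h2 : 1 <= d ^+ 2 by rewrite leNgt; apply/negP.
apply/eqP; rewrite eq_le h1 andbT.
have -> : a ^+ 2 = 1 / d ^+ 2 by rewrite dE exprVn invrK mul1r.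
by rewrite ler_pdivrMr ?mul1r //; lra.
Qed.

(** Otherwise [upper_diagonal] leaves only plus or minus translations. Boxes at small, well
    separated heights are then met by an orbit at most twice in total, counting signs, so [packs]
    would bound their number. *)
Lemma lower_nonzero G : PSL_subgroup_preimage G -> packs G -> isolated_one G -> G (unip 1) ->
  exists2 g, G g & g ord_max ord0 != 0.
Proof.
move=> gG [A HA] iG GT; apply: contrapT => nex.
have c0 g : G g -> g ord_max ord0 = 0.
  by move=> Gg; apply/eqP; apply: contrapT => /negP h; apply: nex; exists g.
have form a b c d : G (mx2 a b c d) -> [/\ c = 0, d = a^-1 & a ^+ 2 = 1].
  move=> Gg; have := c0 _ Gg; rewrite mx2E => c00; subst c.
  by have [] := upper_diagonal gG iG GT Gg.
have [dG G1 GN GM GV] := gG; have [r r0 Hr] := iG.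
have iso x := @isolated_unip G r x Hr r0.
have form2 g : G g -> exists t, g = unip t \/ g = - unip t.
  have [a [b [c [d ->]]]] := mx2_ex g => Gg; have [c00 dE aa] := form _ _ _ _ Gg.
  have /orP[/eqP a1|/eqP a1] : (a == 1) || (a == -1) by rewrite -sqrf_eq1 aa.
    by exists b; left; rewrite /unip dE c00 a1 invr1.
  by exists (- b); right; rewrite /unip oppmx2 opprK dE c00 a1 oppr0 invrN invr1.
(* Successive heights differ by a factor 16, more than the ratio 4 of heights within a box, and all
   are below [r], so that two translations hitting the same box coincide. *)
pose y i : R := Num.min r 1 * (16 ^+ i.+1)^-1.
have m0 : 0 < Num.min r 1 by rewrite lt_min r0 ltr01.
have y0 i : 0 < y i by rewrite mulr_gt0 // invr_gt0 exprn_gt0.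
have yr i : y i < r.
  apply: (@lt_le_trans _ _ (Num.min r 1)); last by rewrite ge_min lexx.
  by rewrite gtr_pMr // invf_lt1 ?exprn_gt0 // exprn_egt1 // ltr1n.
pose n := (2 * A).+1.
have Hk (i : 'I_n) : exists k : 'M[R]_2, \det k = 1 /\
  forall w, Hplane w -> mobius k w = ((w.1 - 0) / y i, w.2 / y i).
  have H0 : Hplane ((0, y i) : R * R) by exact: y0.
  exact: (normalizer H0).
pose k i := projT1 (cid (Hk i)).
have kP i : \det (k i) = 1 /\ forall w, Hplane w -> mobius (k i) w = ((w.1 - 0) / y i, w.2 / y i) := projT2 (cid (Hk i)).
suff : (n <= 2 * A)%N by rewrite ltnn.
apply: (HA n 2%N k) => [i|z Hz s us Hs]; first by have [] := kP i.
have mob t : mobius (unip t) z = (z.1 + t, z.2).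
  case: z Hz {Hs} => u v Hz; rewrite /unip mobius_mx2 ?det_mx22; last by ring.
  by rewrite !mul0r !add0r expr1n expr0n /= addr0 !divr1 mulr0 mul0r addr0 mulr1 mul1r.
have mobN t : mobius (- unip t) z = (z.1 + t, z.2).
  rewrite -mob /mobius !mxE; congr (_, _); last first.
    by rewrite -scaleN1r detZ sqrrN expr1n mul1r; congr (_ / _); ring.
  by congr (_ / _); ring.
have loc p : p \in s -> exists t, [/\ p.1 = unip t \/ p.1 = - unip t, G (unip t), `|(z.1 + t) / y p.2| <= 2^-1 & 2^-1 <= z.2 / y p.2 <= 2].
  move=> ps; have [Gp] := Hs _ ps; have [Dk kE] := kP p.2.
  rewrite mobius_mul //; last exact: dG.
  rewrite kE; last by apply: mobius_upper => //; exact: dG.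
  have [t Ht] := form2 _ Gp.
  have -> : mobius p.1 z = (z.1 + t, z.2) by case: Ht => ->.
  move=> /boxP[/= h1 h2]; exists t; split => //; last by rewrite subr0 in h1.
  case: Ht => E; first by rewrite -E.
  by have := GM _ _ GN Gp; rewrite E mulNmx mul1mx opprK.
case: s us Hs loc => [//|p0 s0]; set s := p0 :: s0 => us Hs loc.
have [t0 [e0 G0 a0 b0]] := loc p0 (mem_head _ _).
apply: (@leq_trans (size [:: p0; (- p0.1, p0.2)])) => //.
apply: uniq_leq_size => // p ps; have [t [et Gt at_ bt]] := loc p ps.
have ylt (i j : 'I_n) : (i < j)%N -> 2^-1 <= z.2 / y i <= 2 -> 2^-1 <= z.2 / y j <= 2 -> False.
  move=> ij; rewrite !ler_pdivlMr // !ler_pdivrMr // => /andP[h1 h2] /andP[h3 h4].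
  have : y i >= 16 * y j.
    rewrite /y (mulrC 16) -mulrA ler_pM2l // -[X in _ * X]invrK -invfM lef_pV2 ?posrE ?divr_gt0 ?exprn_gt0 //.
    rewrite ler_pdivlMr // -exprSr ler_eXn2l ?ltr1n //.
  have := y0 j; lra.
have E2 : p.2 = p0.2.
  by apply: val_inj; case: (ltngtP p.2 p0.2) => // h; [case: (ylt _ _ h bt b0)|case: (ylt _ _ h b0 bt)].
have tt : t = t0.
  apply/eqP; rewrite -subr_eq0; apply/eqP; apply: iso.
    by have := GM _ _ Gt (GV _ G0); rewrite unipV unipD addrC.
  rewrite E2 in at_; move: at_ a0; rewrite !normrM !normfV (gtr0_norm (y0 _)) !ler_pdivrMr //.
  have := yr p0.2; rewrite !ler_norml => h1 /andP[h2 h3] /andP[h4 h5].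
  by rewrite ltr_norml; apply/andP; split; lra.
rewrite !inE; case: p E2 et {ps at_ bt Gt} => g i /= -> et; case: p0 e0 {s us Hs loc G0 a0 b0} => g0 i0 /= e0.
rewrite tt in et; case: et => ->; case: e0 => ->; rewrite ?opprK ?eqxx ?orbT //.
Qed.

(** Over the reals, conjugation in SL(2) rescales the parameter of a unipotent by squares only; this
    is why both signs occur. *)
Lemma unipotent_conj g : \det g = 1 -> \tr g = 2 -> g <> 1 ->
  exists s : 'M[R]_2, \det s = 1 /\ (g = s *m unip 1 *m invmx s \/ g = s *m unip (-1) *m invmx s).
Proof.
have [a [b [c [d ->]]]] := mx2_ex g; rewrite det_mx22 tr_mx22 => D Tr g1.
have rt (k : R) : k != 0 -> exists2 r, r != 0 & r ^+ 2 = k \/ r ^+ 2 = - k.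
  move=> k0; exists (Num.sqrt `|k|); first by rewrite sqrtr_eq0 -ltNge normr_gt0.
  rewrite sqr_sqrtr //; case: (ger0P k) => _; [by left | by right].
have dE : d = 2 - a by rewrite -Tr; ring.
case: (eqVneq c 0) => c0.
  have a1 : a = 1.
    apply/eqP; rewrite -subr_eq0 -sqrf_eq0; apply/eqP; move: D; rewrite c0 dE => D.
    by rewrite -[RHS](subrr 1) -{3}D; ring.
  have b0 : b != 0.
    apply/eqP => b0; apply: g1; rewrite dE a1 b0 c0 [RHS]scalar_mx2; congr mx2; ring.
  have [r r0 rb] := rt _ b0.
  have Ds : r * r^-1 - 0 * 0 = 1 by rewrite mulfV // mulr0 subr0.
  exists (mx2 r 0 0 r^-1); split; first by rewrite det_mx22.
  rewrite invmx2 // /unip !mulmx2 dE a1 c0.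
  by case: rb => E; [left | right]; congr mx2; try (field => //); rewrite -?E; first [ring | by rewrite -[b]opprK -E; ring].
have [r r0 rc] := rt _ c0.
have Ds : ((a - 1) / r) * 0 - (- r / c) * (c / r) = 1 by field; rewrite r0 c0.
(* The first column of [s] is proportional to (a - 1, c), the first column of g - 1, which g fixes
   because (g - 1)^2 = 0. *)
exists (mx2 ((a - 1) / r) (- r / c) (c / r) 0); split; first by rewrite det_mx22.
have bE : b = - (a - 1) ^+ 2 / c.
  by apply: (mulIf c0); rewrite mulfVK // -[LHS]addr0 -(subrr 1) -{1}D dE; ring.
rewrite invmx2 // /unip !mulmx2 dE bE.
case: rc => E; [right | left].
  by rewrite -E; congr mx2; field.
have {}E : c = - r ^+ 2 by rewrite E opprK.
by rewrite E; congr mx2; field.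
Qed.
End Unipotents.

(** * Products of two integers in a given residue class *)

Section RealPower.
Context {R : realType}.
Implicit Types (s d : R) (m n : nat).

(** This is n^-s for n > 0; the junk value at 0 is why [dominated] treats that index apart. *)
Definition pw s n : R := expR (- s * ln n%:R).

Lemma pw_gt0 s n : 0 < pw s n. Proof. exact: expR_gt0. Qed.
Lemma pw_ge0 s n : 0 <= pw s n. Proof. exact/ltW/pw_gt0. Qed.
Lemma pw1 s : pw s 1 = 1. Proof. by rewrite /pw ln1 mulr0 expR0. Qed.

Lemma pwM s m n : (0 < m)%N -> (0 < n)%N -> pw s (m * n) = pw s m * pw s n.
Proof.
by move=> m0 n0; rewrite /pw natrM lnM ?posrE ?ltr0n // mulrDr expRD.
Qed.

Lemma pwD s t n : pw (s + t) n = pw s n * pw t n.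
Proof. by rewrite /pw opprD mulrDl expRD. Qed.

Lemma pw_inv n : (0 < n)%N -> pw 1 n = n%:R^-1.
Proof. by move=> n0; rewrite /pw mulN1r expRN lnK // posrE ltr0n. Qed.

Lemma pw_anti s m n : 0 <= s -> (0 < m)%N -> (m <= n)%N -> pw s n <= pw s m.
Proof.
move=> s0 m0 mn; rewrite /pw ler_expR !mulNr lerN2 ler_wpM2l // ler_ln ?ler_nat ?posrE ?ltr0n //.
exact: leq_trans mn.
Qed.

Lemma pw_le1 s n : 0 <= s -> (0 < n)%N -> pw s n <= 1.
Proof. by move=> s0 n0; rewrite -(pw1 s); apply: pw_anti. Qed.

Lemma ln_step n : (0 < n)%N ->
  (n.+1%:R : R)^-1 <= ln n.+1%:R - ln n%:R <= (n%:R : R)^-1.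
Proof.
move=> n0; have p0 : 0 < n%:R :> R by rewrite ltr0n.
have p1 : 0 < n.+1%:R :> R by rewrite ltr0n.
rewrite -ln_div ?posrE //; apply/andP; split.
  have := @le_ln1Dx R (n%:R / n.+1%:R - 1).
  rewrite addrCA subrr addr0 => H.
  have {}H : ln (n%:R / n.+1%:R) <= n%:R / n.+1%:R - 1 :> R by apply: H; rewrite ltrBDl subrr divr_gt0.
  have E : n.+1%:R^-1 = 1 - n%:R / n.+1%:R :> R.
    by rewrite -natr1; field; rewrite natr1 gt_eqF.
  rewrite -[X in ln X]invf_div lnV ?posrE ?divr_gt0 //.
  set t := n%:R / n.+1%:R in H E *; rewrite E; lra.
have := @le_ln1Dx R (n.+1%:R / n%:R - 1).
rewrite addrCA subrr addr0 => H.
apply: le_trans (H _) _; first by rewrite ltrBDl subrr divr_gt0.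
by rewrite -natr1 mulrDl mulfV ?gt_eqF // mul1r addrAC subrr add0r.
Qed.

(** Together with [pw_step_ge] this compares n^(-1-d) with increments of n^-d / d; telescoping
    places zeta(1 + d) between 1 / d and 1 + 1 / d. *)
Lemma pw_step_le d n : 0 <= d -> (0 < n)%N -> pw d n - pw d n.+1 <= d * pw (1 + d) n.
Proof.
move=> d0 n0; have /andP[_ H] := ln_step n0.
have -> : pw d n.+1 = pw d n * expR (- d * (ln n.+1%:R - ln n%:R)).
  by rewrite /pw -expRD; congr expR; ring.
rewrite pwD pw_inv //.
have H2 := expR_ge1Dx (- d * (ln n.+1%:R - ln n%:R)).
have H3 : d * (ln n.+1%:R - ln n%:R) <= d * n%:R^-1 by apply: ler_wpM2l.
set e := expR _ in H2 *.
have H4 : 1 - e <= d * n%:R^-1 by lra.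
have := ler_wpM2l (pw_ge0 d n) H4; lra.
Qed.

Lemma pw_step_ge d n : 0 <= d -> (0 < n)%N -> d * pw (1 + d) n.+1 <= pw d n - pw d n.+1.
Proof.
move=> d0 n0; have /andP[H _] := ln_step n0.
have -> : pw d n = pw d n.+1 * expR (d * (ln n.+1%:R - ln n%:R)).
  by rewrite /pw -expRD; congr expR; ring.
rewrite pwD pw_inv //.
have H2 := expR_ge1Dx (d * (ln n.+1%:R - ln n%:R)).
have H3 : d * n.+1%:R^-1 <= d * (ln n.+1%:R - ln n%:R) by apply: ler_wpM2l.
set e := expR _ in H2 *.
set t := n.+1%:R^-1 in H3 *.
have H4 : d * t <= e - 1 by lra.
have := ler_wpM2l (pw_ge0 d n.+1) H4; lra.
Qed.

Lemma sum_pw_le d n : 0 < d -> \sum_(1 <= i < n.+1) pw (1 + d) i <= 1 + d^-1.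
Proof.
move=> d0; case: n => [|n]; first by rewrite big_geq // addr_ge0 // invr_ge0 ltW.
suff H : \sum_(1 <= i < n.+2) pw (1 + d) i <= 1 + d^-1 * (1 - pw d n.+1).
  apply: le_trans H _; rewrite lerD2l ler_piMr ?invr_ge0 ?(ltW d0) // gerBl pw_ge0 //.
elim: n => [|n IH]; first by rewrite big_nat1 !pw1 subrr mulr0 addr0.
rewrite big_nat_recr //=; apply: (le_trans (lerD IH (lexx _))).
have H := pw_step_ge (ltW d0) (ltn0Sn n).
rewrite -addrA lerD2l -(ler_pM2l d0) mulrDr !mulrA mulfV ?gt_eqF // !mul1r.
move: H; lra.
Qed.

Lemma sum_pw_ge d n : 0 < d -> d^-1 * (1 - pw d n.+1) <= \sum_(1 <= i < n.+1) pw (1 + d) i.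
Proof.
move=> d0; elim: n => [|n IH]; first by rewrite big_geq // pw1 subrr mulr0.
rewrite big_nat_recr //=; apply: le_trans (lerD IH (lexx _)).
have H := pw_step_le (ltW d0) (ltn0Sn n).
have : d^-1 * (pw d n.+1 - pw d n.+2) <= pw (1 + d) n.+1 by rewrite ler_pdivrMl.
lra.
Qed.

Lemma pw_small d e : 0 < d -> 0 < e -> exists N, forall n, (N <= n)%N -> (0 < n)%N -> pw d n <= e.
Proof.
move=> d0 e0.
pose N := (Num.truncn (expR (- ln e / d))).+1.
exists N => n Nn n0; rewrite /pw -[leRHS](lnK (_ : e \is Num.pos)) // ler_expR mulNr lerNl.
rewrite -ler_pdivrMl // mulrC -(expRK (- ln e / d)) ler_ln ?posrE ?expR_gt0 ?ltr0n //.
by apply: ltW; apply: lt_le_trans (truncnS_gt _) _; rewrite ler_nat.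
Qed.
End RealPower.

(** * Growth of subsets of a finite group under random translates *)

Section Covering.
Context {R : realType} {gT : finGroupType}.
Implicit Types (A B : {set gT}).

(** A potential that vanishes only on the whole group. Reciprocals of sizes are used because their
    excess is what a random translate halves, see [defect_avg]. *)
Definition defect A : R := (#|A|%:R)^-1 - (#|gT|%:R)^-1.

Lemma card_group_gt0 : 0 < #|gT|%:R :> R.
Proof. by rewrite ltr0n -cardsT; apply/card_gt0P; exists 1%g; rewrite inE. Qed.

Lemma defect_anti A B : A != finset.set0 -> A \subset B -> defect B <= defect A.
Proof.
move=> A0 AB; rewrite /defect lerD2r lef_pV2 ?posrE ?ltr0n ?card_gt0 //.
  by rewrite ler_nat subset_leq_card.
by apply: contraNneq A0 => B0; rewrite -finset.subset0 -B0.
Qed.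

Lemma defect_ge0 A : A != finset.set0 -> 0 <= defect A.
Proof.
move=> A0; rewrite subr_ge0 lef_pV2 ?posrE ?card_group_gt0 ?ltr0n ?card_gt0 //.
by rewrite ler_nat max_card.
Qed.

Lemma defect_le1 A : defect A <= 1.
Proof.
rewrite /defect lerBlDr; apply: ler_wpDr; first by rewrite invr_ge0.
case: (posnP #|A|) => [-> | h]; first by rewrite invr0.
by rewrite invf_le1 ?ltr0n // ler1n.
Qed.

Lemma defect_missing A : A != finset.set0 -> A != finset.setT -> (#|gT|%:R ^+ 2)^-1 <= defect A.
Proof.
move=> A0 AT; have a0 : (0 < #|A|)%N by rewrite card_gt0.
have aT : (#|A|.+1 <= #|gT|)%N.
  by rewrite -cardsT proper_card // properT.
have g0 := card_group_gt0.
have ar : 0 < #|A|%:R :> R by rewrite ltr0n.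
apply: (@le_trans _ _ ((#|gT|.-1%:R)^-1 - (#|gT|%:R)^-1)); last first.
  rewrite lerD2r lef_pV2 ?posrE ?ltr0n //; first by rewrite ler_nat -ltnS prednK // (leq_trans _ aT).
  by rewrite -ltnS prednK ?(leq_trans _ aT) // (leq_trans _ aT).
have : (1 < #|gT|)%N by apply: leq_trans aT.
case: #|gT| g0 => [|[|n]] //= g0 _.
have n1 : 0 < n.+1%:R :> R by rewrite ltr0n.
rewrite (_ : n.+1%:R^-1 - n.+2%:R^-1 = (n.+1%:R * n.+2%:R)^-1 :> R); last first.
  by rewrite -[n.+2]addn1 natrD; field; rewrite gt_eqF //= -natr1 gt_eqF // addr_gt0.
rewrite lef_pV2 ?posrE ?mulr_gt0 ?exprn_gt0 // expr2 ler_wpM2r ?(ltW g0) // ler_nat //.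
Qed.

(** For each pair (x, y) of elements of A there is exactly one a with x = a y. *)
Lemma sum_card_lcoset A : \sum_(a : gT) #|A :&: (a *: A)%g| = (#|A| * #|A|)%N.
Proof.
under eq_bigr => a _ do rewrite -sum1_card big_mkcond /=.
rewrite exchange_big /= -sum_nat_const [RHS]big_mkcond; apply: eq_bigr => x _.
under eq_bigr => a _ do rewrite finset.in_setI.
case xA: (x \in A) => /=; last by rewrite big1.
rewrite -big_mkcond /= sum1_card -[RHS](card_invg A) -(card_lcoset (A^-1)%g x).
by apply: eq_card => a; rewrite mem_lcoset mem_invg invMg invgK -mem_lcoset.
Qed.

(** Let m = #|A| and let x <= m be the size of the intersection. By convexity 1 / (2 m - x) lies
    below its chord (m + x) / (2 m^2), which is linear in x, and x has mean m^2 / #|gT|. *)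
Lemma defect_avg A : A != finset.set0 ->
  \sum_(a : gT) defect (A :|: (a *: A)%g) <= #|gT|%:R * defect A / 2.
Proof.
move=> A0; have a0 : (0 < #|A|)%N by rewrite card_gt0.
pose m : R := #|A|%:R; have m0 : 0 < m by rewrite ltr0n.
pose x a : R := #|A :&: (a *: A)%g|%:R.
have xm a : x a <= m by rewrite ler_nat subset_leq_card // finset.subsetIl.
have x0 a : 0 <= x a by rewrite ler0n.
have cU a : #|A :|: (a *: A)%g|%:R = 2 * m - x a :> R.
  apply/eqP; rewrite eq_sym subr_eq -natrD cardsUI card_lcoset natrD /m; apply/eqP; ring.
have step a : defect (A :|: (a *: A)%g) <= (m + x a) / (2 * m ^+ 2) - (#|gT|%:R)^-1.
  rewrite /defect lerD2r cU.
  have d0 : 0 < 2 * m - x a by have := xm a; lra.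
  rewrite -[leLHS]div1r ler_pdivrMr // mulrAC ler_pdivlMr ?mulr_gt0 ?exprn_gt0 //.
  have h : 0 <= x a * (m - x a) by rewrite mulr_ge0 // subr_ge0.
  by rewrite mul1r; move: h; rewrite expr2; lra.
apply: (le_trans (ler_sum _ (fun a _ => step a))).
rewrite sumrB -mulr_suml big_split /= !sumr_const cardT -cardE.
have -> : \sum_a x a = m ^+ 2 by rewrite -natr_sum sum_card_lcoset natrM expr2.
rewrite -[X in X + _ ^+ 2]mulr_natl -[X in _ - X]mulr_natl.
rewrite /defect -/m mulfV ?gt_eqF ?card_group_gt0 //.
rewrite le_eqVlt; apply/orP; left; apply/eqP; field.
by rewrite !gt_eqF ?card_group_gt0.
Qed.
End Covering.

(** * Dirichlet series with coefficients between 0 and 1 *)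

Section DominatedSums.
Context {R : realType}.
Implicit Types (f g : nat -> R).

Definition tsum f : R := limn (series f).
Definition dominated (s : R) f := forall n, 0 <= f n <= (if n == 0%N then 0 else pw s n).

Lemma dominated_is_cvg (d : R) f : 0 < d -> dominated (1 + d) f -> cvgn (series f).
Proof.
move=> d0 df; apply: nondecreasing_is_cvgn.
  by apply: nondecreasing_series => n _ _; have /andP[] := df n.
exists (1 + d^-1) => _ [n _ <-]; rewrite /series /=.
case: n => [|n]; first by rewrite big_geq // addr_ge0 // invr_ge0 ltW.
apply: le_trans (sum_pw_le n d0); rewrite big_ltn //.
have /andP[h1 h2] := df 0%N; rewrite (@le_anti _ _ (f 0%N) 0) ?h1 ?h2 // add0r.
rewrite !big_nat; apply: ler_sum => i /andP[i0 _]; have /andP[_] := df i.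
by rewrite gtn_eqF.
Qed.

Lemma tsum_ge_partial (d : R) f n : 0 < d -> dominated (1 + d) f -> \sum_(0 <= i < n) f i <= tsum f.
Proof.
move=> d0 df; apply: (nondecreasing_cvgn_le _ (dominated_is_cvg d0 df) n).
by apply: nondecreasing_series => k _ _; have /andP[] := df k.
Qed.

Lemma tsum_le_bound (d : R) f (b : R) : 0 < d -> dominated (1 + d) f ->
  (forall n, exists2 m, (n <= m)%N & \sum_(0 <= i < m) f i <= b) -> tsum f <= b.
Proof.
move=> d0 df H; apply: limr_le; first exact: dominated_is_cvg df.
apply: nearW => n; have [m nm] := H n; apply: le_trans.
apply: (@nondecreasing_series _ f xpredT 0%N _ n m nm) => k _ _; by have /andP[] := df k.
Qed.

Lemma tsum_ge0 (d : R) f : 0 < d -> dominated (1 + d) f -> 0 <= tsum f.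
Proof. by move=> d0 df; have := tsum_ge_partial 0 d0 df; rewrite big_geq. Qed.

Lemma tsumB (d : R) f g : 0 < d -> dominated (1 + d) f -> dominated (1 + d) g ->
  tsum (fun n => f n - g n) = tsum f - tsum g.
Proof.
move=> d0 df dg; rewrite /tsum -limB; [|exact: dominated_is_cvg df|exact: dominated_is_cvg dg].
congr (limn _); apply/funext => n; rewrite /series /= sumrB //.
Qed.

Lemma tsumZ (d c : R) f : 0 < d -> dominated (1 + d) f -> tsum (fun n => c * f n) = c * tsum f.
Proof.
move=> d0 df; apply/cvg_lim => //.
have -> : series (fun n => c * f n) = (fun n => c * series f n).
  by apply/funext => n; rewrite /series /= mulr_sumr.
exact: (cvgM (cvg_cst c) (dominated_is_cvg d0 df)).
Qed.

Lemma tsum_multiples (d : R) f p : 0 < d -> (0 < p)%N -> dominated (1 + d) f ->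
  dominated (1 + d) (fun m => f (p * m)%N) ->
  tsum (fun n => if (p %| n)%N then f n else 0) = tsum (fun m => f (p * m)%N).
Proof.
move=> d0 p0 df dfp.
have dd : dominated (1 + d) (fun n => if (p %| n)%N then f n else 0).
  move=> n; case: ifP => _; first exact: df.
  by rewrite lexx /=; case: ifP => // _; exact: pw_ge0.
have E K : \sum_(0 <= n < p * K) (if (p %| n)%N then f n else 0) = \sum_(0 <= m < K) f (p * m)%N.
  elim: K => [|K IH]; first by rewrite muln0 !big_geq.
  rewrite mulnS addnC (@big_cat_nat _ _ _ (p * K)%N) ?leq_addr //= IH big_nat_recr //=; congr (_ + _).
  rewrite -{1}[(p * K)%N]add0n big_addn addKn.
  case: p p0 {df dfp dd IH} => // p _; rewrite big_nat_recl // add0n dvdn_mulr // big_nat big1 ?addr0 // => i ip.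
  rewrite dvdn_addl ?dvdn_mulr // gtnNdvd //.
apply/eqP; rewrite eq_le; apply/andP; split.
  apply: (tsum_le_bound d0 dd) => n; exists (p * n)%N; first by rewrite leq_pmull.
  by rewrite E; exact: tsum_ge_partial dfp.
apply: (tsum_le_bound d0 dfp) => n; exists n => //.
by rewrite -E; exact: tsum_ge_partial dd.
Qed.
End DominatedSums.

(** * Residue classes prime to q *)

Section Residues.
Context {R : realType}.
Variables (q : nat) (q1 : (1 < q)%N).

Definition cop n := coprime q n.
(* [cl n] is the junk value [1] when [n] is not prime to [q]. *)
Definition cl (n : nat) : {unit 'Z_q} := insubd (1%g : {unit 'Z_q}) (n%:R : 'Z_q).

Lemma cop_gt0 n : cop n -> (0 < n)%N.
Proof. by case: n => //; rewrite /cop /coprime gcdn0 => /eqP E; move: q1; rewrite E. Qed.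

Lemma cop_mul m n : cop (m * n) = cop m && cop n.
Proof. exact: coprimeMr. Qed.

Lemma val_cl n : cop n -> val (cl n) = n%:R.
Proof. by move=> cn; rewrite /cl val_insubd unitZpE // (_ : coprime q n = true). Qed.

Lemma cl_mul m n : cop m -> cop n -> cl (m * n) = (cl m * cl n)%g.
Proof.
move=> cm cn; apply: val_inj; rewrite val_cl ?cop_mul ?cm // natrM.
by rewrite [RHS]/= !val_cl.
Qed.

Lemma cl_eqE m n : cop m -> cop n -> (cl m == cl n) = (m == n %[mod q]).
Proof.
move=> cm cn; rewrite -(inj_eq val_inj) !val_cl // -(inj_eq val_inj) /=.
by rewrite !val_Zp_nat.
Qed.

Definition rep (a : {unit 'Z_q}) : nat := val (val a).

Lemma rep_lt a : (rep a < q)%N.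
Proof. by rewrite /rep -[X in (_ < X)%N](Zp_cast q1) ltn_ord. Qed.

Lemma rep_cop a : cop (rep a).
Proof. by rewrite /cop -unitZpE // natr_Zp; case: a. Qed.

Lemma cl_rep a : cl (rep a) = a.
Proof. by apply: val_inj; rewrite val_cl ?rep_cop // natr_Zp. Qed.

Lemma cop_modn n : cop (n %% q) = cop n.
Proof. by rewrite /cop coprime_modr. Qed.

Lemma cl_modn n : cop n -> cl (n %% q) = cl n.
Proof. by move=> cn; apply/eqP; rewrite cl_eqE ?cop_modn // modn_mod. Qed.

Definition inclass (a : {unit 'Z_q}) n := cop n && (cl n == a).

Lemma inclassE a n : inclass a n = (n %% q == rep a)%N.
Proof.
rewrite /inclass; apply/andP/eqP => [[cn /eqP <-]|E].
  apply/eqP; have := cl_modn cn; rewrite -{1}(cl_rep (cl n)) => /eqP.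
  by rewrite cl_eqE ?cop_modn ?rep_cop // modn_mod (modn_small (rep_lt _)).
have cn : cop n by rewrite -cop_modn E rep_cop.
by split => //; rewrite -(cl_rep a) cl_eqE ?rep_cop // E (modn_small (rep_lt _)).
Qed.

Lemma class_partial (F : nat -> R) a L :
  \sum_(0 <= n < q * L) (if inclass a n then F n else 0) = \sum_(0 <= i < L) F (rep a + q * i)%N.
Proof.
elim: L => [|L IH]; first by rewrite muln0 !big_geq.
rewrite mulnS addnC (@big_cat_nat _ _ _ (q * L)%N) ?leq_addr //= IH big_nat_recr //=; congr (_ + _).
rewrite -{1}[(q * L)%N]add0n big_addn addKn.
rewrite (bigD1_seq (rep a)) ?mem_index_iota ?iota_uniq ?rep_lt //=.
rewrite inclassE addnC (mulnC q) modnMDl (modn_small (rep_lt _)) eqxx big_nat_cond big1 ?addr0 // => i.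
move=> /andP[/andP[_ iq] ia].
by rewrite inclassE addnC modnMDl modn_small // (negPf ia).
Qed.

Lemma class_dominated (d : R) a (h : nat -> R) : (forall n, 0 <= h n <= 1) ->
  dominated (1 + d) (fun n => if inclass a n then pw (1 + d) n * h n else 0).
Proof.
move=> h01 n; have /andP[h0 h1] := h01 n; case: ifP => [|_]; last first.
  by apply/andP; split => //; case: ifP => // _; exact: pw_ge0.
case/andP => cn _; rewrite gtn_eqF ?cop_gt0 // mulr_ge0 ?pw_ge0 //=.
by rewrite ler_piMr ?pw_ge0.
Qed.

Definition zclass (d : R) a := tsum (fun n => if inclass a n then pw (1 + d) n else 0).

Lemma zclass_dom (d : R) a : dominated (1 + d) (fun n => if inclass a n then pw (1 + d) n else 0).
Proof.
have := @class_dominated d a (fun=> 1) (fun n => _); under eq_fun do rewrite mulr1; apply=> n.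
by rewrite ler01 lexx.
Qed.

(** Interlacing: each member of the class of a, except the first, is larger than the preceding
    member of the class of b, and the first contributes at most 1. *)
Lemma zclass_close (d : R) a b : 0 < d -> zclass d a <= zclass d b + 1.
Proof.
move=> d0; apply: (tsum_le_bound d0 (zclass_dom d a)) => L; exists (q * L)%N.
  by rewrite leq_pmull // ltnW.
apply: le_trans (lerD (tsum_ge_partial (q * L) d0 (zclass_dom d b)) (lexx 1)).
rewrite !class_partial; case: L => [|L]; first by rewrite !big_geq // add0r.
rewrite big_nat_recl // addrC muln0 addn0; apply: lerD.
  rewrite big_nat_recr //=; apply: ler_wpDr; first exact: pw_ge0.
  apply: ler_sum => i _; apply: pw_anti; first by rewrite addr_ge0 // ltW.
    by rewrite addn_gt0 cop_gt0 ?rep_cop.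
  by rewrite mulnS addnA leq_add2r (leq_trans (ltnW (rep_lt b))) // leq_addl.
by apply: pw_le1; [rewrite addr_ge0 // ltW | exact/cop_gt0/rep_cop].
Qed.

(** The members of a class are bounded by q, 2 q, 3 q and so on, hence the sum is at least q^(-1-d)
    zeta(1 + d); the condition on d ensures q^-d >= 1/2. *)
Lemma zclass_lower (d : R) a : 0 < d -> d <= (2 * q%:R)^-1 -> (2 * q%:R * d)^-1 <= zclass d a.
Proof.
move=> d0 dq; have q0 : 0 < q%:R :> R by rewrite ltr0n ltnW.
have pq : 2^-1 <= pw d q.
  rewrite /pw; apply: le_trans (expR_ge1Dx _).
  have : d * ln q%:R <= 2^-1.
    apply: (@le_trans _ _ ((2 * q%:R)^-1 * q%:R)).
      by apply: ler_pM => //; [exact: ltW | rewrite ln_ge0 // ler1n ltnW | apply: ltW; apply: lt_le_trans (ln_sublinear q0) _].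
    by rewrite invfM mulfVK ?gt_eqF.
  rewrite mulNr; lra.
apply/ler_addgt0Pr => e e0.
have e1 : 0 < e * d by rewrite mulr_gt0.
have [N HN] := pw_small d0 e1.
pose L := N.+1.
apply: le_trans (lerD (tsum_ge_partial (q * L) d0 (zclass_dom d a)) (lexx e)).
rewrite class_partial.
apply: (@le_trans _ _ (pw (1 + d) q * \sum_(1 <= i < L.+1) pw (1 + d) i + e)); last first.
  rewrite lerD2r mulr_sumr big_add1 /= !big_nat; apply: ler_sum => i _.
  rewrite -pwM ?(ltnW q1) //; apply: pw_anti; first by rewrite addr_ge0 // ltW.
    by rewrite addn_gt0 cop_gt0 ?rep_cop.
  by rewrite mulnS leq_add2r ltnW ?rep_lt.
have HL := HN L.+1 (leqW (leqnSn N)) isT.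
have H := sum_pw_ge L d0.
have p0 := pw_ge0 (1 + d) q.
have p1 : pw (1 + d) q <= 1 by apply: pw_le1; [rewrite addr_ge0 // ltW | exact: ltnW].
have H2 := ler_wpM2l p0 H.
apply: (@le_trans _ _ (pw (1 + d) q * (d^-1 * (1 - pw d L.+1)) + e)); last by rewrite lerD2r.
have H3 : (2 * q%:R)^-1 <= pw (1 + d) q.
  rewrite pwD pw_inv ?(ltnW q1) // invfM mulrC ler_wpM2l // invr_ge0 ltW //.
have H4 : (2 * q%:R * d)^-1 <= pw (1 + d) q * d^-1 by rewrite invfM ler_wpM2r // invr_ge0 ltW.
have H5 : pw (1 + d) q * (d^-1 * pw d L.+1) <= e.
  apply: (@le_trans _ _ (1 * (d^-1 * (e * d)))); last by rewrite mul1r mulrCA mulVf ?mulr1 ?gt_eqF.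
  apply: ler_pM => //; first by rewrite mulr_ge0 ?pw_ge0 // invr_ge0 ltW.
  by rewrite ler_wpM2l // invr_ge0 ltW.
by rewrite mulrA mulrBr mulr1 -!mulrA; lra.
Qed.
End Residues.

(** * Sieving Dirichlet series *)

Section Sieve.
Context {R : realType}.
Implicit Types (d : R) (x : nat -> R) (ps : seq nat) (Q : pred nat).

(** The weight x p = 1 removes the multiples of p, and x p = 0 leaves them untouched. With x p =
    p^-(d - e) and exponent 1 + e, the terms are those of [nu d e] wherever all prime factors that
    are at stake belong to [ps]. *)
Definition sieved d x ps Q n : R :=
  if Q n then pw (1 + d) n * \prod_(p <- ps) (if (p %| n)%N then 1 - x p else 1) else 0.

Lemma prod_if01 x ps n : (forall p, 0 <= x p <= 1) ->
  0 <= \prod_(p <- ps) (if (p %| n)%N then 1 - x p else 1) <= 1.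
Proof.
move=> x01; elim: ps => [|p ps /andP[h0 h1]]; first by rewrite big_nil ler01 lexx.
rewrite big_cons; have /andP[a b] := x01 p; have /andP[u v] : 0 <= (if (p %| n)%N then 1 - x p else 1) <= 1.
  by case: ifP; rewrite ?ler01 ?lexx // subr_ge0 b gerBl a.
by rewrite mulr_ge0 //= -[leRHS]mulr1 ler_pM.
Qed.

Lemma sieved_dom d x ps Q : (forall p, 0 <= x p <= 1) -> (forall n, Q n -> (0 < n)%N) ->
  dominated (1 + d) (sieved d x ps Q).
Proof.
move=> x01 Q0 n; rewrite /sieved; have /andP[h0 h1] := prod_if01 ps n x01; case: ifP => [Qn|_]; last first.
  by rewrite lexx /=; case: ifP => // _; exact: pw_ge0.
rewrite gtn_eqF ?Q0 // mulr_ge0 ?pw_ge0 //=.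
by rewrite ler_piMr ?pw_ge0.
Qed.

(** One step of inclusion-exclusion: the multiples p m of p form again a sieved sum in m, since p is
    distinct from the primes in [ps]. *)
Lemma sieved_cons d x p ps Q : 0 < d -> (forall p, 0 <= x p <= 1) -> (forall n, Q n -> (0 < n)%N) ->
  prime p -> all prime ps -> p \notin ps ->
  tsum (sieved d x (p :: ps) Q) =
  tsum (sieved d x ps Q) - x p * pw (1 + d) p * tsum (sieved d x ps (fun m => Q (p * m)%N)).
Proof.
move=> d0 x01 Q0 pp pps pn; have /andP[xp0 xp1] := x01 p.
have p0 := prime_gt0 pp.
have Q0' m : Q (p * m)%N -> (0 < m)%N by move/Q0; rewrite muln_gt0 => /andP[].
have D1 := sieved_dom d ps x01 Q0; have D2 := sieved_dom d ps x01 Q0'.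
have EM m : sieved d x ps Q (p * m)%N = pw (1 + d) p * sieved d x ps (fun m => Q (p * m)%N) m.
  rewrite /sieved; case: ifP => [Qm|_]; last by rewrite mulr0.
  rewrite pwM ?(Q0' m) // -mulrA; congr (_ * (_ * _)); rewrite !big_seq; apply: eq_bigr => r rps.
  rewrite Euclid_dvdM ?(allP pps r) // dvdn_prime2 ?(allP pps r) //.
  by case: eqP => // E; move: pn; rewrite -E rps.
have D3 : dominated (1 + d) (fun m => sieved d x ps Q (p * m)%N).
  move=> m; rewrite EM; have /andP[a b] := D2 m; rewrite mulr_ge0 ?pw_ge0 //=.
  have P1 : pw (1 + d) p <= 1 by apply: pw_le1 => //; rewrite addr_ge0 // ltW.
  by apply: le_trans b; rewrite ler_piMl.
have D4 : dominated (1 + d) (fun n => if (p %| n)%N then sieved d x ps Q n else 0).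
  move=> n; case: ifP => _; first exact: D1.
  by rewrite lexx /=; case: ifP => // _; exact: pw_ge0.
have D5 : dominated (1 + d) (fun n => x p * (if (p %| n)%N then sieved d x ps Q n else 0)).
  move=> n; have /andP[a b] := D4 n; rewrite mulr_ge0 //=; apply: le_trans b.
  by rewrite ler_piMl.
transitivity (tsum (fun n => sieved d x ps Q n - x p * (if (p %| n)%N then sieved d x ps Q n else 0))).
  congr tsum; apply/funext => n; rewrite /sieved; case: ifP => Qn; last by case: ifP; rewrite mulr0 subr0.
  rewrite big_cons; case: ifP => _; [ring|by rewrite mulr0 subr0 mul1r].
rewrite (tsumB d0) // (tsumZ _ d0) // (tsum_multiples d0 p0) //; congr (_ - _); rewrite -mulrA; congr (_ * _).
by rewrite -(tsumZ _ d0) //; congr tsum; apply/funext => m.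
Qed.
End Sieve.

Lemma sum_pw_tail (R : realType) (d : R) m n : 0 < d -> (0 < m)%N -> \sum_(m.+1 <= i < n) pw (1 + d) i <= d^-1 * pw d m.
Proof.
move=> d0 m0; case: (leqP n m.+1) => [h|h]; first by rewrite big_geq // mulr_ge0 ?pw_ge0 // invr_ge0 ltW.
suff H : \sum_(m.+1 <= i < n) pw (1 + d) i <= d^-1 * (pw d m - pw d n.-1).
  apply: (le_trans H); apply: ler_wpM2l; first by rewrite invr_ge0 ltW.
  by rewrite gerBl pw_ge0.
rewrite -(subnKC h); elim: (n - m.+2)%N => [|k IH].
  rewrite addn0 big_nat1 /= -ler_pdivrMl ?invr_gt0 // invrK; apply: pw_step_ge => //; exact: ltW.
rewrite addnS big_nat_recr /=; last by lia.
apply: (le_trans (lerD IH (lexx _))); rewrite -lerBrDl -mulrBr opprB addrCA [pw d m - _]addrC addrK /=.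
rewrite -ler_pdivrMl ?invr_gt0 // invrK addSn /=.
by apply: pw_step_ge => //; exact: ltW.
Qed.

Section ClassSieve.
Context {R : realType}.
Variables (q : nat) (q1 : (1 < q)%N).
Implicit Types (a b : {unit 'Z_q}) (ps : seq nat).

Lemma inclass_gt0 a n : inclass a n -> (0 < n)%N.
Proof. by case/andP => /(cop_gt0 q1). Qed.

Lemma inclass_mul a p m : cop q p -> inclass a (p * m) = inclass ((cl q p)^-1 * a)%g m.
Proof.
move=> cp; rewrite /inclass cop_mul cp /=; case: (boolP (cop q m)) => //= cm.
by rewrite cl_mul //; apply/eqP/eqP => [<-|->]; rewrite ?mulKg ?mulKVg.
Qed.

Definition coprimes Y := [seq p <- iota 0 Y | prime p && coprime q p].

Lemma mem_coprimes Y p : (p \in coprimes Y) = [&& prime p, cop q p & (p < Y)%N].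
Proof. by rewrite /coprimes mem_filter mem_iota add0n -andbA. Qed.

(** Sieving by p subtracts p^(-1-d) times the sieved sum of another class. All classes have the same
    sum up to 1, so the main term acquires the factor 1 - p^(-1-d) and the error at most the factor
    1 + p^(-1-d). *)
Lemma class_sieve_close (d e : R) ps a : 0 < e -> e <= d -> uniq ps -> all (fun p => prime p && cop q p) ps ->
  `|tsum (sieved e (pw (d - e)) ps (inclass a)) - \prod_(p <- ps) (1 - pw (1 + d) p) * zclass e (1%g : {unit 'Z_q})|
  <= \prod_(p <- ps) (1 + pw (1 + d) p).
Proof.
move=> e0 ed; elim: ps a => [|p ps IH] a.
  move=> _ _; rewrite !big_nil mul1r.
  have -> : tsum (sieved e (pw (d - e)) [::] (inclass a)) = zclass e a.
    by congr tsum; apply/funext => n; rewrite /sieved big_nil mulr1.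
  have h1 := zclass_close q1 a 1%g e0; have h2 := zclass_close q1 1%g a e0.
  by rewrite ler_norml; apply/andP; split; lra.
move=> /= /andP[pn u] /andP[/andP[pp cp] al].
pose x n : R := if (0 < n)%N then pw (d - e) n else 1.
have x01 n : 0 <= x n <= 1.
  by rewrite /x; case: ifP => n0; rewrite ?ler01 ?lexx // pw_ge0 pw_le1 // subr_ge0.
have E qs Q : all prime qs -> sieved e (pw (d - e)) qs Q = sieved e x qs Q.
  move=> aq; apply/funext => n; rewrite /sieved; case: ifP => // _; congr (_ * _).
  rewrite !big_seq; apply: eq_bigr => r rq; rewrite /x prime_gt0 //; exact: (allP aq).
have aps : all prime ps by apply: sub_all al => r /andP[].
have EX : x p * pw (1 + e) p = pw (1 + d) p.
  rewrite /x prime_gt0 // -pwD.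
  by rewrite (_ : d - e + (1 + e) = 1 + d) // addrCA subrK.
rewrite E /= ?pp // sieved_cons //; last exact: inclass_gt0.
rewrite EX !big_cons.
have EQ : (fun m => inclass a (p * m)) = inclass ((cl q p)^-1 * a)%g.
  by apply/funext => m; rewrite inclass_mul.
rewrite EQ -!E //.
have := IH ((cl q p)^-1 * a)%g u al; have := IH a u al.
set A := tsum _; set B := tsum _; set P := \prod_(p <- ps) (1 - _); set S := \prod_(p <- ps) _; set z := zclass _ _.
set y := pw (1 + d) p => HA HB.
have y0 : 0 <= y by exact: pw_ge0.
have -> : A - y * B - (1 - y) * P * z = (A - P * z) - y * (B - P * z) by ring.
apply: le_trans (ler_normB _ _) _; rewrite normrM (ger0_norm y0) mulrDl mul1r.
by apply: lerD => //; apply: ler_wpM2l.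
Qed.

Definition zcop (d : R) := tsum (fun n => if cop q n then pw (1 + d) n else 0).

Lemma euler_sieve (d : R) ps : 0 < d -> uniq ps -> all (fun p => prime p && cop q p) ps ->
  tsum (sieved d (fun=> 1) ps (cop q)) = \prod_(p <- ps) (1 - pw (1 + d) p) * zcop d.
Proof.
move=> d0; elim: ps => [|p ps IH] /=.
  move=> _ _; rewrite big_nil mul1r; congr tsum; apply/funext => n; rewrite /sieved big_nil mulr1 //.
move=> /andP[pn u] /andP[/andP[pp cp] al].
rewrite sieved_cons //; last first.
- by apply: sub_all al => r /andP[].
- exact: cop_gt0.
- by move=> r; rewrite ler01 lexx.
rewrite (_ : (fun m => cop q (p * m)) = cop q) ?IH //; last by apply/funext => m; rewrite cop_mul cp.
rewrite big_cons; ring.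
Qed.

Lemma coprimes_uniq Y : uniq (coprimes Y). Proof. exact/filter_uniq/iota_uniq. Qed.
Lemma coprimes_all Y : all (fun p => prime p && cop q p) (coprimes Y).
Proof. exact: filter_all. Qed.

Lemma cop1 : cop q 1. Proof. by rewrite /cop coprimen1. Qed.

Lemma euler_ge1 (d : R) ps : 0 < d -> uniq ps -> all (fun p => prime p && cop q p) ps ->
  1 <= \prod_(p <- ps) (1 - pw (1 + d) p) * zcop d.
Proof.
move=> d0 u al; rewrite -euler_sieve //.
have D : dominated (1 + d) (sieved d (fun=> 1) ps (cop q)).
  by apply: sieved_dom => [p|n /(cop_gt0 q1)]; rewrite ?ler01 ?lexx.
apply: le_trans (tsum_ge_partial 2 d0 D).
rewrite !big_nat_recr //= big_geq // add0r /sieved cop1 pw1 mul1r.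
apply: ler_wpDl; first by have /andP[] := D 0%N.
rewrite big_seq big1 // => p pps; have /andP[pp _] := allP al _ pps.
by rewrite dvdn1; case: eqP pp => // ->.
Qed.

(** After removal of the multiples of all primes up to Y prime to q, only 1 and integers beyond Y
    survive. *)
Lemma euler_le (d : R) Y : 0 < d -> (0 < Y)%N ->
  \prod_(p <- coprimes Y.+1) (1 - pw (1 + d) p) * zcop d <= 1 + d^-1 * pw d Y.
Proof.
move=> d0 Y0; rewrite -euler_sieve ?coprimes_uniq ?coprimes_all //.
set ps := coprimes _.
have D : dominated (1 + d) (sieved d (fun=> 1) ps (cop q)).
  by apply: sieved_dom => [p|n /(cop_gt0 q1)]; rewrite ?ler01 ?lexx.
apply: (tsum_le_bound d0 D) => L; exists (Y.+1 + L)%N; first by rewrite leq_addl.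
rewrite (@big_cat_nat _ _ _ Y.+1) ?leq_addr //=; apply: lerD; last first.
  apply: le_trans (sum_pw_tail (Y.+1 + L) d0 Y0); rewrite !big_nat; apply: ler_sum => n /andP[Yn _].
  by have /andP[_] := D n; rewrite gtn_eqF // (leq_trans _ Yn).
rewrite (bigD1_seq 1%N) ?mem_index_iota ?iota_uniq //= big_nat_cond big1 ?addr0; last first.
  move=> n /andP[/andP[_ nY] n1]; rewrite /sieved; case: ifP => // cn.
  have n2 : (1 < n)%N by rewrite ltn_neqAle eq_sym n1 (cop_gt0 q1).
  rewrite (bigD1_seq (pdiv n)) ?coprimes_uniq //=; first by rewrite pdiv_dvd subrr mul0r mulr0.
  rewrite mem_coprimes pdiv_prime // (leq_ltn_trans (pdiv_leq _)) ?(ltnW n2) // andbT.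
  by rewrite /cop (coprime_dvdr (pdiv_dvd n)).
by have /andP[_] := D 1%N; rewrite /= pw1.
Qed.

(* The Dirichlet convolution of [pw (1 + d)] and [nu d e] is [pw (1 + e)], see [pw_convolution]. *)
Definition nu (d e : R) n : R := pw (1 + e) n * \prod_(p <- primes n) (1 - pw (d - e) p).

Lemma nu_ge0 (d e : R) n : e <= d -> 0 <= nu d e n.
Proof.
move=> ed; rewrite mulr_ge0 ?pw_ge0 // big_seq prodr_ge0 // => p; rewrite mem_primes => /andP[pp _].
by rewrite subr_ge0 pw_le1 ?subr_ge0 ?prime_gt0.
Qed.

(** Once [ps] contains all primes up to y that are prime to q, for some y >= Y, the terms with n < Y
    occur in a sieved sum, which is at most P z + S. As y grows, P tends to 1 / [zcop q d], and S
    stays below [zcop q d]. *)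
Lemma nu_class_sum (d e : R) a Y : 0 < e -> e <= d ->
  \sum_(0 <= n < Y) (if inclass a n then nu d e n else 0) <= zclass e (1%g : {unit 'Z_q}) / zcop d + zcop d.
Proof.
move=> e0 ed; have d0 : 0 < d by exact: lt_le_trans ed.
set z := zclass _ _; set Z := zcop d.
have z0 : 0 <= z by exact: (tsum_ge0 e0 (zclass_dom q1 e _)).
have Z1 : 1 <= Z by have := @euler_ge1 d [::] d0 isT isT; rewrite big_nil mul1r.
have Z0 : 0 < Z by apply: lt_le_trans Z1.
apply/ler_addgt0Pr => t t0.
have t1 : 0 < d * (t / (z + 1)) by rewrite mulr_gt0 // divr_gt0 // ltr_wpDl.
have [N HN] := pw_small d0 t1.
pose y := maxn 1 (maxn N Y).
have y0 : (0 < y)%N by rewrite leq_max.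
have Ny : (N <= y)%N by rewrite !leq_max leqnn !orbT.
have Yy : (Y <= y)%N by rewrite !leq_max leqnn !orbT.
have Hy := HN _ Ny y0.
set ps := coprimes y.+1.
have U := coprimes_uniq y.+1; have AL := coprimes_all y.+1.
have H1 := class_sieve_close a e0 ed U AL.
have H2 := euler_le d0 y0.
have H3 := euler_ge1 d0 U AL.
rewrite -/ps -/z -/Z in H1 H2 H3.
set P := \prod_(p <- ps) _ in H1 H2 H3; set S := \prod_(p <- ps) _ in H1.
have P0 : 0 < P by rewrite -(pmulr_lgt0 _ Z0); apply: lt_le_trans H3.
(* S P is a product of factors 1 - p^(-2-2d), hence at most 1, while P Z is at least 1. *)
have HS : S <= Z.
  have SP : S * P <= 1.
    rewrite /S /P -big_split /= big_seq; apply: prodr_ile1 => p pps.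
    have /andP[pp _] := allP AL _ pps.
    have -> : (1 + pw (1 + d) p) * (1 - pw (1 + d) p) = 1 - pw (1 + d) p ^+ 2 by ring.
    have p1 : pw (1 + d) p <= 1 by rewrite pw_le1 ?prime_gt0 // addr_ge0 // ltW.
    have p2 := pw_ge0 (1 + d) p.
    by rewrite subr_ge0 expr_le1 // p1 gerBl sqr_ge0.
  by rewrite -(ler_pM2r P0) (le_trans SP) // mulrC.
have HP : P <= (1 + t / (z + 1)) / Z.
  rewrite ler_pdivlMr //; apply: le_trans H2 _; rewrite lerD2l ler_pdivrMl //.
have D : dominated (1 + e) (sieved e (pw (d - e)) ps (inclass a)).
  pose x n : R := if (0 < n)%N then pw (d - e) n else 1.
  have x01 n : 0 <= x n <= 1.
    by rewrite /x; case: ifP => n0; rewrite ?ler01 ?lexx // pw_ge0 pw_le1 // subr_ge0.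
  rewrite (_ : sieved _ _ _ _ = sieved e x ps (inclass a)).
    by apply: sieved_dom => // n; exact: inclass_gt0.
  apply/funext => n; rewrite /sieved; case: ifP => // _; congr (_ * _).
  rewrite !big_seq; apply: eq_bigr => r /(allP AL)/andP[rp _]; rewrite /x prime_gt0 //.
have H4 : \sum_(0 <= n < Y) (if inclass a n then nu d e n else 0) <= tsum (sieved e (pw (d - e)) ps (inclass a)).
  apply: le_trans (tsum_ge_partial Y e0 D); rewrite !big_nat; apply: ler_sum => n /andP[_ nY].
  rewrite /sieved; case: ifP => // Qn; rewrite /nu ler_wpM2l ?pw_ge0 //.
  suff -> : \prod_(p <- ps) (if (p %| n)%N then 1 - pw (d - e) p else 1) = \prod_(p <- primes n) (1 - pw (d - e) p) by [].
  rewrite -big_mkcond /= -big_filter; apply: perm_big.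
  have n0 := inclass_gt0 Qn.
  apply: uniq_perm; [exact: filter_uniq | exact: primes_uniq | move=> p].
  rewrite mem_primes mem_filter mem_coprimes n0.
  apply/andP/and3P => [[pn /and3P[pp _ _]]|[pp _ pn]]; first by split.
  have pn' := dvdn_leq n0 pn; have py : (p < y.+1)%N.
    exact: leq_ltn_trans pn' (leq_trans nY (leq_trans Yy (leqnSn y))).
  split => //; rewrite py andbT.
  by rewrite pp /cop (coprime_dvdr pn) //; case/andP: Qn.
apply: (le_trans H4).
have H5 : tsum (sieved e (pw (d - e)) ps (inclass a)) <= P * z + S.
  by move: H1; rewrite ler_norml => /andP[_]; lra.
apply: (le_trans H5).
have H6 : P * z <= z / Z + t.
  apply: (@le_trans _ _ ((1 + t / (z + 1)) / Z * z)); first exact: ler_wpM2r.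
  rewrite mulrAC mulrDl mul1r mulrDl lerD2l.
  have h : t / (z + 1) * z <= t.
    by rewrite mulrAC ler_pdivrMr ?ltr_wpDl // ler_wpM2l ?(ltW t0) // lerDl ler01.
  rewrite ler_pdivrMr //; apply: (le_trans h); rewrite ler_peMr // ltW //.
by lra.
Qed.
End ClassSieve.

(** * A Dirichlet convolution changing the exponent *)

Section DivisorIdentity.
Context {R : realType}.

(** For a prime power the sum telescopes, and both factors are multiplicative. The induction removes
    one prime: its two parts have values p^-s and 1 - p^-s. *)
Lemma divisor_identity (s : R) N : (0 < N)%N ->
  \sum_(n <- divisors N) pw s (N %/ n) * \prod_(p <- primes n) (1 - pw s p) = 1.
Proof.
elim/ltn_ind: N => N IH N0; case: (leqP N 1) => [N1|N1].
  have -> : N = 1%N by apply/eqP; rewrite eqn_leq N1.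
  by rewrite (_ : divisors 1 = [:: 1%N]) // big_seq1 big_nil mulr1 divn1 pw1.
have pp := pdiv_prime N1; set p := pdiv N in pp.
have p0 := prime_gt0 pp.
have [M NM] : exists M, N = (p * M)%N by exists (N %/ p)%N; rewrite mulnC divnK // pdiv_dvd.
have M0 : (0 < M)%N by move: N0; rewrite NM muln_gt0 => /andP[].
have MN : (M < N)%N by rewrite NM -{1}(mul1n M) ltn_mul2r M0 prime_gt1.
have [N' cN' NN'] := pfactor_coprime pp N0.
set k := logn p N in NN'.
have k0 : (0 < k)%N by rewrite logn_gt0 mem_primes pp N0 pdiv_dvd.
have N'0 : (0 < N')%N by move: N0; rewrite NN' muln_gt0 => /andP[].
have pk0 : (0 < p ^ k)%N by rewrite expn_gt0 p0.
have N'N : (N' < N)%N by rewrite NN' -{1}(muln1 N') ltn_mul2l N'0 -(expn0 p) ltn_exp2l ?prime_gt1.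
have pN' : ~~ (p %| N')%N by rewrite -prime_coprime.
(* The two parts are the sums for [N %/ p] and for the part of [N] prime to [p]. *)
rewrite (bigID (fun n => p %| N %/ n)%N) /=.
have -> : \sum_(n <- divisors N | (p %| N %/ n)%N) pw s (N %/ n) * \prod_(p <- primes n) (1 - pw s p) = pw s p.
  apply: (etrans _ (etrans (congr1 (fun t => pw s p * t) (IH M MN M0)) (mulr1 _))).
  rewrite mulr_sumr -big_filter (@perm_big _ _ _ _ _ (divisors M)); last first.
    apply: uniq_perm; [exact/filter_uniq/divisors_uniq | exact: divisors_uniq | move=> n].
    rewrite mem_filter -!dvdn_divisors //; apply/andP/idP => [[pn /dvdnP[w Nw]]|/dvdnP[w Mw]].
      have n0 : (0 < n)%N by move: N0; rewrite Nw muln_gt0 => /andP[].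
      move: pn; rewrite Nw mulnK // => /dvdnP[t wt].
      by apply/dvdnP; exists t; apply/eqP; rewrite -(eqn_pmul2l p0) -NM Nw wt; apply/eqP; ring.
    have n0 : (0 < n)%N by move: M0; rewrite Mw muln_gt0 => /andP[].
    by rewrite NM Mw mulnA mulnK // dvdn_mulr // dvdn_mull.
  rewrite !big_seq; apply: eq_bigr => n; rewrite -dvdn_divisors // => nM.
  have n0 := dvdn_gt0 M0 nM.
  by rewrite NM -muln_divA // pwM ?divn_gt0 // ?(dvdn_leq M0 nM) // mulrA.
have -> : \sum_(n <- divisors N | ~~ (p %| N %/ n)%N) pw s (N %/ n) * \prod_(p <- primes n) (1 - pw s p) = 1 - pw s p.
  apply: (etrans _ (etrans (congr1 (fun t => (1 - pw s p) * t) (IH N' N'N N'0)) (mulr1 _))).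
  rewrite mulr_sumr -big_filter.
  rewrite (@perm_big _ _ _ _ _ [seq (m * p ^ k)%N | m <- divisors N']); last first.
    apply: uniq_perm; first exact/filter_uniq/divisors_uniq.
      rewrite map_inj_uniq ?divisors_uniq // => x y /eqP; rewrite eqn_pmul2r // => /eqP //.
    move=> n; rewrite mem_filter -!dvdn_divisors //; apply/andP/mapP => [[pn /dvdnP[w Nw]]|[m]].
      have n0 : (0 < n)%N by move: N0; rewrite Nw muln_gt0 => /andP[].
      move: pn; rewrite Nw mulnK // => pw'.
      have : (p ^ k %| w * n)%N by rewrite -Nw NN' dvdn_mull.
      rewrite Gauss_dvdr; last by rewrite coprimeXl // prime_coprime.
      move=> /dvdnP[m nm]; exists m => //; rewrite -dvdn_divisors //; apply/dvdnP; exists w.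
      by apply/eqP; rewrite -(eqn_pmul2r pk0) -NN' Nw nm mulnA.
    rewrite -dvdn_divisors // => /dvdnP[w Nw] ->.
    have m0 : (0 < m)%N by move: N'0; rewrite Nw muln_gt0 => /andP[].
    rewrite NN' Nw -mulnA mulnK ?muln_gt0 ?m0 // dvdn_mull //; split => //.
    by apply: contra pN' => h; rewrite Nw dvdn_mulr.
  rewrite big_map !big_seq; apply: eq_bigr => m; rewrite -dvdn_divisors // => mN.
  have m0 := dvdn_gt0 N'0 mN.
  rewrite {1}NN' divnMr // mulrCA; congr (_ * _).
  rewrite (@perm_big _ _ _ _ _ (p :: primes m)) ?big_cons //.
  apply: uniq_perm; first exact: primes_uniq.
    rewrite /= primes_uniq andbT mem_primes m0 pp /=.
    by apply: contra pN' => h; apply: dvdn_trans h mN.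
  by move=> r; rewrite primesM // in_cons primesX // (primes_prime pp) inE orbC.
ring.
Qed.

Lemma pw_convolution (d e : R) N : (0 < N)%N ->
  pw (1 + e) N = \sum_(n <- divisors N) pw (1 + d) (N %/ n) * nu d e n.
Proof.
move=> N0; apply: (etrans (esym (etrans (congr1 (fun t => pw (1 + e) N * t) (divisor_identity (d - e) N0)) (mulr1 _)))).
rewrite mulr_sumr !big_seq; apply: eq_bigr => n.
rewrite -dvdn_divisors // => nN; have n0 := dvdn_gt0 N0 nN.
have nn : (0 < N %/ n)%N by rewrite divn_gt0 // dvdn_leq.
rewrite (_ : 1 + d = (1 + e) + (d - e)); last by rewrite -addrA (addrCA e) subrr addr0.
rewrite [pw (1 + e + _) _]pwD -{1}(divnK nN) [pw (1 + e) (_ * _)]pwM // /nu; ring.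
Qed.
End DivisorIdentity.

Lemma sum_quotients_le (R : realType) n X (P : pred nat) (g : nat -> R) : (0 < n)%N -> (forall m, P m -> 0 <= g m) ->
  \sum_(N < X | (n %| N)%N && P (N %/ n)%N) g (N %/ n)%N <= \sum_(m < X | P m) g m.
Proof.
move=> n0 g0; pose p (N : 'I_X) : 'I_X := Ordinal (leq_ltn_trans (leq_div N n) (ltn_ord N)).
rewrite (partition_big p (fun m : 'I_X => P m)) => [/=|N /andP[]//].
apply: ler_sum => m Pm; rewrite (eq_bigr (fun=> g m)) => [|N /andP[_ /eqP <-] //].
rewrite sumr_const -[leRHS]mulr1n ler_wpMn2l ?g0 //.
apply/card_le1_eqP => N N'; rewrite !unfold_in => /andP[/andP[d1 _] /eqP e1] /andP[/andP[d2 _] /eqP e2].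
apply: val_inj; rewrite /= -(divnK d1) -(divnK d2); congr (_ * _)%N.
by have := congr1 val (etrans e1 (esym e2)).
Qed.

(** * Classes of the divisors of an integer *)

Section DivisorClasses.
Context {R : realType}.
Variables (q : nat) (q1 : (1 < q)%N).
Local Notation gT := {unit 'Z_q}.

(** If N lies in the class of P^2 and the class of P is among these, the cofactor of such a divisor
    lies in the class of P as well, so N is a product of two integers congruent to P. *)
Definition divisor_classes N : {set gT} := finset.finset (fun a => has (fun n => cl q n == a) (divisors N)).

Lemma divisor_classesP N a : (0 < N)%N ->
  reflect (exists2 n, (n %| N)%N & cl q n = a) (a \in divisor_classes N).
Proof.
move=> N0; rewrite finset.inE; apply: (iffP hasP) => [[n]|[n nN na]].
  by rewrite -dvdn_divisors // => nN /eqP <-; exists n.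
by exists n; rewrite -?dvdn_divisors //; apply/eqP.
Qed.

Lemma divisor_classes_neq0 N : (0 < N)%N -> divisor_classes N != finset.set0.
Proof. by move=> N0; apply/set0Pn; exists (cl q 1); apply/divisor_classesP => //; exists 1%N. Qed.

Lemma divisor_classes_mul m n : cop q m -> cop q n ->
  divisor_classes m :|: (cl q n *: divisor_classes m)%g \subset divisor_classes (m * n).
Proof.
move=> cm cn; have m0 := cop_gt0 q1 cm; have n0 := cop_gt0 q1 cn.
have mn0 : (0 < m * n)%N by rewrite muln_gt0 m0.
apply/fintype.subsetP => a; rewrite finset.inE => /orP[/divisor_classesP-/(_ m0)[t tm <-]|].
  by apply/divisor_classesP => //; exists t => //; exact: dvdn_mulr.
case/lcosetP => b /divisor_classesP-/(_ m0)[t tm <-] ->.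
apply/divisor_classesP => //; exists (n * t)%N; first by rewrite mulnC dvdn_mul.
by rewrite cl_mul // /cop (coprime_dvdr tm).
Qed.

Definition weighted_defect (d : R) X := \sum_(N < X | cop q N) pw (1 + d) N * defect (divisor_classes N).

(** By [pw_convolution] the weight N^-(1 + e) is shared among the factorizations N = m n. The
    divisor classes of N contain those of m and their translate by the class of n; as no class of n
    weighs more than [B], this translate is as good as random and [defect_avg] applies for each
    m. *)
Lemma weighted_defect_step (d e B : R) X : e <= d ->
  (forall a : gT, \sum_(n < X | inclass a n) nu d e n <= B) ->
  weighted_defect e X <= #|{: gT}|%:R * B / 2 * weighted_defect d X.
Proof.
move=> ed HB; pose F m n : R := pw (1 + d) m * nu d e n * defect (divisor_classes m :|: (cl q n *: divisor_classes m)%g).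
have un0 m n : cop q m -> divisor_classes m :|: (cl q n *: divisor_classes m)%g != finset.set0.
  move=> cm; have := divisor_classes_neq0 (cop_gt0 q1 cm); apply: contra => /eqP h.
  by rewrite -finset.subset0 -h finset.subsetUl.
have F0 m n : cop q m -> 0 <= F m n.
  move=> cm; apply: mulr_ge0; last exact/defect_ge0/un0.
  by apply: mulr_ge0; [exact: pw_ge0 | exact: nu_ge0].
have H1 : weighted_defect e X <= \sum_(N < X | cop q N) \sum_(n < X | (n %| N)%N) F (N %/ n)%N n.
  apply: ler_sum => N cN; have N0 := cop_gt0 q1 cN.
  rewrite (pw_convolution d e N0) mulr_suml.
  have -> : \sum_(n < X | (n %| N)%N) F (N %/ n)%N n = \sum_(n <- divisors N) F (N %/ n)%N n.
    rewrite -(big_mkord (fun n => n %| N)%N (fun n => F (N %/ n)%N n)) -big_filter; apply: perm_big.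
    apply: uniq_perm; [exact/filter_uniq/iota_uniq | exact: divisors_uniq | move=> n].
    rewrite mem_filter mem_index_iota -dvdn_divisors //=; case: (boolP (n %| N)%N) => //= nN.
    exact: leq_ltn_trans (dvdn_leq N0 nN) (ltn_ord N).
  rewrite !big_seq; apply: ler_sum => n; rewrite -dvdn_divisors // => nN.
  have /andP[cm cn] : cop q (N %/ n) && cop q n by rewrite -cop_mul divnK.
  rewrite /F ler_wpM2l //; first by apply: mulr_ge0; [exact: pw_ge0 | exact: nu_ge0].
  apply: defect_anti; first exact: un0.
  by have := divisor_classes_mul cm cn; rewrite divnK.
apply: (le_trans H1).
have H2 : \sum_(N < X | cop q N) \sum_(n < X | (n %| N)%N) F (N %/ n)%N n <=
   \sum_(n < X | cop q n) \sum_(m < X | cop q m) F m n.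
  rewrite (exchange_big_dep (fun n : 'I_X => cop q n)) /=; last first.
    by move=> N n cN nN; rewrite /cop (coprime_dvdr nN).
  apply: ler_sum => n cn; have n0 := cop_gt0 q1 cn.
  apply: le_trans (sum_quotients_le X n0 (fun m cm => F0 m n cm)).
  rewrite le_eqVlt; apply/orP; left; apply/eqP; apply: eq_bigl => N; rewrite andbC.
  case: (boolP (n %| N)%N) => //= nN; by rewrite -{1}(divnK nN) cop_mul cn andbT.
apply: (le_trans H2).
rewrite exchange_big /= mulr_sumr; apply: ler_sum => m cm.
have m0 := cop_gt0 q1 cm.
rewrite (partition_big (fun n : 'I_X => cl q n) xpredT) //=.
apply: (@le_trans _ _ (\sum_(a : gT) pw (1 + d) m * B * defect (divisor_classes m :|: (a *: divisor_classes m)%g))).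
  apply: ler_sum => a _.
  rewrite (eq_bigr (fun n : 'I_X => pw (1 + d) m * nu d e n * defect (divisor_classes m :|: (a *: divisor_classes m)%g))).
    rewrite -mulr_suml -mulr_sumr; apply: ler_wpM2r.
      apply: defect_ge0; have := divisor_classes_neq0 m0; apply: contra => /eqP h.
      by rewrite -finset.subset0 -h finset.subsetUl.
    by apply: ler_wpM2l; [exact: pw_ge0 | exact: HB].
  by move=> n /andP[_ /eqP <-].
rewrite -mulr_sumr; have := @defect_avg R _ _ (divisor_classes_neq0 m0).
have B0 : 0 <= B.
  by apply: le_trans (HB 1%g); apply: sumr_ge0 => n _; exact: nu_ge0.
have c0 : 0 <= pw (1 + d) m * B by rewrite mulr_ge0 ?pw_ge0.
move=> /(ler_wpM2l c0) h; apply: (le_trans h); rewrite le_eqVlt; apply/orP; left; apply/eqP.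
by rewrite /=; ring.
Qed.
End DivisorClasses.

Section DefectDecay.
Context {R : realType}.
Variables (q : nat) (q1 : (1 < q)%N).
Local Notation gT := {unit 'Z_q}.
Local Notation phi := (#|{: {unit 'Z_q}}|%:R : R).
Implicit Types d e : R.

Lemma card_units_le : (#|{: {unit 'Z_q}}| <= q)%N.
Proof.
rewrite -[leqRHS](Zp_cast q1) -[leqRHS]card_ord.
exact: (@leq_card _ _ (val : gT -> 'Z_q) val_inj).
Qed.

Lemma zcop_dom d : dominated (1 + d) (fun n => if cop q n then pw (1 + d) n else 0).
Proof.
move=> n; case: ifP => [cn|_]; first by rewrite gtn_eqF ?(cop_gt0 q1) // pw_ge0 lexx.
by rewrite lexx /=; case: ifP => // _; exact: pw_ge0.
Qed.

Lemma zcop_class d : 0 < d -> zcop q d = \sum_(a : gT) zclass d a.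
Proof.
move=> d0; apply/cvg_lim => //.
have -> : series (fun n => if cop q n then pw (1 + d) n else 0) =
  (fun N => \sum_(a : gT) series (fun n => if inclass a n then pw (1 + d) n else 0) N).
  apply/funext => N; rewrite /series /= exchange_big /=; apply: eq_bigr => n _.
  case: ifP => cn; last by rewrite big1 // => a _; rewrite /inclass cn.
  rewrite (bigD1 (cl q n)) //= /inclass cn eqxx big1 ?addr0 // => a /negPf an.
  by rewrite eq_sym an.
apply: cvg_big => [|a _]; first exact: add_continuous.
have := dominated_is_cvg d0 (zclass_dom q1 d a); exact.
Qed.

Lemma zcop_ge1 d : 0 < d -> 1 <= zcop q d.
Proof. by move=> d0; have := @euler_ge1 R q q1 d [::] d0 isT isT; rewrite big_nil mul1r. Qed.

Lemma zcop_le d : 0 < d -> zcop q d <= 1 + d^-1.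
Proof.
move=> d0; apply: (tsum_le_bound d0 (zcop_dom d)) => n; exists n.+1; first exact: leqnSn.
apply: le_trans (sum_pw_le n d0); rewrite big_ltn // ifF ?add0r; last by apply/negP => /(cop_gt0 q1).
by apply: ler_sum => i _; case: ifP => // _; exact: pw_ge0.
Qed.

Lemma zcop_lower d : 0 < d -> d <= (2 * q%:R)^-1 -> phi / (2 * q%:R * d) <= zcop q d.
Proof.
move=> d0 dq; rewrite zcop_class // mulr_natl -sumr_const.
by apply: ler_sum => a _; exact: zclass_lower.
Qed.

Lemma zclass_le_zcop d : 0 < d -> phi * zclass d (1%g : gT) <= zcop q d + phi.
Proof.
move=> d0; rewrite zcop_class // mulr_natl -[X in _ + X]mulr1 mulr_natl -!sumr_const -big_split /=.
by apply: ler_sum => a _; exact: zclass_close.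
Qed.

Lemma weighted_defect_ge0 d X : 0 <= weighted_defect q d X.
Proof.
by apply: sumr_ge0 => n cn; rewrite mulr_ge0 ?pw_ge0 ?defect_ge0 ?divisor_classes_neq0 ?(cop_gt0 q1).
Qed.

(** By [weighted_defect_step] the factor is at most phi (z / Z + Z) Z / (2 Z'), and phi z <= Z' +
    phi. Since 10 phi Z^2 <= Z', this is at most (1 + 1/10 + 1/10) / 2 = 3/5. *)
Lemma weighted_defect_decay d e X : 0 < d -> d <= 1 -> 0 < e -> e <= d ^+ 2 / (80 * q%:R) ->
  weighted_defect q e X / zcop q e <= 3 / 5 * (weighted_defect q d X / zcop q d).
Proof.
move=> d0 d1 e0 ed.
have alg (u v w t : R) : u <= v -> w <= t + u -> 10 * v <= t -> (w + v) / 2 <= 3 / 5 * t.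
  by move=> *; lra.
have q0 : 0 < q%:R :> R by rewrite ltr0n ltnW.
have qge : 1 <= q%:R :> R by rewrite ler1n ltnW.
have f0 : 0 < phi by exact: card_group_gt0.
have d20 : 0 < d ^+ 2 by rewrite exprn_gt0.
have d2 : d ^+ 2 <= d by rewrite expr2 ger_pMl.
have ed' : e <= d.
  apply: (le_trans ed); rewrite ler_pdivrMr ?mulr_gt0 //; apply: (le_trans d2).
  by rewrite ler_peMr ?(ltW d0) //; nra.
have eq' : e <= (2 * q%:R)^-1.
  apply: (le_trans ed); rewrite -[leRHS]mul1r; apply: ler_pM; rewrite ?(ltW d20) ?invr_ge0 ?(le_trans d2) //; by rewrite lef_pV2 ?posrE ?mulr_gt0 //; nra.
set Z := zcop q d; set Z' := zcop q e.
have Z1 : 1 <= Z by exact: zcop_ge1.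
have Z1' : 1 <= Z' by exact: zcop_ge1.
have Z0 : 0 < Z by exact: lt_le_trans ltr01 Z1.
have Z0' : 0 < Z' by exact: lt_le_trans ltr01 Z1'.
have HZ : Z <= 2 / d.
  apply: (le_trans (zcop_le d0)); have : 1 <= d^-1 by rewrite invf_ge1.
  by rewrite -[2]/(1 + 1) mulrDl mul1r => h; rewrite lerD2r.
have HZ' : phi / (2 * q%:R * e) <= Z' by exact: zcop_lower.
set z := zclass e (1%g : gT).
have Hz : phi * z <= Z' + phi by exact: zclass_le_zcop.
have HB a : \sum_(n < X | inclass (a : gT) n) nu d e n <= z / Z + Z.
  rewrite big_mkcond /= -(big_mkord xpredT (fun n => if inclass a n then nu d e n else 0)).
  exact: nu_class_sum.
have := weighted_defect_step q1 ed' HB.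
have W0 := weighted_defect_ge0 d X.
set W := weighted_defect q d X in W0 *; set W' := weighted_defect q e X => H.
clearbody Z Z' z W W'.
(* This fixes the 80: Z <= 2 / d makes the left side at most 40 phi / d^2, and Z' >= phi / (2 q
   e). *)
have H10 : 10 * phi * Z ^+ 2 <= Z'.
  apply: le_trans HZ'; rewrite ler_pdivlMr ?mulr_gt0 //.
  have : Z ^+ 2 <= 4 / d ^+ 2.
    have -> : 4 / d ^+ 2 = (2 / d) ^+ 2 by rewrite expr_div_n; congr (_ / _); ring.
    by apply: lerXn2r => //; rewrite nnegrE ltW // divr_gt0.
  move=> hz; have h1 : Z ^+ 2 * (20 * q%:R * e) <= 1.
    apply: (@le_trans _ _ (4 / d ^+ 2 * (20 * q%:R * (d ^+ 2 / (80 * q%:R))))).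
      apply: ler_pM => //; first exact: sqr_ge0.
        by rewrite !mulr_ge0 // ltW.
      by rewrite ler_pM2l // mulr_gt0.
    rewrite le_eqVlt; apply/orP; left; apply/eqP; field.
    by rewrite !gt_eqF.
  have -> : 10 * phi * Z ^+ 2 * (2 * q%:R * e) = phi * (Z ^+ 2 * (20 * q%:R * e)) by ring.
  by rewrite -[leRHS]mulr1 ler_pM2l.
have K : phi * (z / Z + Z) / 2 <= 3 / 5 * (Z' / Z).
  rewrite mulrA !ler_pdivlMr // mulrAC mulrDr mulrDl.
  rewrite [phi * (z / Z) * Z](_ : _ = phi * z); last by field; rewrite gt_eqF.
  have : phi * Z * Z = phi * Z ^+ 2 by ring.
  have : phi <= phi * Z ^+ 2 by rewrite ler_peMr ?(ltW f0) // expr_ge1 // ltW.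
  move=> h1 h2; rewrite h2; apply: alg h1 Hz _; by rewrite mulrA.
rewrite ler_pdivrMr //; apply: (le_trans H).
apply: (le_trans (ler_wpM2r W0 K)); rewrite le_eqVlt; apply/orP; left; apply/eqP; field.
by rewrite gt_eqF.
Qed.

(** Closed form of the recursion [dseqS], started at 1 / (80 q). *)
Definition dseq j : R := ((80 * q%:R) ^+ (2 ^ j.+1).-1)^-1.

Lemma dseq_gt0 j : 0 < dseq j.
Proof. by rewrite invr_gt0 exprn_gt0 // mulr_gt0 // ltr0n ltnW. Qed.

Lemma q80_ge1 : 1 <= 80 * q%:R :> R.
Proof. by have : 1 <= q%:R :> R by [rewrite ler1n ltnW]; lra. Qed.

Lemma dseq_le1 j : dseq j <= 1.
Proof. by rewrite invf_le1 ?exprn_gt0 ?(lt_le_trans _ q80_ge1) // exprn_ege1 // q80_ge1. Qed.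

Lemma dseqS j : dseq j.+1 = dseq j ^+ 2 / (80 * q%:R).
Proof.
rewrite /dseq exprVn -exprM -invfM -exprSr; congr (_ ^+ _)^-1.
by rewrite [in LHS]expnS; have := expn_gt0 2 j.+1; lia.
Qed.

Lemma weighted_defect_dseq j X : weighted_defect q (dseq j) X <= (3 / 5) ^+ j * zcop q (dseq j).
Proof.
rewrite -ler_pdivrMr; last exact: lt_le_trans ltr01 (zcop_ge1 (dseq_gt0 j)).
elim: j => [|j IH].
  rewrite expr0 ler_pdivrMr; last exact: lt_le_trans ltr01 (zcop_ge1 (dseq_gt0 0)).
  rewrite mul1r; apply: le_trans (tsum_ge_partial X (dseq_gt0 0) (zcop_dom _)).
  rewrite big_mkord -big_mkcond /=; apply: ler_sum => n _.
  by rewrite ler_piMr ?pw_ge0 ?defect_le1.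
rewrite exprS; apply: le_trans (weighted_defect_decay X (dseq_gt0 j) (dseq_le1 j) (dseq_gt0 _) _) _.
  by rewrite dseqS.
by rewrite ler_pM2l.
Qed.
End DefectDecay.

Lemma abel_le (R : realType) (f w : nat -> R) (C : R) X :
  (forall i, (0 < i)%N -> w i.+1 <= w i) -> (forall i, 0 <= w i) -> 0 <= C ->
  (forall n, (n <= X)%N -> \sum_(1 <= i < n.+1) f i <= C) ->
  \sum_(1 <= i < X.+1) f i * w i <= C * w 1%N.
Proof.
move=> wd w0 C0 HS; case: X HS => [|X] HS; first by rewrite big_geq // mulr_ge0.
pose S n := \sum_(1 <= i < n.+1) f i.
suff H n : (n <= X)%N -> \sum_(1 <= i < n.+2) f i * w i - S n.+1 * w n.+1 <= C * (w 1%N - w n.+1).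
  have := H X (leqnn X); have := ler_wpM2r (w0 X.+1) (HS X.+1 (leqnn _)); rewrite -/(S X.+1) mulrBr; lra.
elim: n => [_|n IH nX]; first by rewrite /S !big_nat1 !subrr mulr0.
have := IH (ltnW nX).
have h : S n.+1 * (w n.+1 - w n.+2) <= C * (w n.+1 - w n.+2).
  by apply: ler_wpM2r; [rewrite subr_ge0 wd | apply: HS; rewrite ltnS ltnW].
have SE : S n.+2 = S n.+1 + f n.+2 by rewrite /S big_nat_recr.
have AE : \sum_(1 <= i < n.+3) f i * w i = \sum_(1 <= i < n.+2) f i * w i + f n.+2 * w n.+2 by rewrite big_nat_recr.
rewrite SE AE; set A := \sum_(1 <= i < n.+2) f i * w i => h2.
have -> : A + f n.+2 * w n.+2 - (S n.+1 + f n.+2) * w n.+2 = (A - S n.+1 * w n.+1) + S n.+1 * (w n.+1 - w n.+2) by ring.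
have -> : C * (w 1%N - w n.+2) = C * (w 1%N - w n.+1) + C * (w n.+1 - w n.+2) by ring.
exact: lerD.
Qed.

(** * From weighted defects to the density of products *)

Section ProductDensity.
Context {R : realType}.
Variables (q : nat) (q1 : (1 < q)%N).
Local Notation gT := {unit 'Z_q}.
Implicit Types d : R.

Lemma defective_sum d X : \sum_(n < X | cop q n && (divisor_classes q n != finset.setT)) pw (1 + d) n <=
  q%:R ^+ 2 * weighted_defect q d X.
Proof.
rewrite /weighted_defect mulr_sumr [leRHS](bigID (fun n : 'I_X => divisor_classes q n != finset.setT)) /=.
apply: ler_wpDr.
  apply: sumr_ge0 => n /andP[cn _].
  by rewrite mulr_ge0 ?mulr_ge0 ?pw_ge0 ?sqr_ge0 ?defect_ge0 ?divisor_classes_neq0 ?(cop_gt0 q1).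
apply: ler_sum => n /andP[cn dn]; rewrite mulrCA ler_peMr ?pw_ge0 //.
have d0 := divisor_classes_neq0 q (cop_gt0 q1 cn).
have q0 : 0 < q%:R ^+ 2 :> R by rewrite exprn_gt0 // ltr0n ltnW.
have := @defect_missing R _ _ d0 dn; set f := #|_| => h.
have f0 : 0 < f%:R :> R by exact: card_group_gt0.
have fq : (q%:R ^+ 2)^-1 <= (f%:R ^+ 2)^-1 :> R.
  have qq : 0 < q%:R :> R by rewrite ltr0n ltnW.
  rewrite lef_pV2 ?posrE ?exprn_gt0 //; apply: lerXn2r; rewrite ?nnegrE ?(ltW f0) //.
  by rewrite ler_nat card_units_le.
by rewrite mulrC -ler_pdivrMr // mul1r (le_trans fq).
Qed.

Lemma zclass_tail d (a : gT) X : 0 < d -> (0 < X)%N ->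
  zclass d a <= \sum_(n < X.+1 | inclass a n) pw (1 + d) n + d^-1 * pw d X.
Proof.
move=> d0 X0; apply: (tsum_le_bound d0 (zclass_dom q1 d a)) => L; exists (X.+1 + L)%N; first by rewrite leq_addl.
rewrite (@big_cat_nat _ _ _ X.+1) ?leq_addr //=; apply: lerD.
  by rewrite [leRHS]big_mkcond /= big_mkord.
apply: le_trans (sum_pw_tail (X.+1 + L) d0 X0); apply: ler_sum => n _.
by case: ifP => // _; exact: pw_ge0.
Qed.
Lemma dseqV j : (dseq q j : R)^-1 = ((80 * q) ^ (2 ^ j.+1).-1)%:R.
Proof. by rewrite /dseq invrK natrX natrM. Qed.

(** This is (8 q)^(1 / d) for d = [dseq q j]: the tail bound X^-d / d is there exactly 1 / (8 q d),
    a quarter of the lower bound in [zclass_lower]. *)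
Definition horizon j := ((8 * q) ^ ((80 * q) ^ (2 ^ j.+1).-1))%N.

Lemma pw_dseq j : pw (dseq q j) (horizon j) = (8 * q%:R)^-1 :> R.
Proof.
have q0 : 0 < 8 * q%:R :> R by rewrite mulr_gt0 // ltr0n ltnW.
rewrite /pw /horizon natrX lnXn natrM // -[ln _ *+ _]mulr_natl -dseqV mulrA mulNr mulfV ?gt_eqF ?dseq_gt0 //.
by rewrite mulN1r expRN lnK.
Qed.

(** The class has weight at least 1 / (2 q d); the tail beyond the horizon and the integers lacking
    some divisor class cost at most 1 / (8 q d) each. *)
Lemma productive_sum j (a : gT) l : (q <= 2 ^ l)%N -> (6 * l + 8 <= j)%N ->
  (4 * q%:R * dseq q j)^-1 <= (
  \sum_(n < (horizon j).+1 | inclass a n && (divisor_classes q n == finset.setT)) pw (1 + dseq q j) n : R).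
Proof.
move=> ql lj; set d := dseq q j; set X := horizon j.
have d0 : 0 < d by exact: dseq_gt0.
have qg : 0 < q%:R :> R by rewrite ltr0n ltnW.
have X0 : (0 < X)%N by rewrite expn_gt0 muln_gt0 /= ltnW.
have dq : d <= (2 * q%:R)^-1.
  rewrite /d /dseq lef_pV2 ?posrE ?exprn_gt0 ?mulr_gt0 //.
  apply: (@le_trans _ _ (80 * q%:R)); first by lra.
  by apply: ler_eXnr; [have := expn_gt0 2 j; rewrite expnS; lia | exact: q80_ge1].
have H1 := zclass_lower q1 a d0 dq.
have H2 := zclass_tail a d0 X0.
rewrite pw_dseq in H2.
have H3 := defective_sum d X.+1.
have H4 : q%:R ^+ 2 * weighted_defect q d X.+1 <= (8 * q%:R * d)^-1.
  have h := @weighted_defect_dseq R q q1 j X.+1.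
  have hz : zcop q d <= 2 / d.
    apply: (le_trans (zcop_le q1 d0)); have : 1 <= d^-1 by rewrite invf_ge1 // dseq_le1.
    by rewrite -[2]/(1 + 1) mulrDl mul1r => k; rewrite lerD2r.
  (* So many steps suffice because (3/5)^2 <= 1/2 and 2^(3 l + 4) >= 16 q^3. *)
  have h35 : (3 / 5 : R) ^+ j <= (16 * q%:R ^+ 3)^-1.
    apply: (@le_trans _ _ ((3 / 5) ^+ (6 * l + 8))); first by apply: ler_wiXn2l; rewrite ?divr_ge0 // ler_pdivrMr // mul1r ler_nat.
    rewrite (_ : 6 * l + 8 = 2 * (3 * l + 4))%N; last by lia.
    rewrite exprM; apply: (@le_trans _ _ (2^-1 ^+ (3 * l + 4))).
      by apply: lerXn2r; rewrite ?nnegrE ?sqr_ge0 //; lra.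
    rewrite exprVn lef_pV2 ?posrE ?exprn_gt0 ?mulr_gt0 ?exprn_gt0 //.
    have -> : 2 ^+ (3 * l + 4) = 16 * (2 ^+ l) ^+ 3 :> R by rewrite exprD mulnC exprM mulrC; congr (_ * _); ring.
    rewrite ler_pM2l //; apply: lerXn2r; rewrite ?nnegrE ?exprn_ge0 // ?(ltW qg) //.
    by rewrite -natrX ler_nat.
  apply: (@le_trans _ _ (q%:R ^+ 2 * ((16 * q%:R ^+ 3)^-1 * (2 / d)))).
    rewrite ler_pM2l ?exprn_gt0 //; apply: (le_trans h); apply: ler_pM => //.
    by exact: le_trans ler01 (zcop_ge1 q1 d0).
  rewrite le_eqVlt; apply/orP; left; apply/eqP; field.
  by rewrite !gt_eqF.
set A := \sum_(n < X.+1 | _) _.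
have H5 : \sum_(n < X.+1 | inclass a n) pw (1 + d) n <=
  A + \sum_(n < X.+1 | cop q n && (divisor_classes q n != finset.setT)) pw (1 + d) n.
  rewrite (bigID (fun n : 'I_X.+1 => divisor_classes q n == finset.setT)) /= lerD2l.
  rewrite [leLHS]big_mkcond [leRHS]big_mkcond /=; apply: ler_sum => n _.
  by rewrite /inclass; case: (cop q n); case: (cl q n == a); case: (divisor_classes q n == finset.setT); rewrite /= ?pw_ge0.
suff : (2 * q%:R * d)^-1 <= A + (8 * q%:R * d)^-1 + d^-1 * (8 * q%:R)^-1.
  have -> : (2 * q%:R * d)^-1 = 4 * (8 * q%:R * d)^-1 by field; rewrite !gt_eqF.
  have -> : (4 * q%:R * d)^-1 = 2 * (8 * q%:R * d)^-1 by field; rewrite !gt_eqF.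
  have -> : d^-1 * (8 * q%:R)^-1 = (8 * q%:R * d)^-1 by field; rewrite !gt_eqF.
  lra.
apply: (le_trans H1); apply: (le_trans H2); rewrite lerD2r; apply: (le_trans H5); rewrite lerD2l.
exact: le_trans H3 H4.
Qed.
(** One exponential comes from raising 8 q to the power 1 / d, the other two from squaring d in each
    of O(log q) steps. *)
Lemma horizon_le l : (q <= 2 ^ l)%N -> (horizon (6 * l + 8) <= 2 ^ 2 ^ 2 ^ (7 * l + 12))%N.
Proof.
move=> ql; rewrite /horizon.
have q8 : (8 * q <= 2 ^ (l + 3))%N by rewrite expnD mulnC leq_mul.
have q80 : (80 * q <= 2 ^ (l + 7))%N by rewrite expnD mulnC leq_mul.
have lt2 n : (n < 2 ^ n)%N by exact: ltn_expl.
have l3 : (l + 3 <= 2 ^ (l + 2))%N by have := lt2 (l + 2)%N; lia.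
have l8 : (l + 8 <= 2 ^ (l + 3))%N.
  by elim: (l) => // m IH; rewrite !addSn expnS; lia.
set E := (2 ^ (6 * l + 8).+1).-1.
have HE : ((l + 2) + (l + 7) * E <= 2 ^ (7 * l + 12))%N.
  apply: (@leq_trans ((l + 8) * 2 ^ (6 * l + 9))); last first.
    rewrite (_ : 7 * l + 12 = (l + 3) + (6 * l + 9))%N; last by lia.
    by rewrite [leqRHS]expnD leq_mul2r l8 orbT.
  rewrite (_ : (6 * l + 9)%N = (6 * l + 8).+1) /E; last by lia.
  have := lt2 (6 * l + 8).+1; set t := (2 ^ _)%N => ht.
  by rewrite (_ : (l + 8)%N = (l + 7).+1) ?mulSn ?leq_add ?leq_mul ?leq_pred //; lia.
apply: (@leq_trans ((2 ^ (l + 3)) ^ ((2 ^ (l + 7)) ^ E))).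
  apply: (@leq_trans ((2 ^ (l + 3)) ^ ((80 * q) ^ E))); first by rewrite leq_exp2r ?expn_gt0 ?muln_gt0 ?(ltnW q1).
  by rewrite leq_pexp2l ?expn_gt0 // leq_exp2r // /E -subn1 subn_gt0; have := lt2 (6 * l + 8).+1; lia.
rewrite -!expnM leq_exp2l // ; apply: (@leq_trans (2 ^ ((l + 2) + (l + 7) * E))).
  by rewrite [leqRHS]expnD leq_mul2r l3 orbT.
by rewrite leq_exp2l.
Qed.

(** If all scales from [Z1] to the horizon had density at most 1 / (32 q), Abel summation would
    bound the weighted sum by [Z1] plus zeta(1 + d) / (32 q), contrary to [productive_sum]. This is
    why the scale is not explicit. *)
Lemma product_density l P Z1 : (q <= 2 ^ l)%N -> (Z1 <= 2 ^ l)%N -> coprime q P ->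
  exists2 Z, (Z1 <= Z <= 2 ^ 2 ^ 2 ^ (7 * l + 12))%N &
  exists s : seq nat, [/\ uniq s, (Z < 32 * q * size s)%N & forall N, N \in s ->
    (N <= Z)%N /\ exists x y : nat, [/\ N = (x * y)%N, (0 < x)%N, (0 < y)%N, x = P %[mod q] & y = P %[mod q]]].
Proof.
move=> ql Zl cP; set J := (6 * l + 8)%N; set X := horizon J.
pose a : gT := (cl q P * cl q P)%g.
pose A n := inclass a n && (divisor_classes q n == finset.setT).
pose s Z := [seq n <- iota 1 Z | A n].
suff [Z [h1 h2 h3]] : exists Z, [/\ (Z1 <= Z)%N, (Z <= X)%N & (Z < 32 * q * size (s Z))%N].
  exists Z; first by rewrite h1 (leq_trans h2) // horizon_le.
  exists (s Z); split => //; first exact/filter_uniq/iota_uniq.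
  move=> N; rewrite mem_filter mem_iota add1n ltnS => /andP[/andP[/andP[cN /eqP aN] /eqP DN] /andP[N0 NZ]].
  split => //; have /divisor_classesP : cl q P \in divisor_classes q N by rewrite DN finset.inE.
  move=> /(_ N0)[t tN tP]; have cc : cop q (N %/ t) && cop q t by rewrite -cop_mul divnK.
  have [cw ct] := andP cc.
  exists (N %/ t)%N, t; rewrite divnK // (cop_gt0 q1 cw) (cop_gt0 q1 ct); split => //; apply/eqP.
    rewrite -cl_eqE //; apply/eqP; apply: (mulIg (cl q t)).
    by rewrite -cl_mul // divnK // tP aN.
  by rewrite -cl_eqE // tP.
apply: contrapT => HN.
have HZ Z : (Z1 <= Z)%N -> (Z <= X)%N -> (32 * q * size (s Z) <= Z)%N.
  by move=> h1 h2; rewrite leqNgt; apply/negP => h3; apply: HN; exists Z.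
set d : R := dseq q J.
have d0 : 0 < d by exact: dseq_gt0.
have qg : 0 < q%:R :> R by rewrite ltr0n ltnW.
have H1 := @productive_sum J a l ql (leqnn _).
rewrite -/d -/X in H1.
have sE n : \sum_(1 <= i < n.+1) (A i)%:R = (size (s n))%:R :> R.
  rewrite /s size_filter -sum1_count natr_sum [RHS]big_mkcond /= /index_iota subn1 /=.
  by apply: eq_bigr => i _; case: (A i).
have H2 : \sum_(1 <= i < X.+1) ((A i)%:R - (32 * q%:R)^-1) * pw (1 + d) i <= Z1%:R * pw (1 + d) 1.
  apply: abel_le => // [i i0|i|n nX].
  - by apply: pw_anti => //; rewrite addr_ge0 // ltW.
  - exact: pw_ge0.
  rewrite sumrB sE sumr_const_nat subn1 /= lerBlDr -[_ *+ n]mulr_natl.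
  have q32 : 0 < 32 * q%:R :> R by rewrite mulr_gt0.
  case: (leqP Z1 n) => [zn|nz].
    have := HZ n zn nX; rewrite -(ler_nat R) !natrM => h.
    by apply: ler_wpDl => //; rewrite ler_pdivlMr // mulrC.
  apply: ler_wpDr; first by rewrite mulr_ge0 // invr_ge0 ltW.
  rewrite ler_nat (leq_trans _ (ltnW nz)) // /s size_filter.
  by apply: leq_trans (count_size _ _) _; rewrite size_iota.
have H3 : \sum_(n < X.+1 | A n) pw (1 + d) n = \sum_(1 <= i < X.+1) (A i)%:R * pw (1 + d) i.
  rewrite big_mkcond /= -(big_mkord xpredT (fun n => if A n then pw (1 + d) n else 0)) big_ltn //.
  rewrite ifF ?add0r; last by apply/negP => /andP[/(inclass_gt0 q1)].
  by apply: eq_bigr => i _; case: (A i); rewrite ?mul1r ?mul0r.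
have H4 := sum_pw_le X d0.
have d1 : 1 <= d^-1 by rewrite invf_ge1 // dseq_le1.
have H5 : Z1%:R <= d^-1 / (8 * q%:R).
  rewrite ler_pdivlMr ?mulr_gt0 // /d dseqV -!natrM ler_nat.
  have lt2 n : (n < 2 ^ n)%N by exact: ltn_expl.
  apply: (@leq_trans (2 ^ (2 * l + 3))).
    rewrite (_ : 2 * l + 3 = l + (3 + l))%N; last by lia.
    by rewrite expnD [(2 ^ (3 + l))%N]expnD !leq_mul.
  apply: (@leq_trans (2 ^ (2 ^ J.+1).-1)).
    by rewrite leq_exp2l //; have := lt2 J.+1; rewrite /J; lia.
  by rewrite leq_exp2r ?(leq_trans _ (leq_pmulr _ _)) ?(ltnW q1) // -subn1 subn_gt0; have := lt2 J.+1; lia.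
move: H2; under eq_bigr do rewrite mulrBl; rewrite sumrB -mulr_sumr -H3 pw1 mulr1 => H2.
have H6 := le_trans H1 (_ : _ <= \sum_(n < X.+1 | A n) pw (1 + d) n).
have {}H6 := H6 (lexx _).
have H7 : (32 * q%:R)^-1 * \sum_(1 <= i < X.+1) pw (1 + d) i <= (32 * q%:R)^-1 * (2 * d^-1).
  rewrite ler_pM2l ?invr_gt0 ?mulr_gt0 //; apply: (le_trans H4); rewrite -[2]/(1 + 1) mulrDl mul1r lerD2r //.
(* In units of 1 / (32 q d), the productive sum is at least 8, while the assumed densities allow 2,
   plus 4 for [Z1]. *)
have e1 : (4 * q%:R * d)^-1 = 8 * (32 * q%:R * d)^-1 by field; rewrite !gt_eqF.
have e2 : (32 * q%:R)^-1 * (2 * d^-1) = 2 * (32 * q%:R * d)^-1 by field; rewrite !gt_eqF.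
have e3 : d^-1 / (8 * q%:R) = 4 * (32 * q%:R * d)^-1 by field; rewrite !gt_eqF.
have e4 : 0 < (32 * q%:R * d)^-1 by rewrite invr_gt0 !mulr_gt0.
rewrite e1 in H6; rewrite e2 in H7; rewrite e3 in H5.
move: e4 H2 H5 H6 H7; move: (32 * q%:R * d)^-1 (\sum_(n < X.+1 | A n) _) (_ * \sum_(1 <= i < X.+1) _) (Z1%:R : R) => t u v w.
clear; lra.
Qed.
End ProductDensity.

(** * Sparse traces force rational entries *)

(** Instead of the iterated logarithm, any [m] that bounds it in base 2 is allowed; counting
    arguments then involve powers of 2 only. *)
Definition sparse (R : realType) (T : set R) := forall e : R, 0 < e -> exists n0, forall n m (s : seq R),
  (n0 <= n)%N -> (n <= 2 ^ 2 ^ 2 ^ m)%N -> uniq s -> (forall t, t \in s -> T t /\ `|t| <= n%:R) ->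
  (size s)%:R <= e * (n%:R * m%:R).

Lemma ln_le_expn (R : realType) n m : (0 < n)%N -> (n <= 2 ^ m)%N -> ln (n%:R : R) <= m%:R.
Proof.
move=> n0 nm; have h2 : ln (2 : R) <= 1.
  have h : (-1 : R) < 1 by lra.
  exact: (le_ln1Dx h).
apply: (@le_trans _ _ (ln ((2 ^ m)%:R : R))).
  by rewrite ler_ln ?posrE ?ltr0n ?expn_gt0 // ler_nat.
by rewrite natrX lnXn // -[ln _ *+ _]mulr_natr ler_piMl.
Qed.

(** Beyond the threshold ln (ln n) exceeds 1, so the third logarithm is positive; ln 2 <= 1 compares
    with base 2. *)
Lemma lll_le (R : realType) n m : expR (expR (1 : R)) < n%:R -> (n <= 2 ^ 2 ^ 2 ^ m)%N -> 0 < lll R n <= m%:R.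
Proof.
move=> en nm.
have e1 : (1 : R) < expR 1 by apply: lt_le_trans (expR_ge1Dx _); lra.
have e2 : expR 1 < expR (expR 1) :> R by rewrite ltr_expR.
have en' : expR 1 < n%:R :> R by apply: lt_trans en.
have nr : 0 < n%:R :> R by apply: lt_trans en'; rewrite expR_gt0.
have n0 : (0 < n)%N by rewrite -(ltr0n R).
rewrite /lll en'.
have l1 : expR 1 < ln n%:R :> R by rewrite -[ltLHS]expRK ltr_ln // posrE expR_gt0.
have l1p : 0 < ln (n%:R : R) by apply: lt_trans l1; rewrite expR_gt0.
have l2 : 1 < ln (ln n%:R) :> R by rewrite -[ltLHS]expRK ltr_ln // posrE expR_gt0.
have l2p : 0 < ln (ln (n%:R : R)) by apply: lt_trans l2.
rewrite ln_gt0 //=.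
have u1 := ln_le_expn R n0 nm.
have u2 : ln (ln n%:R) <= (2 ^ m)%:R :> R.
  apply: le_trans (ln_le_expn R _ (leqnn (2 ^ 2 ^ m)%N)); last by rewrite expn_gt0.
  by rewrite ler_ln // posrE ltr0n expn_gt0.
apply: le_trans (ln_le_expn R _ (leqnn (2 ^ m)%N)); last by rewrite expn_gt0.
by rewrite ler_ln // posrE ltr0n expn_gt0.
Qed.

Lemma trace_sparse (R : realType) (T : set R) (c : nat -> nat) :
  (forall n : nat, exists s : seq R, [/\ uniq s, size s = c n & forall t, t \in s <-> (T t /\ `|t| <= n%:R)]) ->
  (fun n : nat => (c n)%:R / (n%:R * lll R n)) @ \oo --> (0 : R) -> sparse T.
Proof.
move=> HT /cvgrPdist_lt Hc e e0; have [N _ HN] := Hc e e0.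
exists (N + (Num.truncn (expR (expR (1 : R)))).+1)%N => n m s hn hm us Hs.
have en : expR (expR (1 : R)) < n%:R.
  by apply: lt_le_trans (truncnS_gt _) _; rewrite ler_nat (leq_trans (leq_addl _ _) hn).
have /andP[h2 h3] := lll_le en hm; have n0 : 0 < n%:R :> R by apply: lt_trans en; rewrite expR_gt0.
have := HN n (leq_trans (leq_addr _ _) hn); rewrite /= sub0r normrN => h1.
have [s' [us' Es' Hs']] := HT n.
have ss : (size s <= c n)%N by rewrite -Es'; apply: uniq_leq_size => // t /Hs/Hs'.
apply: (@le_trans _ _ (c n)%:R); first by rewrite ler_nat.
have p0 : 0 < n%:R * lll R n by rewrite mulr_gt0.
rewrite ger0_norm in h1; last by rewrite divr_ge0 // ltW.
apply: (@le_trans _ _ (e * (n%:R * lll R n))); first by rewrite -ler_pdivrMr // ltW.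
by rewrite !ler_pM2l.
Qed.

(** Each dyadic rectangle contains 2^K pairs with product below 4 * 2^K. The k disjoint rectangles
    supply the logarithmic factor in X log X. *)
Lemma dyadic_pairs K k : (k <= K)%N -> exists s : seq (nat * nat), [/\ uniq s, size s = (k * 2 ^ K)%N &
  forall p, p \in s -> exists2 i, (i < k)%N & (2 ^ i <= p.1 < 2 ^ i.+1)%N && (2 ^ (K - i) <= p.2 < 2 ^ (K - i).+1)%N].
Proof.
elim: k => [_|k IH kK]; first by exists [::].
have [s [us ss Hs]] := IH (ltnW kK).
pose t := [seq (x, y) | x <- iota (2 ^ k) (2 ^ k), y <- iota (2 ^ (K - k)) (2 ^ (K - k))].
have tP p : p \in t -> (2 ^ k <= p.1 < 2 ^ k.+1)%N && (2 ^ (K - k) <= p.2 < 2 ^ (K - k).+1)%N.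
  case/allpairsP => -[x y] [/=]; rewrite !mem_iota => hx hy ->.
  by rewrite /= !expnS !mul2n -!addnn hx hy.
exists (s ++ t); split.
- rewrite cat_uniq us /= allpairs_uniq ?iota_uniq ?andbT //; last by move=> [x y] [x' y'] _ _ /=.
  apply/hasPn => p /tP/andP[/andP[h1 _] _]; apply/negP => /Hs[i ik /andP[/andP[_ h2] _]].
  by have := leq_trans (leq_ltn_trans h1 h2) (leq_pexp2l (isT : (0 < 2)%N) ik); rewrite ltnn.
- by rewrite size_cat ss size_allpairs !size_iota -expnD subnKC ?(ltnW kK) // mulSn addnC.
- move=> p; rewrite mem_cat => /orP[/Hs[i ik h]|/tP h]; first by exists i => //; exact: ltnW.
  by exists k.
Qed.

Lemma sparse_no_bilinear (R : realType) (T : set R) (f : nat * nat -> R) (C b : nat) : sparse T ->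
  (forall p, (0 < p.1)%N -> (p.1 + b <= p.2)%N -> T (f p) /\ `|f p| <= (C * p.1 * p.2)%:R) ->
  (forall p p', (0 < p.1)%N -> (p.1 + b <= p.2)%N -> (0 < p'.1)%N -> (p'.1 + b <= p'.2)%N -> f p = f p' -> p = p') ->
  False.
Proof.
move=> sT Hf finj; pose D := C.+1.
have D0 : 0 < (4 * D)%:R :> R by rewrite ltr0n.
have e0 : 0 < ((4 * D)%:R)^-1 :> R by rewrite invr_gt0.
have [n0 Hn0] := sT _ e0.
have lt2 x : (x < 2 ^ x)%N by exact: ltn_expl.
(* There are k 2^K values up to n = 4 D 2^K, whereas sparsity allows m 2^K; hence k = m + 1. The
   choice of K makes the second coordinate exceed the first by at least b, and m is large enough for
   n <= 2^2^2^m. *)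
pose m := (n0 + D + b + 8)%N; pose k := m.+1; pose K := (2 * k + b)%N.
have kK : (k <= K)%N by rewrite /K; lia.
have [s [us ss Hs]] := dyadic_pairs kK.
have Hp p : p \in s -> [/\ (0 < p.1)%N, (p.1 + b <= p.2)%N & (p.1 * p.2 <= 4 * 2 ^ K)%N].
  move=> /Hs[i ik /andP[/andP[h1 h2] /andP[h3 h4]]]; split.
  - by apply: leq_trans h1; rewrite expn_gt0.
  - apply: leq_trans h3; apply: (@leq_trans (2 ^ i.+1 + b)); first by rewrite leq_add2r ltnW.
    apply: (@leq_trans (2 ^ (k + b.+1))); last by rewrite leq_exp2l // /K; lia.
    apply: (@leq_trans (2 ^ k + 2 ^ b)); first by rewrite leq_add ?leq_exp2l // ltnW.
    by have := expn_gt0 2 k; have := expn_gt0 2 b; rewrite expnD expnS; nia.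
  - apply: leq_trans (leq_mul (ltnW h2) (ltnW h4)) _.
    rewrite -expnD (_ : (i.+1 + (K - i).+1 = 2 + K)%N) ?expnD //; by rewrite /K; lia.
pose n := (4 * D * 2 ^ K)%N.
have h1 : (n0 <= n)%N.
  by have := lt2 K; rewrite /n /K /k /m; nia.
have h2 : (n <= 2 ^ 2 ^ 2 ^ m)%N.
  apply: (@leq_trans (2 ^ (2 + D + K))).
    by rewrite /n !expnD leq_mul2r leq_mul2l ltnW ?orbT.
  rewrite leq_exp2l //; apply: (@leq_trans (2 ^ m)); last by rewrite leq_exp2l // ltnW.
  have m8 : (8 <= m)%N by rewrite /m; lia.
  apply: (@leq_trans (5 * m)); first by rewrite /K /k /m; lia.
  rewrite -(subnKC m8); elim: (m - 8)%N => // u; rewrite addnS expnS; lia.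
have := Hn0 n m [seq f p | p <- s] h1 h2.
rewrite size_map ss => H.
have /H{}H : uniq [seq f p | p <- s].
  rewrite map_inj_in_uniq // => p p' /Hp[u1 u2 _] /Hp[v1 v2 _]; exact: finj.
have {}H : (k * 2 ^ K)%:R <= (4 * D)%:R^-1 * (n%:R * m%:R) :> R.
  apply: H => _ /mapP[p /Hp[u1 u2 u3] ->]; have [v1 v2] := Hf p u1 u2; split => //.
  apply: (le_trans v2); rewrite ler_nat -mulnA /n.
  by rewrite (mulnC 4 D) -(mulnA D) leq_mul.
move: H; rewrite ler_pdivlMl // -!natrM ler_nat /n.
have := expn_gt0 2 K; rewrite /= /k; set t := (2 ^ K)%N => t0; nia.
Qed.

(** * Rationality of ratios and products of entries *)

Section RationalEntries.
Context {R : realType}.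
Implicit Types (x y : R) (G : set 'M[R]_2).

Definition israt x := exists q : rat, x = ratr q.

Lemma isratD x y : israt x -> israt y -> israt (x + y).
Proof. by move=> [p ->] [q ->]; exists (p + q); rewrite rmorphD. Qed.
Lemma isratN x : israt x -> israt (- x).
Proof. by move=> [p ->]; exists (- p); rewrite rmorphN. Qed.
Lemma isratB x y : israt x -> israt y -> israt (x - y).
Proof. by move=> hx hy; apply: isratD => //; exact: isratN. Qed.
Lemma isratM x y : israt x -> israt y -> israt (x * y).
Proof. by move=> [p ->] [q ->]; exists (p * q); rewrite rmorphM. Qed.
Lemma isratV x : israt x -> israt x^-1.
Proof. by move=> [p ->]; exists p^-1; rewrite fmorphV. Qed.
Lemma israt_nat n : israt n%:R.
Proof. by exists n%:R; rewrite ratr_nat. Qed.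
Lemma israt_int (n : int) : israt n%:~R.
Proof. by exists n%:~R; rewrite ratr_int. Qed.
Lemma israt0 : israt 0. Proof. exact: (israt_nat 0). Qed.
Lemma israt1 : israt 1. Proof. exact: (israt_nat 1). Qed.

Lemma irrational_free x p q : ~ israt x -> israt p -> israt q -> p + x * q = 0 -> p = 0 /\ q = 0.
Proof.
move=> nx rp rq E; have q0 : q = 0.
  apply: contrapT => /eqP q0; apply: nx.
  have -> : x = - p / q by apply/eqP; rewrite -subr_eq0; apply/eqP; have -> : x - - p / q = (p + x * q) / q by [field]; rewrite E mul0r.
  by apply: isratM; [exact: isratN | exact: isratV].
by move: E; rewrite q0 mulr0 addr0.
Qed.

Lemma bilinear_bound (A B C E : R) : exists K : nat, forall n m : nat, (0 < n)%N -> (0 < m)%N ->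
  `|A * n%:R * m%:R + B * n%:R + C * m%:R + E| <= (K * n * m)%:R.
Proof.
exists (Num.truncn (`|A| + `|B| + `|C| + `|E|)).+1 => n m n0 m0.
have n1 : 1 <= n%:R :> R by rewrite ler1n.
have m1 : 1 <= m%:R :> R by rewrite ler1n.
have nm : 1 <= n%:R * m%:R :> R by rewrite -natrM ler1n muln_gt0 n0.
have nn : n%:R <= n%:R * m%:R :> R by rewrite ler_peMr // (le_trans ler01).
have mm : m%:R <= n%:R * m%:R :> R by rewrite ler_peMl // (le_trans ler01).
have n0' : 0 <= n%:R :> R by []. have m0' : 0 <= m%:R :> R by [].
apply: (@le_trans _ _ ((`|A| + `|B| + `|C| + `|E|) * (n%:R * m%:R))).
  rewrite !mulrDl; apply: le_trans (ler_normD _ _) _; apply: lerD; last first.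
    by rewrite ler_peMr.
  apply: le_trans (ler_normD _ _) _; apply: lerD; last by rewrite normrM (ger0_norm m0') ler_wpM2l.
  apply: le_trans (ler_normD _ _) _; apply: lerD; last by rewrite normrM (ger0_norm n0') ler_wpM2l.
  by rewrite !normrM (ger0_norm n0') (ger0_norm m0') mulrA.
rewrite -mulnA natrM natrM ler_wpM2r ?mulr_ge0 // ltW // truncnS_gt //.
Qed.

(** If x = C / A were irrational, an equality of two values would split into its rational part and
    its coefficient of x. For B = C these determine n + m and n m; for rational (B + C) / A they
    determine m - n and then n, because m - n exceeds |(B + C) / A|. So the values would be distinct
    for m >= n + b. *)
Lemma bilinear_sparse (T : set R) A B C E : sparse T -> A != 0 ->
  (forall n m, T (A * n%:R * m%:R + B * n%:R + C * m%:R + E)) ->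
  B = C \/ israt ((B + C) / A) -> israt (C / A).
Proof.
move=> sT A0 HT BC; apply: contrapT => nx; set x := C / A in BC nx.
have [K HK] := bilinear_bound A B C E.
pose b := (Num.truncn `|(B + C) / A|).+1.
apply: (sparse_no_bilinear (T := T) (C := K) (b := b) (f := fun p => A * p.1%:R * p.2%:R + B * p.1%:R + C * p.2%:R + E) sT).
  move=> [n m] /= n0 nm; split; first exact: HT.
  by apply: HK => //; apply: leq_trans nm; rewrite addnS.
move=> [n m] [n' m'] /= n0 nm n0' nm' EQ.
have rD (i j : nat) : israt (i%:R - j%:R) by apply: isratB; exact: israt_nat.
have eB : B = (B + C) - A * x by rewrite /x mulrC divfK // addrK.
have eC : C = A * x by rewrite /x mulrC divfK.
have E0 : n%:R * m%:R - n'%:R * m'%:R + B / A * (n%:R - n'%:R) + x * (m%:R - m'%:R) = 0.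
  apply: (mulfI A0); rewrite mulr0 /x.
  have -> : A * (n%:R * m%:R - n'%:R * m'%:R + B / A * (n%:R - n'%:R) + C / A * (m%:R - m'%:R)) =
    (A * n%:R * m%:R + B * n%:R + C * m%:R + E) - (A * n'%:R * m'%:R + B * n'%:R + C * m'%:R + E) by field.
  by rewrite EQ subrr.
have bn (r : R) k : `|r| < b%:R -> (b <= k)%N -> 0 < r + k%:R.
  rewrite ltr_norml -(ler_nat R) => /andP[h _] h2; lra.
case: BC => [eq|rr].
  have : (n%:R * m%:R - n'%:R * m'%:R) + x * ((n%:R - n'%:R) + (m%:R - m'%:R)) = 0 by rewrite -E0 eq -/x; ring.
  move=> /(irrational_free nx)[]; [by rewrite -!natrM | exact: isratD | move=> h1 h2].
  have h3 : (n + m = n' + m')%N by apply/eqP; rewrite -(eqr_nat R) !natrD -subr_eq0; apply/eqP; rewrite -h2; ring.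
  have h4 : (n * m = n' * m')%N by apply/eqP; rewrite -(eqr_nat R) !natrM -subr_eq0; apply/eqP.
  have : n = n' by move: h3 h4 nm nm'; rewrite /b; clear; nia.
  by move=> e; congr (_, _) => //; lia.
pose r := (B + C) / A; have rb : `|r| < b%:R by exact: truncnS_gt.
have BA : B / A = r - x by rewrite /r /x; field.
have : (n%:R * m%:R - n'%:R * m'%:R + r * (n%:R - n'%:R)) + x * ((m%:R - m'%:R) - (n%:R - n'%:R)) = 0 by rewrite -E0 BA; ring.
move=> /(irrational_free nx)[].
- by apply: isratD; [rewrite -!natrM | exact: isratM].
- exact: isratB.
move=> h1 h2; have [k mk] : exists k, m = (n + k)%N by exists (m - n)%N; lia.
have bk : (b <= k)%N by lia.
have mk' : m' = (n' + k)%N.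
  apply/eqP; rewrite -(eqr_nat R) natrD; move: h2; rewrite mk natrD => h2; apply/eqP; lra.
have : (n%:R - n'%:R) * ((n%:R + n'%:R) + (r + k%:R)) = 0 :> R by rewrite -h1 mk mk' !natrD; ring.
move/eqP; rewrite mulf_eq0 => /orP[|].
  rewrite subr_eq0 eqr_nat => /eqP e; by rewrite mk mk' e.
by rewrite gt_eqF // ltr_wpDl ?addr_ge0 // bn.
Qed.

Lemma unip_nat G n : PSL_subgroup_preimage G -> G (unip 1) -> G (unip n%:R).
Proof.
move=> [_ G1 _ GM _] GT; elim: n => [|n IH]; first by rewrite unip0.
by rewrite -natr1 addrC -unipD; apply: GM.
Qed.

Lemma tr_unip_unip (a b c d a' b' c' d' n m : R) :
  \tr (mx2 a b c d *m unip n *m mx2 a' b' c' d' *m unip m) =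
  c * c' * n * m + (a * c' + c * d') * n + (c * a' + d * c') * m + (a * a' + b * c' + c * b' + d * d').
Proof. by rewrite /unip !mulmx2 tr_mx22; ring. Qed.

Section Sparse.
Variable G : set 'M[R]_2.
Hypotheses (gG : PSL_subgroup_preimage G) (sG : sparse (trace_set G)) (GT : G (unip 1)).

Lemma trace_bilinear a b c d a' b' c' d' : G (mx2 a b c d) -> G (mx2 a' b' c' d') -> forall n m : nat,
  trace_set G (c * c' * n%:R * m%:R + (a * c' + c * d') * n%:R + (c * a' + d * c') * m%:R + (a * a' + b * c' + c * b' + d * d')).
Proof.
move=> Gg Gh n m; have [_ _ _ GM _] := gG.
exists (mx2 a b c d *m unip n%:R *m mx2 a' b' c' d' *m unip m%:R); split; last exact: tr_unip_unip.
by do 3?[apply: (GM) => //]; exact: unip_nat.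
Qed.

Lemma israt_trace_ratio a b c d : G (mx2 a b c d) -> c != 0 -> israt ((a + d) / c).
Proof.
move=> Gg c0; have := bilinear_sparse sG _ (trace_bilinear Gg Gg) (or_introl _).
have -> : (c * a + d * c) / (c * c) = (a + d) / c by field.
by apply; [rewrite mulf_neq0 | ring].
Qed.

(** The two mixed coefficients differ in general, but their sum divided by c c' is (a + d) / c + (a'
    + d') / c', rational by [israt_trace_ratio], where the two elements are equal and so are the
    coefficients. *)
Lemma israt_cross_ratio a b c d a' b' c' d' : G (mx2 a b c d) -> G (mx2 a' b' c' d') -> c != 0 -> c' != 0 ->
  israt (a' / c' + d / c).
Proof.
move=> Gg Gh c0 c0'; have := bilinear_sparse sG _ (trace_bilinear Gg Gh) (or_intror _).
have -> : (c * a' + d * c') / (c * c') = a' / c' + d / c by field; rewrite ?c0 ?c0'.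
apply; first by rewrite mulf_neq0.
have -> : (a * c' + c * d' + (c * a' + d * c')) / (c * c') = (a + d) / c + (a' + d') / c' by field; rewrite ?c0 ?c0'.
by apply: isratD; apply: israt_trace_ratio; eassumption.
Qed.

(** For nonzero g this says that g is a rational matrix times a real number with rational square. *)
Definition projrat (g : 'M[R]_2) := forall i j k l, israt (g i j * g k l).

Lemma projratM g h : projrat g -> projrat h -> projrat (g *m h).
Proof.
move=> hg hh i j k l; rewrite !mxE big_distrlr /=.
have sum2 (F : 'I_2 -> R) : (forall i, israt (F i)) -> israt (\sum_i F i).
  by move=> H; rewrite !big_ord_recl big_ord0 addr0; apply: isratD.
apply: (sum2) => u; apply: (sum2) => v; rewrite mulrACA; exact: isratM.
Qed.

Lemma projratV g : \det g = 1 -> projrat g -> projrat (invmx g).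
Proof.
have [a [b [c [d ->]]]] := mx2_ex g; rewrite det_mx22 => D; rewrite invmx2 // => H.
have E i j : exists i' j', let t := mx2 a b c d i' j' in mx2 d (- b) (- c) a i j = t \/ mx2 d (- b) (- c) a i j = - t.
  case: (ord2P i) => ->; case: (ord2P j) => ->.
  - by exists ord_max, ord_max; rewrite !mx2E; left.
  - by exists ord0, ord_max; rewrite !mx2E; right.
  - by exists ord_max, ord0; rewrite !mx2E; right.
  - by exists ord0, ord0; rewrite !mx2E; left.
move=> i j k l; have [i' [j' /= [->|->]]] := E i j; have [k' [l' /= [->|->]]] := E k l; rewrite ?mulNr ?mulrN ?opprK //; exact: isratN.
Qed.

Lemma projrat_scaled k a b c d : israt (k ^+ 2) -> israt a -> israt b -> israt c -> israt d ->
  projrat (mx2 (k * a) (k * b) (k * c) (k * d)).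
Proof.
move=> rk ra rb rc rd i j m l; rewrite -!scalemx2 mxE [X in _ * X]mxE mulrACA -expr2.
have E u v : israt (mx2 a b c d u v) by case: (ord2P u) => ->; case: (ord2P v) => ->; rewrite mx2E.
by apply: isratM => //; apply: isratM.
Qed.

(** With u = a / c + n + d / c, the ratio of the first column of g T^n g is a / c - 1 / (c^2 u), so
    c^2 is rational; n is 0 or 1, whichever makes u nonzero. *)
Lemma projrat_lower a b c d : G (mx2 a b c d) -> c != 0 ->
  (forall a' b' c' d', G (mx2 a' b' c' d') -> c' != 0 -> israt (a' / c')) -> israt (d / c) ->
  projrat (mx2 a b c d).
Proof.
move=> Gg c0 Hr rd; have [dG _ _ GM _] := gG.
have ra := Hr _ _ _ _ Gg c0.
have D := dG _ Gg; rewrite det_mx22 in D.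
have [n hn] : exists n : nat, a / c + n%:R + d / c != 0.
  case: (eqVneq (a / c + 0%:R + d / c) 0) => [e|]; last by exists 0%N.
  exists 1%N; rewrite addrAC -[_ + _ + 1]/((a / c + d / c) + 1) -[a / c]addr0 e add0r oner_neq0 //.
have [u uE] : exists u, u = a / c + n%:R + d / c by eexists.
rewrite -uE in hn.
have ed : d = c * (u - a / c - n%:R) by rewrite uE; field.
have Gh : G (mx2 a b c d *m unip n%:R *m mx2 a b c d) by do 2?[apply: (GM) => //]; exact: unip_nat.
rewrite /unip !mulmx2 in Gh.
have cE : (c * 1 + d * 0) * a + (c * n%:R + d * 1) * c = c ^+ 2 * u by rewrite ed; field.
have cn : (c * 1 + d * 0) * a + (c * n%:R + d * 1) * c != 0 by rewrite cE mulf_neq0 ?expf_neq0.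
have := Hr _ _ _ _ Gh cn; rewrite cE.
have -> : ((a * 1 + b * 0) * a + (a * n%:R + b * 1) * c) / (c ^+ 2 * u) = a / c - (c ^+ 2)^-1 / u.
  have -> : b = (a * d - 1) / c by rewrite -D; field.
  by rewrite ed; field; rewrite c0 hn.
move=> h; have ru : israt u by rewrite uE; apply: isratD => //; apply: isratD => //; exact: israt_nat.
have rc2 : israt (c ^+ 2).
  rewrite -[c ^+ 2]invrK; apply: isratV.
  have -> : (c ^+ 2)^-1 = (a / c - (a / c - (c ^+ 2)^-1 / u)) * u by field; rewrite hn c0.
  by apply: isratM => //; apply: isratB.
rewrite (_ : mx2 a b c d = mx2 (c * (a / c)) (c * (b / c)) (c * 1) (c * (d / c))); last by congr mx2; field.
apply: projrat_scaled => //; last exact: israt1.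
have -> : b / c = (a / c) * (d / c) - (c ^+ 2)^-1 by rewrite (_ : b = (a * d - 1) / c); [field | rewrite -D; field].
by apply: isratB; [exact: isratM | exact: isratV].
Qed.
End Sparse.

Lemma conj_unip G x y : G (unip y) -> conj_set (unip x) G (unip y).
Proof.
by move=> Gy; rewrite /conj_set /= unipV !unipD (_ : - x + (y + x) = y) //; ring.
Qed.

(** The conjugation moves a / c, the image of infinity under some g, to 0. Cross ratios with this
    element give the rationality of both ratios for all others with nonzero lower left entry; an
    element fixing infinity is first multiplied by it. *)
Lemma sparse_projrat G : PSL_subgroup_preimage G -> sparse (trace_set G) -> G (unip 1) ->
  (exists2 g, G g & g ord_max ord0 != 0) ->
  exists x, exists2 g, conj_set (unip x) G g & [/\ g ord0 ord0 = 0, g ord_max ord0 != 0 &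
    forall h, conj_set (unip x) G h -> projrat h].
Proof.
move=> gG sG GT [g0 Gg0]; have [a [b [c [d e0]]]] := mx2_ex g0; subst g0; rewrite mx2E => c0.
set x := a / c; have Du : \det (unip x) = 1 by rewrite /unip det_mx22; ring.
have gG1 := conj_group Du gG; have GT1 : conj_set (unip x) G (unip 1) by exact: conj_unip.
set G1 := conj_set _ _ in gG1 GT1 *.
have sG1 : sparse (trace_set G1).
  by rewrite (_ : trace_set G1 = trace_set G) //; apply/seteqP; split => t /(conj_trace G t Du).
have [dG1 _ _ GM1 GV1] := gG1.
have [b' [d' Gg1]] : exists b' d', G1 (mx2 0 b' c d').
  exists (b - x * d + (a - x * c) * x), (d + c * x).
  rewrite /G1 /conj_set /= unipV /unip !mulmx2 (_ : mx2 _ _ _ _ = mx2 a b c d) //.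
  by congr mx2; rewrite /x; field.
exists x, (mx2 0 b' c d') => //; rewrite !mx2E; split => //.
have r1 := israt_trace_ratio gG1 sG1 GT1 Gg1 c0; rewrite add0r in r1.
have Ra p q r s : G1 (mx2 p q r s) -> r != 0 -> israt (p / r).
  move=> Gh r0; have := israt_cross_ratio gG1 sG1 GT1 Gg1 Gh c0 r0 => /isratB/(_ r1).
  by rewrite addrK.
have Rd p q r s : G1 (mx2 p q r s) -> r != 0 -> israt (s / r).
  move=> Gh r0; have := israt_cross_ratio gG1 sG1 GT1 Gh Gg1 r0 c0.
  by rewrite mul0r add0r.
have P h : G1 h -> h ord_max ord0 != 0 -> projrat h.
  have [p [q [r [s ->]]]] := mx2_ex h; rewrite mx2E => Gh r0.
  exact: (projrat_lower gG1 GT1 Gh r0 Ra (Rd _ _ _ _ Gh r0)).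
move=> h Gh; case: (eqVneq (h ord_max ord0) 0) => [h0|]; last exact: P.
have Pg : projrat (mx2 0 b' c d') by apply: P; rewrite ?mx2E.
have Dg := dG1 _ Gg1.
have -> : h = invmx (mx2 0 b' c d') *m (mx2 0 b' c d' *m h) by rewrite mulmxA mulVmx ?mul1mx // unit_det1.
apply: projratM; first exact: projratV.
apply: P; first exact: GM1.
have Dh := dG1 _ Gh; move: h0 Dh {Gh}; have [p [q [r [s ->]]]] := mx2_ex h; rewrite mx2E => -> ; rewrite det_mx22 mulmx2 !mx2E => Dh.
rewrite mulr0 addr0 mulf_neq0 //; apply/eqP => p0; move: Dh; rewrite p0 mul0r mulr0 subr0 => /esym/eqP; rewrite oner_eq0 //.
Qed.
End RationalEntries.

(** * Integrality of rational traces *)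

Section PowerTraces.
Context {R : realType}.
Implicit Types (G : set 'M[R]_2).

(* If [tr h = e / f] and [(x, y) = power_coeffs e f j], then
   [h ^+ j.+1 = (x / f ^+ j) *: h - (f * y / f ^+ j)%:M] by Cayley-Hamilton. *)
Fixpoint power_coeffs (e : int) (f : nat) j : int * int :=
  if j is j'.+1 then let: (x, y) := power_coeffs e f j' in (e * x - (f%:Z ^+ 2) * y, x) else (1, 0).

(** The next coefficient is e x modulo f and -f^2 y modulo x, where y is the preceding one. This
    makes the residue P of [progression_gcd] prime to its modulus. *)
Lemma power_coeffs_coprime (e : int) f j : coprimez e f%:Z ->
  coprimez (power_coeffs e f j).1 f%:Z /\ coprimez (power_coeffs e f j).1 (power_coeffs e f j).2.
Proof.
move=> ef; elim: j => [|j] /=; first by rewrite /coprimez !gcd1z.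
case: (power_coeffs e f j) => x y /= [h1 h2]; split.
  by rewrite coprimez_sym (_ : e * x - f%:Z ^+ 2 * y = (- (f%:Z * y)) * f%:Z + e * x); [rewrite /coprimez gcdzMDl -/(coprimez _ _) coprimezMr !(coprimez_sym f%:Z) ef | ring].
rewrite coprimez_sym /coprimez gcdzMDl gcdzN -/(coprimez _ _).
by rewrite coprimezMr coprimezXr ?h2 ?h1.
Qed.

Lemma power_coeffs_bound (e : int) f j (M : int) : (0 < f)%N -> `|e| + f%:Z ^+ 2 <= M ->
  `|(power_coeffs e f j).1| <= M ^+ j /\ `|(power_coeffs e f j).2| <= M ^+ j.
Proof.
move=> f0 hM; have M1 : 1 <= M.
  by apply: le_trans hM; apply: ler_wpDl => //; apply: exprn_ege1; rewrite lez_nat.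
have M0 : 0 <= M by exact: le_trans M1.
elim: j => [|j] //=.
case: (power_coeffs e f j) => x y /= [h1 h2]; split; last by rewrite exprS (le_trans h1) // ler_peMl // exprn_ge0.
apply: (le_trans (ler_normB _ _)); rewrite !normrM exprS.
apply: (le_trans _ (ler_wpM2r (exprn_ge0 j M0) hM)); rewrite mulrDl lerD //; first exact: ler_wpM2l.
by rewrite -expr2 ger0_norm // ler_wpM2l // exprn_ge0.
Qed.

Lemma unip_int G (n : int) : PSL_subgroup_preimage G -> G (unip 1) -> G (unip n%:~R).
Proof.
move=> gG GT; have [_ _ _ _ GV] := gG; case: n => n; first exact: unip_nat.
by rewrite NegzE mulrNz -unipV; apply: GV; exact: unip_nat.
Qed.

(** The trace of h^(j+1) T^(C2 n1) h T^(C2 n2). As both matrices are combinations of h and 1, the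
    coefficients of n1 and n2 agree, and the bilinear polynomial is a product plus a constant. The
    factor C2 clears the denominator of c, placing both factors in one residue class. *)
Lemma power_traces G a b c d (e C1 : int) (f C2 : nat) j : PSL_subgroup_preimage G -> G (unip 1) -> G (mx2 a b c d) ->
  (0 < f)%N -> (0 < C2)%N -> a + d = e%:~R / f%:R -> c = C1%:~R / C2%:R ->
  let x := (power_coeffs e f j).1 in let x' := (power_coeffs e f j.+1).1 in x != 0 ->
  forall n1 n2 : int,
  trace_set G ((x' + C1 * f%:Z * x * n1)%:~R * (x' + C1 * f%:Z * x * n2)%:~R / (f%:R ^+ j.+2 * x%:~R) -
    (f%:R ^+ j / x%:~R + x%:~R / f%:R ^+ j)).
Proof.
move=> gG GT Gh f0 C20 we ce; have [dG G1 GN GM GV] := gG.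
have D := dG _ Gh; rewrite det_mx22 in D.
have fr : f%:R != 0 :> R by rewrite pnatr_eq0 -lt0n.
have cr : C2%:R != 0 :> R by rewrite pnatr_eq0 -lt0n.
have Hk : G (mx2 ((power_coeffs e f j).1%:~R / f%:R ^+ j * a - f%:R * (power_coeffs e f j).2%:~R / f%:R ^+ j)
  ((power_coeffs e f j).1%:~R / f%:R ^+ j * b) ((power_coeffs e f j).1%:~R / f%:R ^+ j * c)
  ((power_coeffs e f j).1%:~R / f%:R ^+ j * d - f%:R * (power_coeffs e f j).2%:~R / f%:R ^+ j)).
  elim: j => [|j] /=.
    by rewrite expr0 !divr1 !mul1r mulr0 !subr0.
  case: (power_coeffs e f j) => x y /= IH; have := GM _ _ IH Gh; rewrite mulmx2.
  set X := mx2 _ _ _ _; set Y := mx2 _ _ _ _; suff -> : X = Y by [].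
  have bc : b * c = a * d - 1 by rewrite -D; ring.
  have eE : e%:~R = (a + d) * f%:R :> R by rewrite we; field.
  rewrite /X /Y !rmorphB !rmorphM /= !exprS eE.
  have F0 : f%:R ^+ j != 0 :> R by rewrite expf_neq0.
  congr mx2.
  - rewrite -[_ / _ * b * c]mulrA bc. field. by rewrite F0 fr.
  - field; by rewrite F0 fr.
  - field; by rewrite F0 fr.
  - rewrite [X in X + _](_ : _ = (x%:~R / f%:R ^+ j) * (b * c)); last by ring.
    rewrite bc; field; by rewrite F0 fr.
have Dk := dG _ Hk; rewrite det_mx22 in Dk.
move=> x x'; rewrite /x' /=; move: Hk Dk; rewrite /x; case: (power_coeffs e f j) => {}x y /= Hk Dk x0 n1 n2.
have xr : x%:~R != 0 :> R by rewrite intr_eq0.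
have Gt (n : int) : G (unip (C2%:R * n%:~R)).
  by have := @unip_int G (C2%:Z * n) gG GT; rewrite intrM.
exists (mx2 (x%:~R / f%:R ^+ j * a - f%:R * y%:~R / f%:R ^+ j) (x%:~R / f%:R ^+ j * b) (x%:~R / f%:R ^+ j * c)
     (x%:~R / f%:R ^+ j * d - f%:R * y%:~R / f%:R ^+ j) *m unip (C2%:R * n1%:~R) *m mx2 a b c d *m unip (C2%:R * n2%:~R)).
split; first by do 3?[apply: (GM) => //].
rewrite tr_unip_unip.
have F0 : f%:R ^+ j != 0 :> R by rewrite expf_neq0.
pose U : R := x%:~R / f%:R ^+ j; pose V : R := f%:R * y%:~R / f%:R ^+ j.
rewrite -/U -/V in Dk *.
have U0 : U != 0 by rewrite mulf_neq0 // invr_eq0.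
have bc : b * c = a * d - 1 by rewrite -D; ring.
have eE : e%:~R = (a + d) * f%:R :> R by rewrite we; field.
(* The determinant of h^(j+1), expressed by U and V; it reduces the constant term to -(1 / U +
   U). *)
have inv : U ^+ 2 - U * V * (a + d) + V ^+ 2 = 1.
  have h : U * b * (U * c) = U ^+ 2 * (b * c) by ring.
  by rewrite -[RHS]Dk h bc; ring.
have -> : f%:R ^+ j / x%:~R + x%:~R / f%:R ^+ j = U^-1 + U by rewrite /U invf_div.
pose U' := (a + d) * U - V.
have E1 (n : int) : (e * x - f%:Z ^+ 2 * y + C1 * f%:Z * x * n)%:~R = f%:R ^+ j.+1 * (c * U * (C2%:R * n%:~R) + U').
  rewrite rmorphD rmorphB !rmorphM /= eE ce /U' /U /V exprS; field.
  by rewrite F0 cr.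
rewrite !E1.
have -> : f%:R ^+ j.+1 * (c * U * (C2%:R * n1%:~R) + U') * (f%:R ^+ j.+1 * (c * U * (C2%:R * n2%:~R) + U')) / (f%:R ^+ j.+2 * x%:~R) =
  (c * U * (C2%:R * n1%:~R) + U') * (c * U * (C2%:R * n2%:~R) + U') / U.
  rewrite /U !exprS; field; by rewrite F0 xr fr.
move: (C2%:R * n1%:~R) (C2%:R * n2%:~R) => m1 m2.
have -> : (U * a - V) * a + U * b * c + U * c * b + (U * d - V) * d = U * ((a + d) ^+ 2 - 2) - V * (a + d).
  have h : U * c * b = U * (b * c) by ring.
  by rewrite h -[U * b * c]mulrA bc; ring.
rewrite [U^-1 + U](_ : _ = U - V * (a + d) + V ^+ 2 / U + U); last first.
  by congr (_ + _); rewrite -[LHS]mul1r -inv; field.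
by rewrite /U'; field.
Qed.
End PowerTraces.

Lemma linear_lt_exp A B : exists j, (A + B * j < 2 ^ j)%N.
Proof.
have sq k : ((k + 5) ^ 2 < 2 ^ (k + 5))%N.
  by elim: k => // k IH; rewrite addSn (expnS 2 (k + 5)); move: IH; rewrite -!mulnn; nia.
exists (A + B + 5)%N; apply: leq_ltn_trans (sq _); rewrite -mulnn; nia.
Qed.

Lemma israt_frac (R : realType) (x : R) : israt x ->
  exists (e : int) (f : nat), [/\ (0 < f)%N, coprimez e f%:Z & x = e%:~R / f%:R].
Proof.
move=> [q ->]; exists (numq q), `|denq q|%N; split.
- by rewrite absz_gt0 denq_neq0.
- by rewrite coprimezE absz_nat coprime_num_den.
- by rewrite /ratr -[f in _ / f]/(_%:~R) -[(`|denq q|%N)%:R]/((`|denq q|%N : int)%:~R) gtz0_abs ?denq_gt0.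
Qed.

(** Dividing the progression by its gcd g leaves a class P prime to the new modulus q. Since x' is
    prime to f and to x, g divides C1, so it is bounded independently of the power of h. *)
Lemma progression_gcd (C1 x x' : int) (f : nat) : C1 != 0 -> x != 0 -> (1 < f)%N ->
  coprimez x' f%:Z -> coprimez x' x ->
  exists g q P : nat, [/\ [/\ (0 < g)%N, (g <= `|C1|)%N & (g * q = `|C1| * f * `|x|)%N], (1 < q)%N, coprime q P &
    forall d : nat, d = P %[mod q] -> exists n : int, (g * d)%:Z = x' + C1 * f%:Z * x * n].
Proof.
move=> C0 x0 f1 cf cx; pose Q := (`|C1| * f * `|x|)%N.
have Q0 : (0 < Q)%N by rewrite !muln_gt0 !absz_gt0 C0 x0 (ltnW f1).
pose g := gcdn `|x'| Q; have g0 : (0 < g)%N by rewrite gcdn_gt0 Q0 orbT.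
have gC : (g %| `|C1|)%N.
  have h : (g %| `|C1| * (f * `|x|))%N by rewrite mulnA dvdn_gcdr.
  have c1 : coprime g (f * `|x|).
    have h2 : (g %| `|x'|)%N by exact: dvdn_gcdl.
    by rewrite coprimeMr !(coprime_dvdl h2).
  by rewrite Gauss_dvdl in h.
have [q Qq] : exists q, Q = (g * q)%N by exists (Q %/ g)%N; rewrite mulnC divnK // dvdn_gcdr.
have gle : (g <= `|C1|)%N by rewrite dvdn_leq // absz_gt0.
have x1 : (0 < `|x|)%N by rewrite absz_gt0.
have q1 : (1 < q)%N.
  rewrite ltnNge; apply/negP => h; have := leq_mul gle h; rewrite -Qq muln1 leqNgt /Q -mulnA.
  rewrite ltn_Pmulr // ?absz_gt0 //; apply: leq_trans f1 _; exact: leq_pmulr.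
have /dvdzP[z zE] : (g%:Z %| x')%Z by rewrite dvdzE absz_nat dvdn_gcdl.
have cz : coprime `|z| q.
  rewrite /coprime -(eqn_pmul2l g0) muln_gcdr muln1 -Qq.
  have -> : (g * `|z|)%N = `|x'|%N by rewrite zE abszM absz_nat mulnC.
  by [].
have q0 : (0 < q)%N by exact: ltnW.
have r0 : 0 <= (z %% q)%Z by rewrite modz_ge0 //; apply: lt0r_neq0; rewrite ltz_nat.
exists g, q, `|(z %% q)%Z|%N; split => //.
  rewrite coprime_sym -[q in coprime _ q]absz_nat -coprimezE /coprimez gcdz_modl.
  by rewrite -/(coprimez _ _) coprimezE absz_nat.
move=> d dP; have : (d%:Z = z %[mod q])%Z.
  rewrite -(modz_mod z) -[in RHS](gez0_abs r0) !modz_nat; congr Posz; exact: dP.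
move/eqP; rewrite eqz_mod_dvd => /dvdzP[n nE].
have gd : (g * d)%:Z = x' + Q%:Z * n by rewrite Qq !PoszM zE -[d%:Z](subrK z) nE; ring.
have QE : Q%:Z = C1 * f%:Z * x \/ Q%:Z = - (C1 * f%:Z * x).
  rewrite /Q !PoszM !abszE; case: (ger0P C1) => _; case: (ger0P x) => _; [left|right|right|left]; ring.
by case: QE => E; [exists n | exists (- n)]; rewrite gd E //; ring.
Qed.

Lemma leq_exp_base a b i : (a <= b)%N -> (a ^ i <= b ^ i)%N.
Proof. by case: i => // i ab; rewrite leq_exp2r. Qed.

Lemma natural_between (R : realType) (w : R) : 1 <= w -> exists n : nat, 2 * w <= n%:R <= 3 * w.
Proof.
move=> w1; have w0 : 0 <= 2 * w by lra.
have /andP[h h'] := truncn_itv w0; exists (Num.truncn (2 * w)).+1.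
by rewrite ltW //= -natr1; lra.
Qed.

Section IntegralTraces.
Context {R : realType}.
Variable G : set 'M[R]_2.
Hypotheses (gG : PSL_subgroup_preimage G) (sG : sparse (trace_set G)) (GT : G (unip 1)).

(** For f > 1, [power_traces] and [product_density] give more than Z / (32 q) traces of size at most
    n, where 2 alpha Z <= n <= 3 alpha Z; sparsity yields 1 < 96 q alpha m. But q alpha = D g /
    f^(j+1) with g <= D, where D does not depend on j, and m is linear in j. *)
Lemma integral_trace a b c d : G (mx2 a b c d) -> israt (a + d) -> israt c -> c != 0 ->
  exists n : int, a + d = n%:~R.
Proof.
move=> Gh /israt_frac[e [f [f0 cef we]]] /israt_frac[C1 [C2 [C20 _ ce]]] c0.
case: (leqP f 1) => [f1|f1].
  by exists e; rewrite we (_ : f = 1%N) ?divr1 //; lia.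
exfalso; have C10 : C1 != 0 by apply: contraNneq c0 => C10; rewrite ce C10 mul0r.
have [n0 Hn0] := sG ltr01.
pose D := `|C1|%N; have D0 : (0 < D)%N by rewrite absz_gt0.
pose M := (`|e| + f ^ 2)%N.
pose mu := M; have Mmu : (M <= 2 ^ mu)%N by exact/ltnW/ltn_expl.
have fM : (f <= M)%N by rewrite /M -mulnn; nia.
(* The arguments are the constant and the linear coefficient in j of 96 D^2 (7 l + 12), with the [l]
   chosen next. *)
have [j Hj] := linear_lt_exp (96 * D ^ 2 * (7 * (n0 + 3 + D + 2 * mu) + 12)) (96 * D ^ 2 * (21 * mu)).
(* Large enough for 2^l to bound q and (2 M^j + n0 + 1) f^(j+2) |x|; for Z >= 2^l, the main term
   alpha Z then exceeds both [n0] and the constant term. *)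
pose l := (n0 + 3 + D + mu * (3 * j + 2))%N.
have [cxf cxy] := power_coeffs_coprime j cef.
have [cxf' cxy'] := power_coeffs_coprime j.+1 cef.
have hM : `|e| + f%:Z ^+ 2 <= M%:Z by rewrite /M -mulnn PoszD PoszM abszE expr2.
have [bx _] := power_coeffs_bound j (ltnW f1) hM.
have := power_traces gG GT Gh (ltnW f1) C20 we ce => /(_ j) /=.
move: cxf cxy cxf' cxy' bx => /=; case: (power_coeffs e f j) => x y /= cxf _ cxf' cxx bx HT.
have x0 : x != 0.
  by apply: contraTneq cxf => ->; rewrite coprimezE /= /coprime gcd0n; lia.
have {}HT := HT x0.
set x' := e * x - f%:Z ^+ 2 * y in cxf' cxx HT.
have [g [q [P [[g0 gD gq] q1 cP HP]]]] := progression_gcd C10 x0 f1 cxf' cxx.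
have X0 : (0 < `|x|)%N by rewrite absz_gt0.
have M0 : (0 < M)%N by apply: leq_trans (ltnW f1) fM.
have Xle : (`|x| <= M ^ j)%N.
  rewrite -lez_nat abszE (le_trans bx) // le_eqVlt; apply/orP; left; apply/eqP.
  by elim: (j) => // i IH; rewrite exprS IH expnS PoszM.
have Mpow i : (M ^ i <= 2 ^ (mu * i))%N by rewrite expnM; exact: leq_exp_base.
have Dpow : (D <= 2 ^ D)%N by exact/ltnW/ltn_expl.
have ql : (q <= 2 ^ l)%N.
  apply: (@leq_trans (g * q)); first exact: leq_pmull.
  rewrite gq; apply: (@leq_trans (2 ^ D * 2 ^ mu * 2 ^ (mu * j))).
    by apply: leq_mul; [apply: leq_mul => //; exact: leq_trans fM Mmu | exact: leq_trans Xle (Mpow j)].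
  by rewrite -!expnD leq_exp2l // /l; clear; nia.
pose m := (7 * l + 12)%N.
have Hm : (96 * D ^ 2 * m < 2 ^ j)%N.
  by apply: leq_ltn_trans Hj; rewrite /m /l; clear; nia.
have big : ((2 * M ^ j + n0 + 1) * (f ^ j.+2 * `|x|) <= 2 ^ l)%N.
  apply: (@leq_trans ((2 ^ (n0 + 3) * 2 ^ (mu * j)) * (2 ^ (mu * j.+2) * 2 ^ (mu * j)))).
    apply: leq_mul; last apply: leq_mul.
    - apply: (@leq_trans ((n0 + 3) * M ^ j)); first by have := expn_gt0 M j; rewrite M0 /=; clear; nia.
      by apply: leq_mul; [exact/ltnW/ltn_expl | exact: Mpow].
    - exact: leq_trans (leq_exp_base _ fM) (Mpow _).
    - exact: leq_trans Xle (Mpow j).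
  by rewrite -!expnD leq_exp2l // /l; clear; nia.
have [Z /andP[Z1 Z2] [s [us sZ Hs]]] := @product_density R q q1 l P (2 ^ l) ql (leqnn _) cP.
pose F : R := f%:R ^+ j.+2; pose X : R := (`|x|%N)%:R.
have fr0 : 0 < f%:R :> R by rewrite ltr0n ltnW.
have F0 : 0 < F by rewrite exprn_gt0.
have Xr0 : 0 < X by rewrite ltr0n.
have Xr1 : 1 <= X by rewrite ler1n.
have fj0 : 0 < f%:R ^+ j :> R by rewrite exprn_gt0.
have fj1 : 1 <= f%:R ^+ j :> R by rewrite exprn_ege1 // ler1n ltnW.
(* Up to sign the spacing of the traces in N: both factors of the numerator are g times an integer
   in the class of P. *)
pose alpha : R := g%:R ^+ 2 / (F * X).
have gr0 : 0 < g%:R :> R by rewrite ltr0n.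
have FX0 : 0 < F * X by exact: mulr_gt0.
have a0 : 0 < alpha by apply: divr_gt0 => //; exact: exprn_gt0.
have A1 : (2 * M ^ j + n0 + 1)%:R <= alpha * Z%:R.
  rewrite mulrAC ler_pdivlMr //.
  have -> : F * X = (f ^ j.+2 * `|x|)%:R by rewrite natrM natrX.
  rewrite -natrM -natrX -natrM ler_nat; apply: (leq_trans big); apply: (leq_trans Z1).
  by rewrite leq_pmull // expn_gt0 g0.
pose beta : R := f%:R ^+ j / x%:~R + x%:~R / f%:R ^+ j.
have xX : `|x%:~R : R| = X by rewrite -intr_norm -abszE.
have A2 : `|beta| <= (2 * M ^ j)%:R.
  apply: le_trans (ler_normD _ _) _; rewrite !normrM !normfV xX (gtr0_norm fj0).
  have h1 : f%:R ^+ j / X <= f%:R ^+ j by rewrite ler_pdivrMr // ler_peMr // ltW.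
  have h2 : X / f%:R ^+ j <= X by rewrite ler_pdivrMr // ler_peMr // ltW.
  apply: (le_trans (lerD h1 h2)); rewrite mul2n -addnn natrD lerD //.
    by rewrite -natrX ler_nat leq_exp_base.
  by rewrite ler_nat.
have D2m : (3 * D ^ 2 <= 2 ^ j)%N by apply: leq_trans (ltnW Hm); rewrite /m; clear; nia.
(* Hence n <= 3 alpha Z <= Z, and n inherits the triple exponential bound of Z. *)
have A3 : 3 * alpha <= 1.
  rewrite mulrA ler_pdivrMr // mul1r; apply: (@le_trans _ _ (3 * D ^ 2)%:R).
    by rewrite natrM natrX ler_pM2l // lerXn2r ?nnegrE // ler_nat.
  apply: (@le_trans _ _ F); last by rewrite ler_peMr // ltW.
  rewrite /F -natrX ler_nat; apply: (leq_trans D2m); apply: (@leq_trans (f ^ j)); first exact: leq_exp_base.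
  by rewrite leq_exp2l // leqW.
have aZ : 1 <= alpha * Z%:R by apply: le_trans (A1); rewrite ler1n addn1.
have [n /andP[n1 n2]] := natural_between aZ.
have nn0 : (n0 <= n)%N.
  rewrite -(ler_nat R); apply: le_trans (n1); apply: (@le_trans _ _ (alpha * Z%:R)); last first.
    by rewrite ler_peMl ?ler1n // (le_trans ler01 aZ).
  by apply: le_trans (A1); rewrite ler_nat -addnA addnCA leq_addr.
have nm : (n <= 2 ^ 2 ^ 2 ^ m)%N.
  apply: leq_trans (Z2); rewrite -(ler_nat R); apply: (le_trans n2).
  by rewrite mulrA ler_piMl.
pose t (N : nat) : R := g%:R ^+ 2 * N%:R / (F * x%:~R) - beta.
have xr : x%:~R != 0 :> R by rewrite intr_eq0.
have tinj : injective t.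
  move=> N N' /addIr /(mulIf _) h; have := h; rewrite invr_eq0 mulf_neq0 ?(gt_eqF F0) // => /(_ isT).
  by move=> /(mulfI _) h'; apply/eqP; rewrite -(eqr_nat R) h' // expf_neq0 // gt_eqF.
have := Hn0 n m [seq t N | N <- s] nn0 nm; rewrite size_map map_inj_uniq // => /(_ us).
have tP r : r \in [seq t N | N <- s] -> trace_set G r /\ `|r| <= n%:R.
  case/mapP => N /Hs[NZ [u [v [Nuv u0 v0 uP vP]]]] ->; split.
    have [k1 e1] := HP u uP; have [k2 e2] := HP v vP.
    have := HT k1 k2; rewrite -e1 -e2 -/beta -/F.
    by rewrite /t Nuv !PoszM !intrM natrM expr2 mulrACA.
  apply: le_trans (ler_normB _ _) _; apply: le_trans (n1).
  rewrite -[2]/(1 + 1) mulrDl mul1r; apply: lerD; last first.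
    by apply: (le_trans A2); apply: le_trans (A1); rewrite ler_nat -addnA leq_addr.
  have g2 : 0 < g%:R ^+ 2 :> R by exact: exprn_gt0.
  rewrite [`|_ / _|]normrM [`|_ ^+ 2 * _|]normrM (gtr0_norm g2) normr_nat normfV normrM (gtr0_norm F0) xX mulrAC -/alpha.
  by rewrite ler_wpM2l ?ler_nat // ltW.
move=> /(_ tP); rewrite mul1r => Hsize.
have m0 : 0 <= m%:R :> R by [].
have H1 : Z%:R < 96 * q%:R * (alpha * Z%:R) * m%:R :> R.
  apply: (@lt_le_trans _ _ (32 * q * size s)%:R); first by rewrite ltr_nat.
  rewrite !natrM; apply: (@le_trans _ _ (32 * q%:R * (n%:R * m%:R))); first by rewrite ler_wpM2l // mulr_ge0.
  have := ler_wpM2l (_ : 0 <= 32 * q%:R * m%:R) n2; rewrite !mulr_ge0 // => /(_ isT) h.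
  apply: le_trans (le_trans _ h) _; rewrite le_eqVlt; apply/orP; left; apply/eqP; ring.
have Zr : 0 < Z%:R :> R by rewrite ltr0n; apply: leq_trans Z1; rewrite expn_gt0.
have H2 : 1 < 96 * q%:R * alpha * m%:R :> R.
  by rewrite -(ltr_pM2r Zr) mul1r; apply: lt_le_trans H1 _; rewrite le_eqVlt; apply/orP; left; apply/eqP; ring.
move: H2; have -> : 96 * q%:R * alpha * m%:R = 96 * (g%:R * q%:R) * g%:R * m%:R / (F * X).
  by rewrite /alpha; field; rewrite !gt_eqF.
rewrite ltr_pdivlMr // mul1r -natrM gq.
have -> : F * X = (f ^ j.+2 * `|x|)%:R by rewrite natrM natrX.
rewrite -!natrM ltr_nat => H3.
have H4 : (f ^ j.+1 < 96 * D * g * m)%N.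
  have fx : (0 < f * `|x|)%N by rewrite muln_gt0 X0 ltnW.
  rewrite -(ltn_pmul2l fx); apply: leq_trans (leq_trans _ H3) _.
    by rewrite ltnS (expnS f j.+1); apply: eq_leq; ring.
  by apply: eq_leq; rewrite -/D; ring.
have : (2 ^ j <= f ^ j.+1)%N.
  by apply: (@leq_trans (f ^ j)); [exact: leq_exp_base | rewrite leq_exp2l].
have : (96 * D * g * m <= 96 * D ^ 2 * m)%N by rewrite -mulnn mulnA !leq_mul.
by move: Hm H4; clear; lia.
Qed.
End IntegralTraces.

(** * Commensurability with SL(2,Z) *)

Section Integrality.
Context {R : realType}.
Implicit Types (G : set 'M[R]_2) (g h : 'M[R]_2).

Definition isint (x : R) := exists n : int, x = n%:~R.

Lemma isintD x y : isint x -> isint y -> isint (x + y).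
Proof. by move=> [m ->] [n ->]; exists (m + n); rewrite rmorphD. Qed.
Lemma isintN x : isint x -> isint (- x).
Proof. by move=> [m ->]; exists (- m); rewrite rmorphN. Qed.
Lemma isintM x y : isint x -> isint y -> isint (x * y).
Proof. by move=> [m ->] [n ->]; exists (m * n); rewrite rmorphM. Qed.
Lemma isint1 : isint 1. Proof. by exists 1. Qed.

Lemma israt_sqrt x : israt x -> isint (x ^+ 2) -> isint x.
Proof.
move=> /israt_frac[e [f [f0 cef ->]]] [n E]; have fr : f%:R != 0 :> R by rewrite pnatr_eq0 -lt0n.
have E2 : e * e = n * f%:Z * f%:Z.
  apply/eqP; rewrite -(eqr_int R) !rmorphM /= -E; apply/eqP.
  by rewrite -[(f%:Z)%:~R]/(f%:R); field.
have fe : (f %| `|e| * `|e|)%N by rewrite -abszM E2 abszM absz_nat dvdn_mull.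
have : coprime (`|e| * `|e|) f by rewrite coprimeMl andbb -[f]absz_nat -coprimezE.
rewrite /coprime (gcdn_idPr fe) => /eqP ->.
by exists e; rewrite divr1.
Qed.

Definition proj_integral (K : int) g := forall i j k l, isint (K%:~R * (g i j * g k l)).

Section Group.
Variable G : set 'M[R]_2.
Hypotheses (gG : PSL_subgroup_preimage G) (sG : sparse (trace_set G)) (GT : G (unip 1)).
Hypotheses (iG : isolated_one G) (rG : forall g, G g -> projrat g).

Lemma rational_trace a b c d : G (mx2 a b c d) -> israt a -> israt c -> israt d -> isint (a + d).
Proof.
move=> Gh ra rc rd; case: (eqVneq c 0) => [c0|c0]; last first.
  by have [n ->] := integral_trace gG sG GT Gh (isratD ra rd) rc c0; exists n.
move: Gh; rewrite c0 => /(upper_diagonal gG iG GT)[-> /eqP]; rewrite sqrf_eq1 => /orP[]/eqP->.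
  by exists 2; rewrite invr1.
by exists (- 2); rewrite invrN invr1 rmorphN /= -[2%:~R]/(1 + 1) opprD.
Qed.

Lemma rational_lower a b c d : G (mx2 a b c d) -> israt a -> israt c -> israt d -> isint c.
Proof.
move=> Gh ra rc rd; have [_ _ _ GM _] := gG.
have := GM _ _ GT Gh; rewrite /unip mulmx2 => G2.
have -> : c = (1 * a + 1 * c + (0 * b + 1 * d)) - (a + d) by ring.
apply: isintD; last by apply: isintN; exact: rational_trace Gh ra rc rd.
apply: rational_trace G2 _ _ _; rewrite ?mul1r ?mul0r ?add0r //; exact: isratD.
Qed.

(** Conjugating T by the given element, which maps infinity to 0, produces a lower unipotent with
    entry -c0^2. *)
Lemma lower_integral b0 c0 d0 : G (mx2 0 b0 c0 d0) -> c0 != 0 ->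
  exists2 nu : int, 0 < nu & G (mx2 1 0 (- nu%:~R) 1).
Proof.
move=> Gg c00; have [dG _ _ GM GV] := gG; have D := dG _ Gg; rewrite det_mx22 mul0r sub0r in D.
have G2 : G (mx2 1 0 (- c0 ^+ 2) 1).
  have := GM _ _ (GM _ _ Gg GT) (GV _ Gg); rewrite invmx2 ?mul0r ?sub0r // /unip !mulmx2.
  by congr G; congr mx2; first [ring | rewrite -[RHS]D; ring].
have [n nE] : isint (- c0 ^+ 2).
  apply: rational_lower G2 _ _ _; try exact: israt1.
  by apply: isratN; have := rG Gg ord_max ord0 ord_max ord0; rewrite !mx2E expr2.
exists (- n); last by rewrite rmorphN /= opprK -nE.
by rewrite oppr_gt0 -(ltr_int R) -nE oppr_lt0 exprn_even_gt0.
Qed.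

Lemma rational_upper (nu : int) a b c d : G (mx2 1 0 (- nu%:~R) 1) -> G (mx2 a b c d) ->
  israt a -> israt b -> israt c -> israt d -> isint (nu%:~R * b).
Proof.
move=> GL Gh ra rb rc rd; have [_ _ _ GM _] := gG.
have := GM _ _ GL Gh; rewrite mulmx2 => G2.
have rn := @israt_int R nu.
have -> : nu%:~R * b = (a + d) - ((1 * a + 0 * c) + (- nu%:~R * b + 1 * d)) by ring.
apply: isintD; first exact: rational_trace Gh ra rc rd.
apply: isintN; apply: rational_trace G2 _ _ _; rewrite ?mul1r ?mul0r ?addr0 //; apply: isratD => //; rewrite mulNr; apply: isratN; exact: isratM.
Qed.

(** The entries of g need not be rational, but the conjugates by g of T and of the lower unipotent
    are rational matrices, whose off-diagonal entries are the squares of the entries of g up to sign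
    and factors nu. Integral squares of rational products make the products integral. *)
Lemma group_proj_integral (nu : int) g : 0 < nu -> G (mx2 1 0 (- nu%:~R) 1) -> G g -> proj_integral (nu ^+ 2) g.
Proof.
move=> nu0 GL; have [a [b [c [d ->]]]] := mx2_ex g => Gg; have [dG _ _ GM GV] := gG.
have D := dG _ Gg; rewrite det_mx22 in D.
have r i j k l := rG Gg i j k l.
have rn := @israt_int R nu.
have := r ord0 ord0 ord0 ord0; have := r ord0 ord_max ord0 ord_max; have := r ord_max ord0 ord_max ord0.
have := r ord_max ord_max ord_max ord_max; have := r ord0 ord0 ord_max ord0; have := r ord0 ord_max ord_max ord_max.
rewrite !mx2E => rbd rac rdd rcc rbb raa.
have G1 : G (mx2 (1 - a * c) (a * a) (- (c * c)) (1 + a * c)).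
  rewrite -[in X in mx2 X]D -[in X in mx2 _ _ _ X]D.
  have := GM _ _ (GM _ _ Gg GT) (GV _ Gg); rewrite invmx2 // /unip !mulmx2.
  by congr G; congr mx2; ring.
have G2 : G (mx2 (1 - nu%:~R * (b * d)) (nu%:~R * (b * b)) (- (nu%:~R * (d * d))) (1 + nu%:~R * (b * d))).
  move: (nu%:~R) GL => t GL; rewrite -[in X in mx2 X]D -[in X in mx2 _ _ _ X]D.
  have := GM _ _ (GM _ _ Gg GL) (GV _ Gg); rewrite invmx2 // !mulmx2.
  by congr G; congr mx2; ring.
have r1 := israt1 (R := R).
have i1 : isint (c * c).
  rewrite -[c * c]opprK; apply: isintN; apply: rational_lower G1 _ _ _.
  - exact: isratB. - exact: isratN. - exact: isratD.
have i2 : isint (nu%:~R * (a * a)).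
  apply: rational_upper GL G1 _ _ _ _ => //. - exact: isratB. - exact: isratN. - exact: isratD.
have rnbd := isratM rn rbd.
have i3 : isint (nu%:~R * (d * d)).
  rewrite -[_ * _]opprK; apply: isintN; apply: rational_lower G2 _ _ _.
  - exact: isratB. - apply: isratN; exact: isratM. - exact: isratD.
have i4 : isint (nu%:~R * (nu%:~R * (b * b))).
  apply: rational_upper GL G2 _ _ _ _ => //. - exact: isratB. - exact: isratM. - apply: isratN; exact: isratM. - exact: isratD.
have in_ : isint nu%:~R by exists nu.
have sq i j : isint (nu%:~R ^+ 2 * (mx2 a b c d i j) ^+ 2).
  rewrite !expr2 -mulrA; case: (ord2P i) => ->; case: (ord2P j) => ->; rewrite !mx2E //; do ?[exact: isintM | apply: isintM => //].
move=> i j k l; apply: israt_sqrt.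
  by apply: isratM; [exact: israt_int | exact: r].
rewrite rmorphXn /= (_ : _ ^+ 2 = (nu%:~R ^+ 2 * (mx2 a b c d i j) ^+ 2) * (nu%:~R ^+ 2 * (mx2 a b c d k l) ^+ 2)); last by ring.
exact: isintM.
Qed.
End Group.
End Integrality.

(** * Finitely many classes of matrices with bounded denominators *)

Section Colours.
Context {R : realType}.
Implicit Types (g h : 'M[R]_2).

Definition intmx g := forall i j, isint (g i j).

(** A suitable multiple of g is integral; dividing by the gcd of its entries gives g = mu n with n
    primitive. By Bezout mu is an integral combination of the entries of g, so K mu^2 is an integer,
    and K is this integer times det n. *)
Lemma primitive_form (K : int) g : 0 < K -> \det g = 1 -> proj_integral K g ->
  exists (mu : R) (n : 'I_2 -> 'I_2 -> int) (D : nat),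
  [/\ forall i j, g i j = mu * (n i j)%:~R, mu ^+ 2 * D%:R = 1,
   n ord0 ord0 * n ord_max ord_max - n ord0 ord_max * n ord_max ord0 = D%:Z & (D <= `|K|)%N].
Proof.
move=> K0 Dg Hg; have KR : 0 < K%:~R :> R by rewrite ltr0z.
have [k [l e0]] : exists k l, g k l != 0.
  apply: contrapT => H; have z i j : g i j = 0.
    by apply/eqP; apply: contrapT => /negP h; apply: H; exists i, j.
  by move: Dg; rewrite detE !z !mul0r subrr => /esym/eqP; rewrite oner_eq0.
pose N i j : int := projT1 (cid (Hg k l i j)).
have NE i j : K%:~R * (g k l * g i j) = (N i j)%:~R by exact: projT2 (cid (Hg k l i j)).
pose d1 := gcdz (N ord0 ord0) (N ord0 ord_max); pose d2 := gcdz (N ord_max ord0) (N ord_max ord_max).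
pose d := gcdz d1 d2.
have Kg0 : K%:~R * g k l != 0 :> R by exact: mulf_neq0 (lt0r_neq0 KR) e0.
have dN i j : (d %| N i j)%Z.
  case: (ord2P i) => ->; case: (ord2P j) => ->.
  - exact: dvdz_trans (dvdz_gcdl _ _) (dvdz_gcdl _ _).
  - exact: dvdz_trans (dvdz_gcdl _ _) (dvdz_gcdr _ _).
  - exact: dvdz_trans (dvdz_gcdr _ _) (dvdz_gcdl _ _).
  - exact: dvdz_trans (dvdz_gcdr _ _) (dvdz_gcdr _ _).
have d0 : d != 0.
  apply/eqP => d0; have := dN k l; rewrite d0 dvd0z => /eqP h.
  by have := NE k l; rewrite h mulrA => /eqP; rewrite mulf_eq0 (negPf Kg0) (negPf e0).
pose n i j : int := (N i j %/ d)%Z.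
have nE i j : N i j = n i j * d by rewrite /n divzK.
have dR : d%:~R != 0 :> R by rewrite intr_eq0.
pose mu : R := d%:~R / (K%:~R * g k l).
have gE i j : g i j = mu * (n i j)%:~R.
  have := NE i j; rewrite nE rmorphM /= mulrA => h.
  by rewrite /mu mulrAC [d%:~R * _]mulrC -h mulrAC mulfV // mul1r.
have [u1 [v1 b1]] := Bezoutz (N ord0 ord0) (N ord0 ord_max).
have [u2 [v2 b2]] := Bezoutz (N ord_max ord0) (N ord_max ord_max).
have [u3 [v3 b3]] := Bezoutz d1 d2.
have muE : mu = (u3 * u1)%:~R * g ord0 ord0 + (u3 * v1)%:~R * g ord0 ord_max + (v3 * u2)%:~R * g ord_max ord0 + (v3 * v2)%:~R * g ord_max ord_max.
  apply: (mulfI Kg0); rewrite /mu mulrC divfK //.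
  rewrite !mulrDr ![_ * (_ %:~R * g _ _)]mulrCA -![_ * g k l * g _ _]mulrA !NE -!intrM -!intrD; congr _%:~R.
  by rewrite /d -b3 /d1 /d2 -b1 -b2; ring.
pose P (x y : R) := isint (K%:~R * (x * y)).
have Pz (z : int) x y : P x y -> P (z%:~R * x) y.
  rewrite /P (_ : K%:~R * (z%:~R * x * y) = z%:~R * (K%:~R * (x * y))); last by ring.
  by move=> h; apply: isintM => //; exists z.
have Pd x x' y : P x y -> P x' y -> P (x + x') y.
  by rewrite /P mulrDl mulrDr => h h'; exact: isintD.
have Ps x y : P x y -> P y x by rewrite /P [x * y]mulrC.
have P1 i j : P mu (g i j).
  by rewrite muE; apply: (Pd); [apply: (Pd); [apply: (Pd)|]|]; apply: (Pz); exact: Hg.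
have [j jE] : P mu mu.
  by rewrite {1}muE; apply: (Pd); [apply: (Pd); [apply: (Pd)|]|]; apply: (Pz); apply: (Ps); exact: P1.
have mu0 : mu != 0 by rewrite mulf_neq0 // invr_eq0.
have mu2 : 0 < mu * mu by rewrite -expr2 exprn_even_gt0.
pose Dz := n ord0 ord0 * n ord_max ord_max - n ord0 ord_max * n ord_max ord0.
have DzE : mu ^+ 2 * Dz%:~R = 1.
  by rewrite -[RHS]Dg detE !gE /Dz rmorphB !rmorphM /=; move: (mu) => t; ring.
have Dz0 : 0 < Dz by rewrite -(ltr0z R) -(pmulr_rgt0 _ mu2) -expr2 DzE.
have j0 : 0 < j by rewrite -(ltr0z R) -jE mulr_gt0.
have jD : j * Dz = K.
  by apply/eqP; rewrite -(eqr_int R) rmorphM /= -jE -mulrA -expr2 DzE mulr1.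
have DzN : Dz = (`|Dz|%N)%:Z by rewrite gez0_abs // ltW.
exists mu, n, `|Dz|%N; split => //; first by rewrite -[X in _ * X]/((`|Dz|%N)%:Z%:~R) -DzN.
by rewrite -jD abszM leq_pmull // absz_gt0 gt_eqF.
Qed.

(* The colour of [g = mu *: n], [n] primitive, is [\det n] together with [n] modulo [\det n]. *)
Lemma finite_colouring (K : int) : 0 < K -> exists (C : finType) (col : 'M[R]_2 -> C), forall g h,
  \det g = 1 -> \det h = 1 -> proj_integral K g -> proj_integral K h -> col g = col h -> intmx (invmx g *m h).
Proof.
move=> K0; pose B := `|K|%N; pose C : finType := ('I_B.+1 * {ffun 'I_2 * 'I_2 -> 'I_B.+1})%type.
pose Q g (c : C) := exists (mu : R) (n : 'I_2 -> 'I_2 -> int),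
  [/\ forall i j, g i j = mu * (n i j)%:~R, mu ^+ 2 * (c.1 : nat)%:R = 1,
   n ord0 ord0 * n ord_max ord_max - n ord0 ord_max * n ord_max ord0 = (c.1 : nat)%:Z &
   forall i j, (n i j %% (c.1 : nat)%:Z)%Z = (c.2 (i, j) : nat)%:Z].
have H g : exists c : C, \det g = 1 -> proj_integral K g -> Q g c.
  have [[Dg Hg]|nP] := pselect (\det g = 1 /\ proj_integral K g); last first.
    by exists (ord0, [ffun=> ord0]) => h1 h2; case: nP.
  have [mu [n [D [h1 h2 h3 h4]]]] := primitive_form K0 Dg Hg.
  have D0 : (0 < D)%N by rewrite lt0n; apply/eqP => D0; move: h2; rewrite D0 mulr0 => /esym/eqP; rewrite oner_eq0.
  exists (inord D, [ffun p => inord `|(n p.1 p.2 %% D)%Z|%N]) => _ _; exists mu, n; rewrite /= inordK //; split => // i j.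
  have m0 : 0 <= (n i j %% D)%Z by rewrite modz_ge0 //; apply: lt0r_neq0; rewrite ltz_nat.
  rewrite ffunE inordK ?gez0_abs // ltnS (leq_trans _ h4) // -lez_nat gez0_abs //.
  by rewrite ltW // ltz_pmod.
pose col g := projT1 (cid (H g)).
exists C, col => g h Dg Dh Hg Hh ceq.
have [mu [n [gE m2 Dn rn]]] : Q g (col g) := projT2 (cid (H g)) Dg Hg.
have [mu' [n' [hE m2' Dn' rn']]] : Q h (col h) := projT2 (cid (H h)) Dh Hh.
rewrite -ceq in m2' Dn' rn'; move: (col g) m2 Dn rn m2' Dn' rn' {ceq} => [[D Db] c] /= m2 Dn rn m2' Dn' rn'.
have t i j : exists t : int, n' i j = n i j + D%:Z * t.
  exists ((n' i j %/ D)%Z - (n i j %/ D)%Z); rewrite {1}(divz_eq (n' i j) D) {1}(divz_eq (n i j) D) rn rn'; ring.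
(* With n' = n + D t, the product of the adjugate of n with n' is divisible by D, and mu mu' D is 1
   or -1. *)
have sgn : isint (mu * mu' * (D%:Z)%:~R).
  rewrite -[(D%:Z)%:~R]/(D%:R).
  have : (mu * mu' * D%:R) ^+ 2 == 1.
    by apply/eqP; transitivity ((mu ^+ 2 * D%:R) * (mu' ^+ 2 * D%:R)); [ring | rewrite m2 m2' mulr1].
  rewrite sqrf_eq1 => /orP[]/eqP->; [exact: isint1 | exact/isintN/isint1].
have [t0 e0] := t ord0 ord0; have [t1 e1] := t ord0 ord_max; have [t2 e2] := t ord_max ord0; have [t3 e3] := t ord_max ord_max.
have fin (z : int) x : x = mu * mu' * (D%:Z)%:~R * z%:~R -> isint x.
  by move=> ->; apply: isintM => //; exists z.
have DnR : (n ord0 ord0)%:~R * (n ord_max ord_max)%:~R - (n ord0 ord_max)%:~R * (n ord_max ord0)%:~R = (D%:Z)%:~R :> R.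
  by rewrite -!rmorphM -rmorphB Dn.
move: Dg (Dg); rewrite {1}(mx2_eta g) det_mx22 => Dg' _.
rewrite (mx2_eta g) (mx2_eta h) invmx2 // mulmx2 !gE !hE e0 e1 e2 e3.
move=> i j; case: (ord2P i) => ->; case: (ord2P j) => ->; rewrite !mx2E.
- apply: (fin (1 + n ord_max ord_max * t0 - n ord0 ord_max * t2)); rewrite !(rmorphD, rmorphB, rmorphM) /= -DnR; ring.
- apply: (fin (n ord_max ord_max * t1 - n ord0 ord_max * t3)); rewrite !(rmorphD, rmorphB, rmorphM) /=; ring.
- apply: (fin (n ord0 ord0 * t2 - n ord_max ord0 * t0)); rewrite !(rmorphD, rmorphB, rmorphM) /=; ring.
- apply: (fin (1 + n ord0 ord0 * t3 - n ord_max ord0 * t1)); rewrite !(rmorphD, rmorphB, rmorphM) /= -DnR; ring.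
Qed.
End Colours.

(** * Finite index from colourings and packing *)

Section FiniteIndex.
Context {R : realType}.
Implicit Types (G H K : set 'M[R]_2) (g h : 'M[R]_2).

Definition SL2Z : set 'M[R]_2 := [set g | intmx g /\ \det g = 1].

(** A family of pairwise inequivalent elements of maximal size represents every coset. *)
Lemma finite_index_bounded H K B :
  (forall s : seq 'M[R]_2, (forall h, h \in s -> H h) ->
    pairwise (fun h h' => ~~ `[< K (invmx h *m h') >]) s -> (size s <= B)%N) -> finite_index H K.
Proof.
move=> HB; pose P n := `[< exists s : seq 'M[R]_2, [/\ size s = n, forall h, h \in s -> H h &
   pairwise (fun h h' => ~~ `[< K (invmx h *m h') >]) s] >].
have P0 : exists n, P n by exists 0%N; apply/asboolP; exists [::].
have PB n : P n -> (n <= B)%N by move/asboolP => [s [<- Hs ps]]; exact: HB.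
have [n /asboolP[s [sn Hs ps]] nmax] := ex_maxnP P0 PB.
exists s; split => // g Hg; apply: contrapT => nex.
have : P n.+1.
  apply/asboolP; exists (rcons s g); split.
  - by rewrite size_rcons sn.
  - by move=> h; rewrite mem_rcons inE => /orP[/eqP->|/Hs].
  rewrite pairwise_rcons ps andbT; apply/allP => h hs /=; apply/asboolPn => Kh; apply: nex; by exists h.
by move/nmax; rewrite ltnn.
Qed.

Lemma pairwise_inj (C : eqType) (col : 'M[R]_2 -> C) (e : rel 'M[R]_2) s :
  pairwise e s -> (forall g h, g \in s -> h \in s -> e g h -> col g != col h) -> uniq (map col s).
Proof.
elim: s => //= g s IH /andP[/allP eg ps] H; rewrite IH //; last first.
  by move=> u v us vs; apply: H; rewrite inE ?us ?vs orbT.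
rewrite andbT; apply/negP => /mapP[h hs E].
by have := H g h (mem_head _ _) _ (eg _ hs); rewrite inE hs orbT E eqxx => /(_ isT).
Qed.

Lemma intmxM g h : intmx g -> intmx h -> intmx (g *m h).
Proof.
move=> ig ih i j; rewrite mxE !big_ord_recl big_ord0 addr0.
by apply: isintD; apply: isintM.
Qed.

Lemma intmxV g : \det g = 1 -> intmx g -> intmx (invmx g).
Proof.
have [a [b [c [d ->]]]] := mx2_ex g; rewrite det_mx22 => D ig; rewrite invmx2 //.
have := ig ord0 ord0; have := ig ord0 ord_max; have := ig ord_max ord0; have := ig ord_max ord_max; rewrite !mx2E => id ic ib ia.
by move=> i j; case: (ord2P i) => ->; case: (ord2P j) => ->; rewrite !mx2E //; exact: isintN.
Qed.

Lemma small_integer (x : R) : isint x -> `|x| <= 10 -> exists k : 'I_21, x = k%:R - 10.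
Proof.
move=> [n ->]; rewrite -intr_norm -[10]/((10%:Z)%:~R) ler_int => n10.
have h : (`|(n + 10)%R|%N < 21)%N by lia.
exists (Ordinal h) => /=; rewrite -[X in X - _]/((`|(n + 10)%R|%N)%:Z%:~R) gez0_abs; last by lia.
by rewrite rmorphD /= addrK.
Qed.

Definition box_code g : {ffun 'I_2 * 'I_2 -> 'I_21} :=
  [ffun p => odflt ord0 [pick k : 'I_21 | g p.1 p.2 == (k : nat)%:R - 10]].

Lemma box_codeE g : intmx g -> (forall i j, `|g i j| <= 10) ->
  forall i j, g i j = (box_code g (i, j) : nat)%:R - 10.
Proof.
move=> ig gb i j; have [k kE] := small_integer (ig i j) (gb i j).
rewrite ffunE; case: pickP => [k' /eqP //|/(_ k)]; by rewrite /= kE eqxx.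
Qed.

(** Elements of G with equal colour differ by an integral matrix, which bounds the first index. For
    the second, [packs] is applied to inequivalent elements k_i of SL(2,Z): the pairs (g, i) with
    k_i g z in the box are determined by the colour of g^-1 and an integral matrix with entries of
    size at most 10. *)
Lemma finite_index_SL2Z G (K : int) : PSL_subgroup_preimage G -> packs G -> 0 < K ->
  (forall g, G g -> proj_integral K g) -> finite_index G (G `&` SL2Z) /\ finite_index SL2Z (G `&` SL2Z).
Proof.
move=> [dG G1 GN GM GV] [A HA] K0 HG; have [C [col Hcol]] := finite_colouring (R := R) K0.
have det1 g h : \det g = 1 -> \det h = 1 -> \det (invmx g *m h) = 1.
  by move=> Dg Dh; rewrite det_mulmx det_inv1 // Dh mulr1.
split.
  apply: (@finite_index_bounded _ _ #|C|) => s Hs ps.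
  rewrite -(size_map col); suff u : uniq (map col s) by rewrite -(card_uniqP u) max_card.
  apply: pairwise_inj ps _ => g h /Hs Gg /Hs Gh; apply: contraNneq => E; apply/asboolP; split.
    by apply: GM => //; exact: GV.
  by split; [apply: Hcol; rewrite ?dG //; exact: HG | apply: det1; exact: dG].
pose E := {ffun 'I_2 * 'I_2 -> 'I_21}.
apply: (@finite_index_bounded _ _ (#|{: C * E}| * A)) => s Hs ps.
pose k (i : 'I_(size s)) := nth 0 s i.
have kS i : SL2Z (k i) by apply: Hs; rewrite mem_nth.
have kd i : \det (k i) = 1 by case: (kS i).
apply: (HA (size s) #|{: C * E}| k) => // z Hz t ut Ht.
have ksep i j : (i != j) -> ~ (G `&` SL2Z) (invmx (k i) *m k j).
  wlog: i j / (i < j)%N.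
    move=> W ij; case: (ltngtP i j) => [||/val_inj e]; [by move=> h; apply: W|move=> h Kij|by rewrite e eqxx in ij].
    case: Kij => Gij [Iij Dij].
    have Dinv : invmx (invmx (k i) *m k j) = invmx (k j) *m k i.
      apply: invmx_right; first exact: unit_det1.
      by rewrite mulmxA mulmxK ?mulVmx ?unit_det1.
    apply: (W j i h); first by rewrite eq_sym.
    by rewrite -Dinv; split; [exact: GV | split; [exact: intmxV | exact: det_inv1]].
  move=> ij _; move/(pairwiseP 0): ps => /(_ i j); rewrite !inE => /(_ (ltn_ord i) (ltn_ord j) ij)/asboolPn.
  by [].
pose cl (p : 'M[R]_2 * 'I_(size s)) := col (invmx p.1).
pose w (p : 'M[R]_2 * 'I_(size s)) := k p.2 *m p.1.
have wd p : p \in t -> \det (w p) = 1 by move=> /Ht[Gp _]; rewrite det_mulmx kd dG // mulr1.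
have same p q : p \in t -> q \in t -> cl p = cl q -> (G `&` SL2Z) (p.1 *m invmx q.1).
  move=> /Ht[Gp _] /Ht[Gq _] E1; split; first by apply: GM => //; exact: GV.
  split; last by rewrite det_mulmx det_inv1 ?dG // mulr1.
  have := Hcol _ _ (det_inv1 (dG _ Gp)) (det_inv1 (dG _ Gq)) (HG _ (GV _ Gp)) (HG _ (GV _ Gq)) E1.
  by rewrite invmxK.
(* Within a colour class, [w p *m invmx (w q)] is an integral matrix moving a point of the box inside the box. *)
have ent p q : p \in t -> q \in t -> cl p = cl q ->
    forall i j, (w p *m invmx (w q)) i j = (box_code (w p *m invmx (w q)) (i, j) : nat)%:R - 10.
  move=> pt qt E1; have [Gpq [Ipq Dpq]] := same _ _ pt qt E1.
  have [Gp bp] := Ht _ pt; have [Gq bq] := Ht _ qt.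
  have uq : w q \in unitmx by apply: unit_det1; exact: wd.
  have D : \det (w p *m invmx (w q)) = 1 by rewrite det_mulmx det_inv1 ?wd // mulr1.
  apply: box_codeE.
    rewrite /w [invmx (_ *m _)](_ : _ = invmx q.1 *m invmx (k q.2)); last first.
      apply: invmx_right => //; rewrite mulmxA mulmxK ?mulmxV ?unit_det1 // dG //.
    rewrite mulmxA -(mulmxA (k p.2)); apply: intmxM; last by apply: intmxV => //; case: (kS q.2).
    by apply: intmxM => //; case: (kS p.2).
  apply: (box_entries D bq).
  by rewrite -mobius_mul ?D ?wd // mulmxKV.
(* A reference pair for each colour: the first one of that colour in [t]. *)
pose base p := nth p t (find (fun q => cl q == cl p) t).
have baseP p : p \in t -> base p \in t /\ cl (base p) = cl p.
  move=> pt; have hp : has (fun q => cl q == cl p) t by apply/hasP; exists p.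
  by split; [rewrite mem_nth // -has_find | apply/eqP; exact: (nth_find p hp)].
have baseE p q : p \in t -> cl p = cl q -> base p = base q.
  move=> pt E1; rewrite /base E1; apply: set_nth_default; rewrite -has_find.
  by apply/hasP; exists p => //; rewrite E1.
pose f p : C * E := (cl p, box_code (w p *m invmx (w (base p)))).
rewrite -(size_map f); suff u : uniq (map f t) by rewrite -(card_uniqP u) max_card.
rewrite map_inj_in_uniq // => p q pt qt [E1 E2].
have [bt bE] := baseP p pt; have bq := baseE _ _ pt E1.
have wE : w p = w q.
  have ub : w (base p) \in unitmx by apply: unit_det1; exact: wd.
  rewrite -[w p](mulmxKV ub) -[w q](mulmxKV ub); congr (_ *m _); apply/matrixP => i j.
  by rewrite ent ?bE // E2 -bq -ent // bE.
have kE : invmx (k q.2) *m k p.2 = q.1 *m invmx p.1.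
  have up1 : p.1 \in unitmx by apply/unit_det1/dG; have [] := Ht _ pt.
  rewrite -[LHS](mulmxK up1) -(mulmxA _ (k p.2)) -/(w p) wE /w.
  by rewrite mulmxA mulVmx ?mul1mx ?unit_det1.
have p2 : p.2 = q.2.
  apply/eqP; apply: contrapT => /negP; rewrite eq_sym => h; apply: (ksep _ _ h).
  by rewrite kE; exact: same.
have p1 : p.1 = q.1.
  by move: wE; rewrite /w p2 => /(congr1 (mulmx (invmx (k q.2)))); rewrite !mulKmx ?unit_det1.
by case: p q p1 p2 {pt qt E1 E2 bt bE bq wE kE} => ? ? [? ?] /= -> ->.
Qed.
End FiniteIndex.

(** * The rational quaternion algebra M(2,Q) *)

Section ArithmeticWitness.
Context {R : realType}.
Implicit Types (G H K : set 'M[R]_2) (g h m : 'M[R]_2).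

Lemma conj_set_mul (s t : 'M[R]_2) G : \det s = 1 -> \det t = 1 ->
  conj_set t (conj_set s G) = conj_set (s *m t) G.
Proof.
move=> Ds Dt; apply/funext => g; rewrite /conj_set /=; congr G.
rewrite [invmx (s *m t)](_ : _ = invmx t *m invmx s) ?mulmxA //.
by apply: invmx_right; rewrite ?unit_det1 ?det_mulmx ?Ds ?Dt ?mulr1 // mulmxA mulmxK ?mulmxV ?unit_det1.
Qed.

Lemma finite_index_conj (t : 'M[R]_2) H K : \det t = 1 -> (forall h, H h -> \det h = 1) ->
  finite_index (conj_set t H) (conj_set t K) -> finite_index H K.
Proof.
move=> Dt dH [s [Hs sP]]; have ut := unit_det1 Dt.
exists [seq t *m h *m invmx t | h <- s]; split; first by move=> _ /mapP[h /Hs Hh ->].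
move=> g Hg; have [|h hs Kh] := sP (invmx t *m g *m t).
  by rewrite /conj_set /= mulmxA mulmxK // mulmxA mulmxV // mul1mx.
exists (t *m h *m invmx t); first exact: map_f.
have uh := unit_det1 (dH _ (Hs _ hs)).
have uh' : h \in unitmx by move: uh; rewrite !unitmx_mul unitmx_inv ut andbT.
move: Kh; rewrite /conj_set /= (_ : invmx (t *m h *m invmx t) = t *m invmx h *m invmx t).
  by rewrite !mulmxA mulmxK.
by apply: invmx_right => //; rewrite !mulmxA mulmxKV // mulmxK // mulmxV.
Qed.

Lemma rat_embedding (T : numFieldType) (s : R -> T) : field_embedding [set x | israt x] s ->
  forall q : rat, s (ratr q) = ratr q.
Proof.
move=> [s1 sD sM].
have s0 : s 0 = 0 by apply: (addrI (s 0)); rewrite -sD ?addr0 //; exact: israt0.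
have sN x : israt x -> s (- x) = - s x.
  by move=> rx; apply: (addrI (s x)); rewrite -sD ?subrr //; exact: isratN.
have sn n : s n%:R = n%:R.
  by elim: n => // n IH; rewrite -!natr1 sD ?s1 ?IH //; [exact: israt_nat | exact: israt1].
have sz (z : int) : s z%:~R = z%:~R.
  by case: z => n; rewrite ?NegzE ?mulrNz ?sN -?pmulrn ?sn //; exact: israt_nat.
move=> q; have dq : (denq q)%:~R != 0 :> T by rewrite intr_eq0.
apply: (mulIf dq); rewrite -sz -sM; [|by exists q|exact: israt_int].
rewrite /ratr divfK ?intr_eq0 // sz divfK //.
Qed.

Lemma number_field_rat : number_field [set x : R | israt x].
Proof.
split; first by split; [exact: israt1 | move=> x y; exact: isratB | move=> x y; exact: isratM | move=> x rx _; exact: isratV].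
exists [:: 1]; split => [e|x [q ->]]; first by rewrite inE => /eqP ->; exact: israt1.
by exists (fun=> q); rewrite big_ord1 /= mulr1.
Qed.

Lemma totally_real_rat : totally_real [set x : R | israt x].
Proof.
move=> s es x [q ->]; rewrite (rat_embedding es).
have -> : ratr q = (ratr q)%:C%C :> R[i] by rewrite fmorph_rat.
by [].
Qed.

(** The identity is the only embedding of the rationals, so there is no other real place. *)
Lemma ramified_rat : ramified_except_identity [set x : R | israt x] 1 1.
Proof.
split; first by rewrite ltr10 => -[].
by move=> s es [_ [q ->]]; rewrite (rat_embedding es) eqxx.
Qed.

Definition intconj (t : 'M[R]_2) : set 'M[R]_2 := [set m | intmx (invmx t *m m *m t)].

Lemma israt_denominator (x : R) : israt x -> exists2 m : nat, (0 < m)%N & isint (x *+ m).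
Proof.
move=> /israt_frac[e [f [f0 _ ->]]]; exists f => //; exists e.
by rewrite -[_ / _ *+ _]mulr_natr divfK // pnatr_eq0 -lt0n.
Qed.

(** In the basis 1, diag(1, -1), the exchange matrix and their product, the coordinates of a matrix
    are half sums and half differences of its entries. Hence the algebra is t M(2,Q) t^-1, with the
    order t M(2,Z) t^-1. *)
Lemma order_image_intconj (t : 'M[R]_2) : \det t = 1 ->
  order_image [set x : R | israt x] (t *m mx2 1 0 0 (-1) *m invmx t) (t *m mx2 0 1 1 0 *m invmx t) (intconj t).
Proof.
move=> Dt; have ut := unit_det1 Dt.
pose c m := t *m m *m invmx t.
have cK m : invmx t *m c m *m t = m by rewrite /c !mulmxA mulVmx // mul1mx mulmxKV.
have Kc m : c (invmx t *m m *m t) = m by rewrite /c !mulmxA mulmxV // mul1mx mulmxK.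
have cM m n : c m *m c n = c (m *m n) by rewrite /c !mulmxA mulmxKV.
have cD m n : c m + c n = c (m + n) by rewrite /c mulmxDr mulmxDl.
have cZ (k : R) m : k *: c m = c (k *: m) by rewrite /c -scalemxAr -scalemxAl.
have c1 (k : R) : k%:M = c k%:M by rewrite /c scalar_mxC -mulmxA mulmxV // mulmx1.
rewrite -/(c (mx2 1 0 0 (-1))) -/(c (mx2 0 1 1 0)).
have qE (x0 x1 x2 x3 : R) : x0%:M + x1 *: c (mx2 1 0 0 (-1)) + x2 *: c (mx2 0 1 1 0) + x3 *: (c (mx2 1 0 0 (-1)) *m c (mx2 0 1 1 0)) =
  c (mx2 (x0 + x1) (x2 + x3) (x2 - x3) (x0 - x1)).
  rewrite cM !cZ c1 !cD; congr c; rewrite mulmx2 !scalemx2 scalar_mx2 !addmx2; congr mx2; ring.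
have r2 : israt (2^-1 : R) by apply/isratV/israt_nat.
have ir x : isint x -> israt x by move=> [n ->]; exact: israt_int.
split.
- move=> m Om; pose n := invmx t *m m *m t.
  have [p [q [r [s nE]]]] := mx2_ex n.
  have ip : isint p by have := Om ord0 ord0; rewrite -/n nE mx2E.
  have iq : isint q by have := Om ord0 ord_max; rewrite -/n nE mx2E.
  have ir' : isint r by have := Om ord_max ord0; rewrite -/n nE mx2E.
  have is_ : isint s by have := Om ord_max ord_max; rewrite -/n nE mx2E.
  exists ((p + s) / 2), ((p - s) / 2), ((q + r) / 2), ((q - r) / 2); split.
  1-4: by apply: isratM => //; first [apply: isratB; exact: ir | apply: isratD; exact: ir].
  by rewrite qE -[LHS]Kc -/n nE; congr c; congr mx2; field.
- by rewrite /intconj /= (_ : (1 : 'M[R]_2) = 1%:M) // mulmx1 mulVmx // => i j; rewrite mxE; exists (i == j)%:Z.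
- move=> m n Om On; rewrite /intconj /= mulmxBr mulmxBl => i j; rewrite mxE [X in _ + X]mxE.
  by apply: isintD; [exact: Om | apply: isintN; exact: On].
- split.
    move=> m n Om On; have -> : m *m n = c ((invmx t *m m *m t) *m (invmx t *m n *m t)) by rewrite -cM !Kc.
    by rewrite /intconj /= cK; exact: intmxM.
  exists [:: c (mx2 1 0 0 0); c (mx2 0 1 0 0); c (mx2 0 0 1 0); c (mx2 0 0 0 1)]; split.
    have i0 : isint (0 : R) by exists 0.
    have i1 : isint (1 : R) by exists 1.
    move=> e; rewrite !inE => /or4P[] /eqP -> ; rewrite /intconj /= cK => i j; case: (ord2P i) => ->; case: (ord2P j) => ->; rewrite mx2E //.
  move=> m Om; pose n := invmx t *m m *m t; have [p [q [r [s nE]]]] := mx2_ex n.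
  have [zp pE] : isint p by have := Om ord0 ord0; rewrite -/n nE mx2E.
  have [zq qE'] : isint q by have := Om ord0 ord_max; rewrite -/n nE mx2E.
  have [zr rE] : isint r by have := Om ord_max ord0; rewrite -/n nE mx2E.
  have [zs sE] : isint s by have := Om ord_max ord_max; rewrite -/n nE mx2E.
  exists (fun i => nth 0 [:: zp; zq; zr; zs] i).
  rewrite !big_ord_recl big_ord0 /= addr0 -![c _ *~ _]scaler_int !cZ !cD -[LHS]Kc -/n nE; congr c.
  by rewrite !scalemx2 !addmx2 pE qE' rE sE; congr mx2; ring.
- move=> x [x0 [x1 [x2 [x3 [r0 r1 r2' r3 ->]]]]]; rewrite qE.
  have [m0 p0 i0] := israt_denominator r0; have [m1 p1 i1] := israt_denominator r1.
  have [m2 p2 i2] := israt_denominator r2'; have [m3 p3 i3] := israt_denominator r3.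
  exists (m0 * m1 * m2 * m3)%N; first by rewrite !muln_gt0 p0 p1 p2.
  have im (y : R) a b : isint (y *+ a) -> isint (y *+ (a * b)).
    by move=> h; rewrite mulrnA -mulr_natr; apply: isintM => //; exists b%:Z.
  set M := (_ * _)%N.
  have I0 : isint (x0 *+ M) by rewrite /M -!mulnA; exact: im.
  have I1 : isint (x1 *+ M) by rewrite /M (mulnC m0) -!mulnA; exact: im.
  have I2 : isint (x2 *+ M) by rewrite /M (mulnC _ m2) -!mulnA; exact: im.
  have I3 : isint (x3 *+ M) by rewrite /M (mulnC _ m3); exact: im.
  rewrite /intconj /= -scaler_nat cZ cK scalemx2 => i j.
  have e (y : R) : M%:R * y = y *+ M by rewrite mulr_natl.
  case: (ord2P i) => ->; case: (ord2P j) => ->; rewrite mx2E ?mulrDr ?mulrN !e; apply: isintD => //; exact: isintN.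
Qed.

Lemma arithmetic_of_SL2Z G (t : 'M[R]_2) : \det t = 1 -> (forall g, G g -> \det g = 1) ->
  finite_index (conj_set t G) (conj_set t G `&` SL2Z) -> finite_index SL2Z (conj_set t G `&` SL2Z) ->
  arithmetic_group G.
Proof.
move=> Dt dG h1 h2; have ut := unit_det1 Dt.
have E : conj_set t (norm_one (intconj t)) = SL2Z.
  apply/funext => g; rewrite /conj_set /norm_one /SL2Z /intconj /=.
  by rewrite !det_mulmx Dt det_inv1 // mul1r mulr1 !mulmxA mulVmx // mul1mx mulmxKV.
have EI : conj_set t (G `&` norm_one (intconj t)) = conj_set t G `&` SL2Z by rewrite -E.
exists [set x | israt x], 1, 1, (t *m mx2 1 0 0 (-1) *m invmx t), (t *m mx2 0 1 1 0 *m invmx t), (intconj t).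
have cM m n : (t *m m *m invmx t) *m (t *m n *m invmx t) = t *m (m *m n) *m invmx t.
  by rewrite !mulmxA mulmxKV.
split; [exact: number_field_rat | exact: totally_real_rat | | exact: ramified_rat | split].
- by split; [exact: israt1 | exact: israt1 | exact: oner_neq0 | exact: oner_neq0].
- split; rewrite !cM !mulmx2.
  + by rewrite (_ : mx2 _ _ _ _ = 1%:M) ?mulmx1 ?mulmxV // scalar_mx2; congr mx2; ring.
  + by rewrite (_ : mx2 _ _ _ _ = 1%:M) ?mulmx1 ?mulmxV // scalar_mx2; congr mx2; ring.
  + by rewrite -mulNmx -mulmxN oppmx2; congr (_ *m _ *m _); congr mx2; ring.
- exact: order_image_intconj.
- by split; apply: (finite_index_conj Dt); rewrite ?EI ?E // => h [].
Qed.
End ArithmeticWitness.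

Theorem theoremA (R : realType) (G : set 'M[R]_2) (c : nat -> nat) :
  PSL_subgroup_preimage G ->
  nonuniform_lattice G ->
  (forall n : nat, exists s : seq R,
      [/\ uniq s, size s = c n &
          forall t, t \in s <-> (trace_set G t /\ `|t| <= n%:R)]) ->
  (fun n : nat => (c n)%:R / (n%:R * lll R n)) @ \oo --> (0 : R) ->
  arithmetic_group G.
Proof.
move=> gG [lG ncG] HT Hc; have [dG G1 _ _ _] := gG.
have pG := lattice_packs gG lG; have sG := trace_sparse HT Hc.
(* The finiteness of the traces in [-3, 3] isolates the trace 2, as [unipotent_exists] requires. *)
have [s3 [_ _ Hs3]] := HT 3%N.
have [g [Gg tg g1]] := unipotent_exists gG pG ncG (fun t Tt t3 => (Hs3 t).2 (conj Tt t3)).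
have [s [Ds gs]] := unipotent_conj (dG _ Gg) tg g1.
have us := unit_det1 Ds.
have gG0 := conj_group Ds gG; have pG0 := conj_packs Ds dG pG.
have iG0 := conj_isolated Ds lG.1 G1.
have sparse_conj (t : 'M[R]_2) : \det t = 1 -> sparse (trace_set (conj_set t G)).
  move=> Dt; rewrite (_ : trace_set _ = trace_set G) //; apply/seteqP; split => x /(conj_trace G x Dt) //.
have GT0 : conj_set s G (unip 1).
  have [_ _ _ _ GV0] := gG0.
  case: gs => gE; first by rewrite /conj_set /= -gE.
  by rewrite -[1]opprK -unipV; apply: GV0; rewrite /conj_set /= -gE.
have [x [g0 Gg0 [a0 c0 rG]]] := sparse_projrat gG0 (sparse_conj _ Ds) GT0 (lower_nonzero gG0 pG0 iG0 GT0).
have Dx : \det (unip x) = 1 by rewrite /unip det_mx22; ring.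
have Dt : \det (s *m unip x) = 1 by rewrite det_mulmx Ds Dx mulr1.
have GT : conj_set (unip x) (conj_set s G) (unip 1) by exact: conj_unip.
rewrite conj_set_mul // in Gg0 rG GT.
have gG' := conj_group Dt gG; have sG' := sparse_conj _ Dt.
have iG' := conj_isolated Dt lG.1 G1.
move: Gg0 c0; rewrite (mx2_eta g0) a0 mx2E => Gg0 c0.
have [nu nu0 GL] := lower_integral gG' sG' GT iG' rG Gg0 c0.
have nu2 : 0 < nu ^+ 2 by rewrite exprn_gt0.
have [f1 f2] := finite_index_SL2Z gG' (conj_packs Dt dG pG) nu2
  (fun h Gh => group_proj_integral gG' sG' GT iG' rG nu0 GL Gh).
exact: arithmetic_of_SL2Z Dt dG f1 f2.
Qed.
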